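(* Let $k\ge2$ be an integer, $\rho\in(0,1)$, and let $D\subset\mathbb R^2$ be a polygon of diameter $h_D$ that is shape regular with parameter $\rho$. Then there is a constant $C$ depending only on $k$ and $\rho$ such that for every $\xi\in H^2(D)$, $$\|\Pi^\Delta_{k,D}\xi\|_{L^2(D)}+h_D|\Pi^\Delta_{k,D}\xi|_{H^1(D)}+h_D^2|\Pi^\Delta_{k,D}\xi|_{H^2(D)}\le C\,|||\xi|||_{k,D}.$$
   Context: Shape regularity with parameter $\rho$: every edge $e$ of $D$ has length $|e|\ge\rho h_D$, and $D$ is star shaped with respect to a disc of radius $\rho h_D$. $\mathcal E_D$ is the set of edges of $D$. $\mathbb P_j$ is the space of polynomials of total degree $\le j$ ($\mathbb P_j=\{0\}$ for $j<0$). $r\ge\max\{3,k\}$ is a fixed integer. $\Pi^0_{j,D}$ and $\Pi^0_{j,e}$ are the $L^2$-orthogonal projections onto $\mathbb P_j(D)$ and $\mathbb P_j(e)$ (zero if $j<0$). The semi-norm on $H^2(D)$ is $$|||\xi|||_{k,D}^2=\|\Pi^0_{k-4,D}\xi\|_{L^2(D)}^2+h_D\sum_{e\in\mathcal E_D}\|\Pi^0_{r,e}\xi\|_{L^2(e)}^2+h_D^3\sum_{e\in\mathcal E_D}\sum_{i=1}^2\Big\|\Pi^0_{r-1,e}\frac{\partial\xi}{\partial x_i}\Big\|_{L^2(e)}^2.$$ $\Pi^\Delta_{k,D}:H^2(D)\to\mathbb P_k(D)$ is defined by $((\Pi^\Delta_{k,D}\xi,q))_D=((\xi,q))_D$ for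 all $q\in\mathbb P_k(D)$, $\int_{\partial D}\nabla\Pi^\Delta_{k,D}\xi\,ds=\int_{\partial D}\nabla\xi\,ds$, $\int_{\partial D}\Pi^\Delta_{k,D}\xi\,ds=\int_{\partial D}\xi\,ds$, where $((\xi,v))_D=\int_D\sum_{i,j=1}^2\frac{\partial^2\xi}{\partial x_i\partial x_j}\frac{\partial^2v}{\partial x_i\partial x_j}\,dx$. *)

(* Defs.v *)
From mathcomp Require Import all_boot all_order all_algebra.
From mathcomp Require Import all_classical all_reals all_analysis.

Set Implicit Arguments.
Unset Strict Implicit.
Unset Printing Implicit Defensive.

Import Order.TTheory GRing.Theory Num.Theory.
Import numFieldNormedType.Exports.

Local Open Scope classical_set_scope.
Local Open Scope ring_scope.

Section Geometry.
Variable R : realType.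

(* The library norm on R * R is the maximum norm, hence an explicit
   Euclidean norm. *)
Definition enorm (x : R * R) : R := Num.sqrt (x.1 ^+ 2 + x.2 ^+ 2).

Definition disc (c : R * R) (s : R) : set (R * R) :=
  [set x | enorm (x - c) < s].

Definition diam (D : set (R * R)) : R :=
  sup [set d | exists x y, [/\ D x, D y & d = enorm (x - y)]].

Definition star_shaped (D B : set (R * R)) : Prop :=
  forall (x y : R * R) (t : R), D x -> B y -> 0 <= t -> t <= 1 ->
    D ((1 - t) *: y + t *: x).

(* The i-th edge joins v i to its cyclic successor. *)
Definition edge_pt n (v : 'I_n -> R * R) (i : 'I_n) (t : R) : R * R :=
  (1 - t) *: v i + t *: v (ordS i).

Definition edge_length n (v : 'I_n -> R * R) (i : 'I_n) : R :=
  enorm (v (ordS i) - v i).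

(* The injectivity clause says that the closed polygonal line through the
   vertices is simple; D is then the bounded component of its complement.
   Angles equal to pi are allowed. *)
Definition polygon n (v : 'I_n -> R * R) (D : set (R * R)) : Prop :=
  [/\ (3 <= n)%N,
      forall (i j : 'I_n) (s t : R), 0 <= s < 1 -> 0 <= t < 1 ->
        edge_pt v i s = edge_pt v j t -> i = j /\ s = t,
      open D, bounded_set D &
      closure D `\` D =
        [set x | exists (i : 'I_n) (t : R), 0 <= t <= 1 /\ x = edge_pt v i t]].

Definition shape_regular (rho : R) n (v : 'I_n -> R * R) (D : set (R * R)) :=
  (forall i, rho * diam D <= edge_length v i) /\
  (exists c, star_shaped D (disc c (rho * diam D))).

End Geometry.

Section Calculus.
Variable R : realType.
Implicit Types (f g u p q : R * R -> R) (D : set (R * R)).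

Definition basis_vec (i : 'I_2) : R * R := ((i == 0)%:R, (i == 1)%:R).

Definition pd (i : 'I_2) f : R * R -> R := fun x => 'D_(basis_vec i) f x.

(* All iterated partial derivatives exist and are continuous. *)
Definition smooth f : Prop :=
  forall s : seq 'I_2,
    continuous (foldr pd f s) /\
    forall i x, derivable (foldr pd f s) x (basis_vec i).

Definition test_function D f : Prop :=
  [/\ smooth f, compact (closure [set x | f x != 0]) &
      closure [set x | f x != 0] `<=` D].

Definition dint D f : R :=
  (\int[(lebesgue_measure \x lebesgue_measure)%E]_(x in D) f x)%R.

(* Line integral with respect to arc length along the i-th edge. *)
Definition eint n (v : 'I_n -> R * R) (i : 'I_n) f : R :=
  edge_length v i *
    (\int[lebesgue_measure]_(t in `[0%R : R, 1%R : R]) f (edge_pt v i t))%R.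

Definition bint n (v : 'I_n -> R * R) f : R := \sum_(i < n) eint v i f.

(* The L^2 norm associated with an integral I, used with I := dint D and
   I := eint v i. *)
Definition l2norm (I : (R * R -> R) -> R) f : R :=
  Num.sqrt (I (fun x => f x ^+ 2)).

Definition inL2 D f : Prop :=
  measurable_fun D f /\
  (lebesgue_measure \x lebesgue_measure)%E.-integrable D
    (fun x => (f x ^+ 2)%:E).

Definition inL2_edge n (v : 'I_n -> R * R) (i : 'I_n) f : Prop :=
  measurable_fun `[0%R : R, 1%R : R] (fun t : R => f (edge_pt v i t)) /\
  lebesgue_measure.-integrable `[0%R : R, 1%R : R]
    (fun t : R => (f (edge_pt v i t) ^+ 2)%:E).

Definition is_weak_pd D (i : 'I_2) u g : Prop :=
  inL2 D g /\
  forall f, test_function D f ->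
    dint D (fun x => u x * pd i f x) = - dint D (fun x => g x * f x).

Definition weak_pd D (i : 'I_2) u : R * R -> R :=
  xget (cst 0) [set g | is_weak_pd D i u g].

Definition inH1 D u : Prop :=
  inL2 D u /\ forall i, exists g, is_weak_pd D i u g.

Definition inH2 D u : Prop := inH1 D u /\ forall i, inH1 D (weak_pd D i u).

(* g, of which only the values on the boundary matter, is the trace of u in
   H^1(D): the L^2 limit on each edge of restrictions of smooth functions
   that converge to u in H^1(D). *)
Definition is_trace n (v : 'I_n -> R * R) D u g : Prop :=
  (forall e, inL2_edge v e g) /\
  exists phi : nat -> R * R -> R,
    [/\ forall m, smooth (phi m),
        l2norm (dint D) (phi m \- u) @[m --> \oo] --> (0 : R),
        forall i, l2norm (dint D) (pd i (phi m) \- weak_pd D i u)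
                    @[m --> \oo] --> (0 : R) &
        forall e, l2norm (eint v e) (phi m \- g) @[m --> \oo] --> (0 : R)].

Definition trace n (v : 'I_n -> R * R) D u : R * R -> R :=
  xget (cst 0) [set g | is_trace v D u g].

(* Polynomial functions of total degree at most j; only 0 when j < 0. *)
Definition poly_space (j : int) : set (R * R -> R) :=
  [set f | exists c : nat -> nat -> R, f = fun x =>
     \sum_(a < `|j|.+1) \sum_(b < `|j|.+1 | (a + b)%:Z <= j)
       c a b * x.1 ^+ a * x.2 ^+ b].

Definition is_l2proj (I : (R * R -> R) -> R) (j : int) f p : Prop :=
  poly_space j p /\
  forall q, poly_space j q ->
    I (fun x => p x * q x) = I (fun x => f x * q x).

(* For I := eint v e, the restrictions to the edge of the members of
   poly_space j are exactly the polynomials of degree at most j in the arc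
   length, so that the projection is determined on the edge, and only there. *)
Definition l2proj (I : (R * R -> R) -> R) (j : int) f : R * R -> R :=
  xget (cst 0) [set p | is_l2proj I j f p].

Definition hess f (i j : 'I_2) : R * R -> R := pd i (pd j f).

Definition weak_hess D u (i j : 'I_2) : R * R -> R :=
  weak_pd D i (weak_pd D j u).

Definition hess_form D (A B : 'I_2 -> 'I_2 -> R * R -> R) : R :=
  dint D (fun x => \sum_(i < 2) \sum_(j < 2) A i j x * B i j x).

(* Boundary values of xi and of its gradient are traces; those of the
   polynomial p are its restrictions. *)
Definition is_PiDelta (k : nat) n (v : 'I_n -> R * R) D xi p : Prop :=
  [/\ poly_space k%:Z p,
      forall q, poly_space k%:Z q ->
        hess_form D (hess p) (hess q) = hess_form D (weak_hess D xi) (hess q),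
      forall i, exists g,
        is_trace v D (weak_pd D i xi) g /\ bint v (pd i p) = bint v g &
      exists g, is_trace v D xi g /\ bint v p = bint v g].

Definition PiDelta (k : nat) n (v : 'I_n -> R * R) D xi : R * R -> R :=
  xget (cst 0) [set p | is_PiDelta k v D xi p].

Definition triple_norm (k r : nat) n (v : 'I_n -> R * R) D xi : R :=
  Num.sqrt
    (l2norm (dint D) (l2proj (dint D) (k%:Z - 4) xi) ^+ 2
     + diam D * \sum_(e < n)
         l2norm (eint v e) (l2proj (eint v e) r%:Z (trace v D xi)) ^+ 2
     + diam D ^+ 3 * \sum_(e < n) \sum_(i < 2)
         l2norm (eint v e)
           (l2proj (eint v e) (r%:Z - 1) (trace v D (weak_pd D i xi))) ^+ 2).

(* Sobolev seminorms of smooth functions (applied to polynomials only, whose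
   weak and classical derivatives agree). *)
Definition h1seminorm D f : R :=
  Num.sqrt (\sum_(i < 2) l2norm (dint D) (pd i f) ^+ 2).

Definition h2seminorm D f : R :=
  Num.sqrt (\sum_(i < 2) \sum_(j < 2) l2norm (dint D) (hess f i j) ^+ 2).

End Calculus.

(* Main.v *)
(* Cutting [D] into the triangles joining the center [c] of the disc to the
   edges, star-shapedness gives Green's formula with a normal field [nu] with
   [nu . (x - c) >= rho h] on the boundary, [h = h_D]; applied to [x - c] it
   bounds the perimeter by [8 h / rho].  Let [T] be the triple norm of [xi] and
   [p] its projection.  Testing the definition of [p] with [q = p] and
   integrating by parts twice, the square of the H^2 seminorm of [p] becomes a
   sum of integrals, over [D] and over the edges, of [xi] and of its first
   derivatives against derivatives of [p] of order two to four.  These are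
   polynomials of so low a degree that [xi] may be replaced by its projections,
   and the inverse estimates for polynomials give [h^2 |p|_{H^2} <= C T].  The
   conditions on the boundary integrals bound the means of [grad p] and [p] on
   the boundary in terms of [T], and their oscillations are controlled by the
   second, respectively first, derivatives of [p], which yields the pointwise
   bounds [|grad p| <= C T / h^2] and [|p| <= C T / h]. *)

(* The constant may see neither [r] nor the number of edges. Boundary terms are therefore never
   counted edge by edge: Cauchy-Schwarz over the edges, weighted by the square roots of their
   lengths, turns them into the perimeter. As [D] is in general not convex, mean value arguments
   take place in the square of half-side [h] centred at [c], which contains the closure of [D];
   polynomials live on the whole plane, and the inverse estimates bound them on that square by their
   norm on [D]. Traces and projection are picked by choice. If the projection exists, its definition
   itself supplies traces of [xi] and of its gradient, and the estimate is proved for every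
   polynomial satisfying that definition. A trace named there need not be the chosen one; since all
   traces have the same edge integrals, the two can be exchanged. *)
Require Import Defs.
From mathcomp Require Import all_boot all_order all_algebra.
From mathcomp Require Import all_classical all_reals all_analysis.
From mathcomp Require Import measurable_realfun ring lra zify.
Import Order.TTheory GRing.Theory Num.Theory.
Import numFieldNormedType.Exports.
Local Open Scope classical_set_scope.
Local Open Scope ring_scope.

Set Implicit Arguments.
Unset Strict Implicit.
Unset Printing Implicit Defensive.

(** * Affine changes of variables *)

Section AffineChange.
Variable R : realType.
Notation leb := (@lebesgue_measure R).
Notation leb2 := ((leb \x leb)%E).

(** The product sigma-algebra is generated by rectangles, so [O] is written as the union of the
    countably many boxes with rational centre and radius 1/(n+1) that it contains. *)
Lemma open_measurable2 (O : set (R * R)) : open O -> measurable O.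
Proof.
move=> oO.
pose F (k : rat * rat * nat) : set (R * R) :=
  let B := (ball (ratr k.1.1 : R) (k.2.+1%:R^-1 : R)) `*`
           (ball (ratr k.1.2 : R) (k.2.+1%:R^-1 : R)) in
  [set x | B x /\ B `<=` O].
have -> : O = \bigcup_k F k.
  apply/seteqP; split=> [x Ox|x [k _ [Bx BO]]]; last exact: BO.
  have /nbhs_ballP[e /= e0 xeO] : nbhs x O by exact: open_nbhs_nbhs.
  (* The radius is below e/2: the centre is that close to [x] and the box that close to its centre,
     so the box stays within [e] of [x]. *)
  pose n := Num.truncn (2 / e).
  have ne : n.+1%:R^-1 < e / 2.
    rewrite invf_plt ?posrE ?divr_gt0//.
    by rewrite invf_div truncnS_gt.
  have n0 : 0 < n.+1%:R^-1 :> R by rewrite invr_gt0 ltr0n.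
  have rat_near (d y : R) : 0 < d -> exists q : rat, `|y - ratr q| < d.
    move=> d0; have ylt : y - d < y + d by lra.
    have [q] := rat_in_itvoo ylt.
    rewrite in_itv/= => /andP[q1 q2]; exists q.
    by rewrite ltr_norml; apply/andP; split; lra.
  have [q1 xq1] := rat_near _ x.1 n0; have [q2 xq2] := rat_near _ x.2 n0.
  exists (q1, q2, n) => //; split => /=.
    by split; rewrite /ball/= distrC.
  move=> y [/= yq1 yq2]; apply: xeO.
  move: xq1 xq2 yq1 yq2 ne; rewrite /ball/=.
  move: (n.+1%:R^-1) => d xq1 xq2 yq1 yq2 ne.
  split; rewrite /ball/=.
    rewrite (le_lt_trans (ler_distD (ratr q1) _ _))//; lra.
  rewrite (le_lt_trans (ler_distD (ratr q2) _ _))//; lra.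
apply: countable_bigcupT_measurable => [|k]; first exact: countableP.
rewrite /F; set B := _ `*` _.
have mB : measurable B.
  by apply: measurableX; exact: measurable_ball.
have [BO|BO] := pselect (B `<=` O).
  by rewrite (_ : [set x | _] = B)//; apply/seteqP; split=> x // [].
by rewrite (_ : [set x | _] = set0)//; apply/seteqP; split=> x // [].
Qed.

Lemma continuous_measurable_fun2 (f : R * R -> R) (D : set (R * R)) :
  continuous f -> measurable D -> measurable_fun D f.
Proof.
move=> cf mD; apply: measurable_funTS.
apply: (measurability _ (RGenOInfty.measurableE R)).
move=> /= _ [_ [a ->] <-]; apply: measurableI => //.
apply: open_measurable2; apply: open_comp => //; exact: open_gt.
Qed.

(** The pushforward of Lebesgue measure, scaled by [|a|], agrees with Lebesgue measure on half-open
    intervals; uniqueness does the rest. *)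
Lemma lebesgue_measure_affine (a b : R) (A : set R) : a != 0 -> measurable A ->
  (leb A = (`|a|)%:E * leb ((fun t => a * t + b)%R @^-1` A))%E.
Proof.
move=> a0 mA.
have mf : measurable_fun [set: measurableTypeR R]
    (fun t : measurableTypeR R => (a * t + b : measurableTypeR R)).
  apply: continuous_measurable_fun => t; apply: cvgD; last exact: cvg_cst.
  by apply: cvgM; [exact: cvg_cst|exact: cvg_id].
pose m := mscale (NngNum (normr_ge0 a)) (pushforward leb (fun t : measurableTypeR R => (a * t + b : measurableTypeR R))).
rewrite (@lebesgue_measure_unique R (m mf) _ A mA)//.
move=> _ [[x y] _ <-].
rewrite -[RHS]/((`|a|)%:E * leb ((fun t => a * t + b)%R @^-1` `]x, y]%classic))%E.
have [xy|yx] := ltP x y; last first.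
  by rewrite set_itv_ge ?bnd_simp -?leNgt// preimage_set0 !measure0 mule0.
rewrite lebesgue_measure_itv/= lte_fin xy.
have [ap|an|a0'] := ltgtP 0 a; last by rewrite a0' eqxx in a0.
- rewrite (_ : _ @^-1` _ = `](x - b) / a, (y - b) / a]%classic); last first.
    apply/seteqP; split => t /=; rewrite !in_itv/= ltr_pdivrMr// ler_pdivlMr//;
      move=> /andP[? ?]; apply/andP; split; lra.
  rewrite lebesgue_measure_itv/= lte_fin ltr_pM2r ?invr_gt0// ltrD2r xy.
  rewrite gtr0_norm// -!EFinD -EFinM; congr EFin; field; lra.
- rewrite (_ : _ @^-1` _ = `[(y - b) / a, (x - b) / a[%classic); last first.
    apply/seteqP; split => t /=; rewrite !in_itv/= ltr_ndivlMr// ler_ndivrMr//;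
      move=> /andP[? ?]; apply/andP; split; lra.
  rewrite lebesgue_measure_itv/= lte_fin ltr_nM2r ?invr_lt0// ltrD2r xy.
  rewrite ltr0_norm// -!EFinD -EFinM; congr EFin; field; lra.
Qed.

Lemma leb2E (E : set (R * R)) : (leb2 E = \int[leb]_x leb (xsection E x))%E.
Proof. by []. Qed.

Lemma swap_measurable (E : set (R * R)) : measurable E ->
  measurable ((fun z : R * R => (z.2, z.1)) @^-1` E).
Proof.
move=> mE; rewrite -[X in measurable X]setTI.
suff mf : measurable_fun setT (fun z : R * R => (z.2, z.1)) by exact: mf.
by apply: measurable_fun_pair; [exact: measurable_snd|exact: measurable_fst].
Qed.

Lemma shear_measurable (a b c : R) (E : set (R * R)) : measurable E ->
  measurable ((fun z : R * R => (z.1, a * z.1 + b * z.2 + c)) @^-1` E).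
Proof.
move=> mE; rewrite -[X in measurable X]setTI.
suff mf : measurable_fun setT (fun z : R * R => (z.1, a * z.1 + b * z.2 + c)).
  exact: mf.
apply: measurable_fun_pair => //=.
apply: measurable_funD => //; apply: measurable_funD => //.
  by apply: measurable_funM => //; exact: measurable_fst.
by apply: measurable_funM => //; exact: measurable_snd.
Qed.

(** The two orders of iterated integration define measures that agree on rectangles, hence
    everywhere. *)
Lemma leb2_swap (E : set (R * R)) : measurable E ->
  leb2 E = leb2 ((fun z => (z.2, z.1)) @^-1` E).
Proof.
move=> mE; rewrite (_ : leb2 E = (leb \x^ leb)%E E).
  rewrite leb2E /product_measure2; apply: eq_integral => y _.
  congr (leb _); apply/seteqP; split=> x; rewrite /ysection/xsection/= !inE//.
by apply: product_measure_unique => // B C mB mC/=; rewrite product_measure2E.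
Qed.

(** A shear fixes the first coordinate and acts affinely on each vertical section, so the
    one-dimensional formula is integrated over the sections. *)
Lemma leb2_shear (a b c : R) (E : set (R * R)) : b != 0 -> measurable E ->
  (leb2 E = (`|b|)%:E * leb2 ((fun z => (z.1, a * z.1 + b * z.2 + c)%R) @^-1` E))%E.
Proof.
move=> b0 mE.
have mF := shear_measurable a b c mE.
rewrite [RHS]/= !leb2E -ge0_integralZl//; last first.
  exact: measurable_fun_xsection.
apply: eq_integral => x _.
rewrite (@lebesgue_measure_affine b (a * x + c)) //; last exact: measurable_xsection.
congr (_ * leb _)%E.
apply/seteqP; split=> y; rewrite /xsection/= !inE/=;
  by rewrite (_ : b * y + (a * x + c) = a * x + b * y + c)//; ring.
Qed.

Definition affmap (p a w : R * R) (z : R * R) : R * R :=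
  (p.1 + z.1 * a.1 + z.2 * w.1, p.2 + z.1 * a.2 + z.2 * w.2).
Definition det2 (a w : R * R) : R := a.1 * w.2 - a.2 * w.1.

Lemma measurable_affmap p a w : measurable_fun setT (affmap p a w).
Proof.
apply: measurable_fun_pair => /=; (apply: measurable_funD => //;
  [apply: measurable_funD => //; apply: measurable_funM => //; exact: measurable_fst
  |apply: measurable_funM => //; exact: measurable_snd]).
Qed.

Lemma measurable_affmap_pre p a w (E : set (R * R)) :
  measurable E -> measurable (affmap p a w @^-1` E).
Proof. by move=> mE; rewrite -[X in measurable X]setTI; exact: measurable_affmap. Qed.

(** Gaussian elimination with pivot [w.2]: the map is a shear, a swap, a second shear and a swap.
    The first shear computes the second coordinate, the second one obtains the first coordinate from
    it; their factors [w.2] and [det2 a w / w.2] multiply to the determinant. *)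
Lemma leb2_affine_aux p a w (E : set (R * R)) : w.2 != 0 -> det2 a w != 0 -> measurable E ->
  (leb2 E = (`|det2 a w|)%:E * leb2 (affmap p a w @^-1` E))%E.
Proof.
move=> w0 d0 mE.
rewrite leb2_swap//.
rewrite (@leb2_shear (w.1 / w.2) (det2 a w / w.2) (p.1 - w.1 / w.2 * p.2))//;
  [|by rewrite mulf_neq0// invr_neq0|exact: swap_measurable].
rewrite [in LHS]leb2_swap; last by apply: shear_measurable; apply: swap_measurable.
rewrite (@leb2_shear a.2 w.2 p.2)//; last by apply: swap_measurable; apply: shear_measurable; apply: swap_measurable.
rewrite muleA -EFinM -normrM divfK//; congr (_ * leb2 _)%E.
apply/funext => -[s t] /=; rewrite /affmap/=; congr (E (_, _)); last by ring.
rewrite /det2; by field.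
Qed.

Lemma leb2_affine p a w (E : set (R * R)) : det2 a w != 0 -> measurable E ->
  (leb2 E = (`|det2 a w|)%:E * leb2 (affmap p a w @^-1` E))%E.
Proof.
move=> d0 mE; have [w20|w20] := eqVneq w.2 0; last exact: leb2_affine_aux.
(* A vanishing pivot is replaced by [w.1], which an exchange of the coordinates puts in its
   place. *)
have w10 : w.1 != 0.
  by apply: contraNneq d0 => w10; rewrite /det2 w10 w20 !mulr0 subr0.
have mE' := swap_measurable mE.
rewrite leb2_swap// (@leb2_affine_aux (p.2, p.1) (a.2, a.1) (w.2, w.1))//; last first.
  by apply: contraNneq d0; rewrite /det2/= => d0; apply/eqP; rewrite -[RHS]oppr0 -d0; ring.
by congr (_%:E * _)%E; rewrite /det2/= distrC; congr `| _ |; ring.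
Qed.

Lemma continuous_affmap p a w : continuous (affmap p a w).
Proof.
move=> z; rewrite /affmap.
apply: (@cvg_pair _ _ _ _ (nbhs (affmap p a w z).1) (nbhs (affmap p a w z).2)) => /=.
  apply: cvgD; first apply: cvgD; first exact: cvg_cst.
    by apply: cvgM; [exact: cvg_fst|exact: cvg_cst].
  by apply: cvgM; [exact: cvg_snd|exact: cvg_cst].
apply: cvgD; first apply: cvgD; first exact: cvg_cst.
  by apply: cvgM; [exact: cvg_fst|exact: cvg_cst].
by apply: cvgM; [exact: cvg_snd|exact: cvg_cst].
Qed.

Lemma Rintegral_mscale d (T : measurableType d) (m : {measure set T -> \bar R})
    (k : {nonneg R}) (D : set T) (f : T -> R) : measurable D ->
  m.-integrable D (EFin \o f) ->
  Rintegral (mscale k m) D f = k%:num * Rintegral m D f.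
Proof.
move=> mD fi; have mf := measurable_int _ fi; rewrite /Rintegral.
rewrite integralE !ge0_integral_mscale//; last 2 first.
- exact: measurable_funeneg.
- exact: measurable_funepos.
rewrite -muleBr//=.
  rewrite -integralE fineM//; exact: integrable_fin_num.
rewrite fin_num_adde_defr//; exact: integrable_pos_fin_num.
Qed.

Definition boxed (D : set (R * R)) :=
  exists M : R, forall x, D x -> `|x.1| <= M /\ `|x.2| <= M.

Lemma boxedP (D : set (R * R)) : bounded_set D -> boxed D.
Proof.
move=> [M [Mr DM]]; exists (M + 1) => x Dx.
have := DM (M + 1) ltac:(by rewrite ltrDl) x Dx.
by rewrite /= prod_normE ge_max => /andP[].
Qed.

Lemma continuous_boxed (f : R * R -> R) (D : set (R * R)) : continuous f -> boxed D ->
  exists K : R, forall x, D x -> `|f x| <= K.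
Proof.
move=> cf [M DM].
have cK : compact (`[- M, M]%classic `*` `[- M, M]%classic : set (R * R)).
  by apply: compact_setX; exact: segment_compact.
have : compact (f @` (`[- M, M]%classic `*` `[- M, M]%classic)).
  apply: continuous_compact => //; exact: continuous_subspaceT.
move=> /compact_bounded[K [Kr fK]]; exists (K + 1) => x Dx.
apply: (fK (K + 1)); first by rewrite ltrDl.
exists x => //; have [] := DM _ Dx.
by rewrite !ler_norml /= !in_itv/=.
Qed.

Lemma leb2_boxed (D : set (R * R)) (c : R * R) (M : R) : measurable D -> 0 <= M ->
  (forall x, D x -> `|x.1 - c.1| <= M /\ `|x.2 - c.2| <= M) ->
  (leb2 D <= ((2 * M) ^+ 2)%:E)%E.
Proof.
move=> mD M0 DM.
apply: (@le_trans _ _ (leb2 (`[c.1 - M, c.1 + M]%classic `*` `[c.2 - M, c.2 + M]%classic))).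
  apply: le_measure; rewrite ?inE//; first exact: measurableX.
  by move=> x /DM[]; rewrite !ler_distl /= !in_itv/=.
rewrite product_measure1E//= !lebesgue_measure_itv/= !lte_fin.
have [MM|MM] := ltP; last by rewrite mul0e lee_fin sqr_ge0.
have [MM'|MM'] := ltP; last by rewrite mule0 lee_fin sqr_ge0.
by rewrite -!EFinD -EFinM lee_fin; lra.
Qed.

Lemma continuous_integrable (f : R * R -> R) (D : set (R * R)) : continuous f ->
  measurable D -> boxed D -> leb2.-integrable D (EFin \o f).
Proof.
move=> cf mD bD; have [K fK] := continuous_boxed cf bD.
apply: measurable_bounded_integrable => //.
- have [M DM] := bD.
  rewrite (le_lt_trans (@leb2_boxed D (0, 0) `|M| mD _ _)) ?ltry// => x /DM[x1 x2].
  by rewrite /= !subr0; split; rewrite (le_trans _ (ler_norm M)).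
- exact: continuous_measurable_fun2.
- exists K; split; first by rewrite num_real.
  by move=> x Kx y Dy; apply: (le_trans (fK y Dy)); exact: ltW.
Qed.

Lemma dint_affine p a w (f : R * R -> R) (D : set (R * R)) : continuous f ->
  measurable D -> boxed (affmap p a w @^-1` D) -> det2 a w != 0 ->
  dint D f = `|det2 a w| * dint (affmap p a w @^-1` D) (f \o affmap p a w).
Proof.
move=> cf mD bD d0; rewrite /dint /Rintegral.
pose T := (measurableTypeR R * measurableTypeR R)%type.
have mA : measurable_fun [set: T] (affmap p a w : T -> T) := measurable_affmap p a w.
pose m := mscale (NngNum (normr_ge0 (det2 a w))) (pushforward leb2 (affmap p a w : T -> T)).
have mf : measurable_fun [set: T] (EFin \o (f : T -> R)).
  by apply/measurable_EFinP; exact: continuous_measurable_fun2.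
have cfA : continuous (f \o affmap p a w).
  move=> x; apply: continuous_comp; [exact: continuous_affmap|exact: cf].
have ifA : leb2.-integrable (affmap p a w @^-1` D) ((EFin \o f) \o affmap p a w).
  by apply: continuous_integrable => //; exact: measurable_affmap_pre.
have E : (\int[leb2]_(x in D) (f x)%:E = \int[m mA]_(x in D) (f x)%:E)%E.
  by apply: eq_measure_integral => B mB BD; exact: leb2_affine.
have P := @integral_pushforward _ _ T T R _ mA leb2 D _ mf ifA mD.
have iP := @integrable_pushforward _ _ T T R _ mA leb2 D _ mf ifA mD.
rewrite E.
have := @Rintegral_mscale _ T (pushforward leb2 (affmap p a w : T -> T))
  (NngNum (normr_ge0 (det2 a w))) D f mD iP.
by rewrite /Rintegral -/(m mA) => ->; rewrite P.
Qed.

End AffineChange.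

(** * Continuously differentiable functions of two variables *)

Section C1.
Variable R : realType.
Implicit Types f g : R * R -> R.

Lemma sum2 (V : nmodType) (F : 'I_2 -> V) : \sum_(i < 2) F i = F 0 + F 1.
Proof. by rewrite big_ord_recl big_ord1; congr (_ + F _); exact/val_inj. Qed.

Lemma ord2P (P : 'I_2 -> Prop) : P 0 -> P 1 -> forall i, P i.
Proof.
by move=> P0 P1 [[|[|//]] i2]; [move: P0|move: P1];
  congr P; exact/val_inj.
Qed.

(** Only the two partial derivatives are required, as in [smooth]; derivatives along arbitrary lines
    are recovered in [C1_line]. *)
Definition C1 f := [/\ continuous f, forall i x, derivable f x (basis_vec R i) &
  forall i, continuous (pd i f)].

Lemma smooth_C1 f : smooth f -> C1 f.
Proof.
move=> sf; split; first by have [] := sf [::].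
  by have [] := sf [::].
by move=> i; have [] := sf [:: i].
Qed.

Lemma is_derive_pd0 f x : derivable f x (basis_vec R 0) ->
  is_derive x.1 (1 : R) (fun t => f (t, x.2)) (pd 0 f x).
Proof.
move=> df; have E : (fun h : R => h^-1 *: (f (h *: (1 : R) + x.1, x.2) - f (x.1, x.2))) =
    (fun h => h^-1 *: (f (h *: basis_vec R 0 + x) - f x)).
  apply/funext => h; rewrite -surjective_pairing; congr (_ *: (f _ - _)).
  case: x {df} => x y /=; congr (_, _) => /=.
  by rewrite /GRing.scale/= mulr0 add0r.
by apply: DeriveDef; rewrite /derivable /pd/derive/= E.
Qed.

Lemma is_derive_pd1 f x : derivable f x (basis_vec R 1) ->
  is_derive x.2 (1 : R) (fun t => f (x.1, t)) (pd 1 f x).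
Proof.
move=> df; have E : (fun h : R => h^-1 *: (f (x.1, h *: (1 : R) + x.2) - f (x.1, x.2))) =
    (fun h => h^-1 *: (f (h *: basis_vec R 1 + x) - f x)).
  apply/funext => h; rewrite -surjective_pairing; congr (_ *: (f _ - _)).
  case: x {df} => x y /=; congr (_, _) => /=.
  by rewrite /GRing.scale/= mulr0 add0r.
by apply: DeriveDef; rewrite /derivable /pd/derive/= E.
Qed.

Lemma between_dist (a b c : R) : a <= c <= b \/ b <= c <= a -> `|a - c| <= `|b - a|.
Proof.
case=> /andP[ac cb].
  by rewrite distrC !ger0_norm ?subr_ge0// ?lerB// (le_trans ac).
by rewrite [leRHS]distrC !ger0_norm ?subr_ge0// ?lerB// (le_trans ac).
Qed.

Lemma mvt1 (g g' : R -> R) (a b : R) : (forall t : R, is_derive t (1 : R) g (g' t)) ->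
  exists2 c, a <= c <= b \/ b <= c <= a & g b - g a = g' c * (b - a).
Proof.
move=> dg; have cg : continuous g.
  by move=> t; apply/differentiable_continuous/derivable1_diffP; have [] := dg t.
have [ab|/ltW ba] := leP a b.
  have [c cab E] := @MVT_segment R g g' a b ab (fun t _ => dg t) (continuous_subspaceT cg).
  by exists c => //; left; move: cab; rewrite in_itv.
have [c cab E] := @MVT_segment R g g' b a ba (fun t _ => dg t) (continuous_subspaceT cg).
exists c; first by right; move: cab; rewrite in_itv.
by rewrite -[LHS]opprB E; ring.
Qed.

(** The one-variable theorem is applied on the two legs of the path going vertically from [x] to
    [(x.1, y.2)], then horizontally to [y]. Both intermediate points stay in the rectangle spanned
    by [x] and [y]. *)
Lemma mvt2 f (x y : R * R) : C1 f -> exists xi eta,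
  [/\ x.1 <= xi <= y.1 \/ y.1 <= xi <= x.1,
      x.2 <= eta <= y.2 \/ y.2 <= eta <= x.2 &
      f y - f x = pd 0 f (xi, y.2) * (y.1 - x.1) + pd 1 f (x.1, eta) * (y.2 - x.2)].
Proof.
move=> [cf df cdf].
have [xi xi1 E1] := @mvt1 (fun t => f (t, y.2)) (fun t => pd 0 f (t, y.2)) x.1 y.1
  (fun t => is_derive_pd0 (df 0 (t, y.2))).
have [eta eta1 E2] := @mvt1 (fun t => f (x.1, t)) (fun t => pd 1 f (x.1, t)) x.2 y.2
  (fun t => is_derive_pd1 (df 1 (x.1, t))).
exists xi, eta; split => //; rewrite -E1 -E2 -!surjective_pairing; ring.
Qed.

(** By [mvt2] the difference quotient is the same combination of partial derivatives taken at points
    tending to [q t], so their continuity gives the limit. *)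
Lemma C1_line f (p u : R * R) (t : R) : C1 f ->
  let q s := (p.1 + s * u.1, p.2 + s * u.2) in
  is_derive t (1 : R) (fun s => f (q s)) (u.1 * pd 0 f (q t) + u.2 * pd 1 f (q t)).
Proof.
move=> cf q; set L := _ + _.
suff H : (fun h : R => h^-1 *: (f (q (h *: (1 : R) + t)) - f (q t))) h @[h --> 0^'] --> L.
  by apply: DeriveDef; [apply/cvg_ex; exists L|exact/cvg_lim].
have [_ _ cdf] := cf.
(* The summand 1 keeps [U] positive when [u] vanishes, so that [e / U] and [d0 / U] are legitimate
   tolerances. *)
pose U := `|u.1| + `|u.2| + 1.
have U0 : 0 < U by rewrite /U; have := normr_ge0 u.1; have := normr_ge0 u.2; lra.
have u1U : `|u.1| <= U by rewrite /U; have := normr_ge0 u.1; have := normr_ge0 u.2; lra.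
have u2U : `|u.2| <= U by rewrite /U; have := normr_ge0 u.1; have := normr_ge0 u.2; lra.
apply/cvgrPdist_le => e e0.
have eU0 : 0 < e / U by rewrite divr_gt0.
have /cvgrPdist_le/(_ _ eU0)/nbhs_ballP[d0 /= d00 Hd0] := cdf 0 (q t).
have /cvgrPdist_le/(_ _ eU0)/nbhs_ballP[d1 /= d10 Hd1] := cdf 1 (q t).
near=> h.
have hN0 : h != 0 by near: h; exact: nbhs_dnbhs_neq.
have hd0 : `|h| < d0 / U.
  near: h; apply: dnbhs0_lt; by rewrite divr_gt0.
have hd1 : `|h| < d1 / U.
  near: h; apply: dnbhs0_lt; by rewrite divr_gt0.
have [xi [eta [xiP etaP E]]] := mvt2 (q t) (q (h + t)) cf.
have hE : h *: (1 : R) = h by rewrite /GRing.scale/= mulr1.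
have q1 : `|(q (h + t)).1 - (q t).1| = `|h| * `|u.1|.
  by rewrite /q/= -normrM; congr `| _ |; ring.
have q2 : `|(q (h + t)).2 - (q t).2| = `|h| * `|u.2|.
  by rewrite /q/= -normrM; congr `| _ |; ring.
have hU d : `|h| < d / U -> `|h| * U < d by rewrite ltr_pdivlMr.
have hu1 : `|h| * `|u.1| <= `|h| * U by rewrite ler_wpM2l.
have hu2 : `|h| * `|u.2| <= `|h| * U by rewrite ler_wpM2l.
have xi_near := between_dist xiP; have eta_near := between_dist etaP.
have B0 : `|pd 0 f (q t) - pd 0 f (xi, (q (h + t)).2)| <= e / U.
  apply: Hd0; split => /=; rewrite /ball/=.
    by rewrite (le_lt_trans xi_near)// q1 (le_lt_trans hu1)// hU.
  by rewrite -[_ - _]/((q t).2 - (q (h + t)).2) distrC q2 (le_lt_trans hu2)// hU.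
have B1 : `|pd 1 f (q t) - pd 1 f ((q t).1, eta)| <= e / U.
  apply: Hd1; split => /=; rewrite /ball/=; first by rewrite subrr normr0.
  by rewrite (le_lt_trans eta_near)// q2 (le_lt_trans hu2)// hU.
rewrite hE E.
have -> : L - h^-1 *: (pd 0 f (xi, (q (h + t)).2) * ((q (h + t)).1 - (q t).1) +
    pd 1 f ((q t).1, eta) * ((q (h + t)).2 - (q t).2)) =
    u.1 * (pd 0 f (q t) - pd 0 f (xi, (q (h + t)).2)) +
    u.2 * (pd 1 f (q t) - pd 1 f ((q t).1, eta)).
  by rewrite /L /GRing.scale/=; field.
rewrite (le_trans (ler_normD _ _))// !normrM.
apply: (@le_trans _ _ (`|u.1| * (e / U) + `|u.2| * (e / U))).
  by apply: lerD; apply: ler_wpM2l.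
rewrite -mulrDl mulrA ler_pdivrMr// mulrC ler_wpM2l//; first exact: ltW.
by rewrite /U; lra.
Unshelve. all: by end_near.
Qed.

Lemma C1M f g : C1 f -> C1 g -> C1 (fun x => f x * g x).
Proof.
move=> [cf df cdf] [cg dg cdg]; split.
- by move=> x; apply: cvgM; [exact: cf|exact: cg].
- by move=> i x; exact: derivableM.
- move=> i; rewrite (_ : pd i _ = fun x => f x * pd i g x + g x * pd i f x); last first.
    by apply/funext => x; rewrite /pd (@deriveM _ _ f g).
  move=> x; apply: cvgD; apply: cvgM; [exact: cf|exact: cdg|exact: cg|exact: cdf].
Qed.

Lemma pdM i f g x : C1 f -> C1 g -> pd i (fun x => f x * g x) x = f x * pd i g x + g x * pd i f x.
Proof. by move=> [cf df cdf] [cg dg cdg]; rewrite /pd (@deriveM _ _ f g). Qed.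

Lemma pdD i f g x : C1 f -> C1 g -> pd i (fun x => f x + g x) x = pd i f x + pd i g x.
Proof. by move=> [cf df cdf] [cg dg cdg]; rewrite /pd (@deriveD _ _ _ f g). Qed.

Lemma pdB i f g x : C1 f -> C1 g -> pd i (fun x => f x - g x) x = pd i f x - pd i g x.
Proof. by move=> [cf df cdf] [cg dg cdg]; rewrite /pd (@deriveB _ _ _ f g). Qed.

Lemma C1D f g : C1 f -> C1 g -> C1 (fun x => f x + g x).
Proof.
move=> Cf Cg; have [cf df cdf] := Cf; have [cg dg cdg] := Cg; split.
- by move=> x; apply: cvgD; [exact: cf|exact: cg].
- by move=> i x; exact: derivableD.
- move=> i; rewrite (_ : pd i _ = fun x => pd i f x + pd i g x); last first.
    by apply/funext => x; rewrite pdD.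
  move=> x; apply: cvgD; [exact: cdf|exact: cdg].
Qed.

Lemma pd_cst i (a : R) x : pd i (fun=> a) x = 0.
Proof. exact: derive_cst. Qed.

Lemma C1_cst (a : R) : C1 (fun=> a).
Proof.
split; first by move=> x; exact: cvg_cst.
  by move=> i x; exact: derivable_cst.
move=> i; rewrite (_ : pd i _ = fun=> 0); first by move=> x; exact: cvg_cst.
by apply/funext => x; exact: pd_cst.
Qed.

Lemma C1Z a f : C1 f -> C1 (fun x => a * f x).
Proof. by move=> Cf; apply: C1M => //; exact: C1_cst. Qed.

Lemma pdZ i a f x : C1 f -> pd i (fun x => a * f x) x = a * pd i f x.
Proof.
move=> Cf; rewrite (@pdM i (fun=> a) f x)//; last exact: C1_cst.
by rewrite pd_cst mulr0 addr0.
Qed.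

Lemma C1B f g : C1 f -> C1 g -> C1 (fun x => f x - g x).
Proof.
move=> Cf Cg; rewrite (_ : (fun x => _) = fun x => f x + (-1) * g x); last first.
  by apply/funext => x; rewrite mulN1r.
by apply: C1D => //; exact: C1Z.
Qed.

Definition xcoord (i : 'I_2) (x : R * R) : R := if i == 0 then x.1 else x.2.

Lemma is_derive_xcoord i j x :
  is_derive x (basis_vec R i) (xcoord j) ((i == j)%:R).
Proof.
have E : (fun h : R => h^-1 *: (xcoord j (h *: basis_vec R i + x) - xcoord j x)) @ 0^'
    --> ((i == j)%:R : R).
  apply: cvg_near_cst; near=> h.
  have h0 : h != 0 by near: h; exact: nbhs_dnbhs_neq.
  rewrite /xcoord; elim/ord2P: j; elim/ord2P: i => /=;
    rewrite /GRing.scale/= addrK ?mulr1 ?mulr0 ?mulVf//.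
by apply: DeriveDef; [apply/cvg_ex; eexists; exact: E|exact/cvg_lim].
Unshelve. all: by end_near.
Qed.

Lemma pd_xcoord i j x : pd i (xcoord j) x = (i == j)%:R.
Proof. by have [] := is_derive_xcoord i j x. Qed.

Lemma C1_xcoord j : C1 (xcoord j).
Proof.
split.
- by elim/ord2P: j => x; [exact: cvg_fst|exact: cvg_snd].
- by move=> i x; have [] := is_derive_xcoord i j x.
- move=> i; rewrite (_ : pd i _ = fun=> (i == j)%:R); first by move=> x; exact: cvg_cst.
  by apply/funext => x; exact: pd_xcoord.
Qed.

End C1.

(** * Star-shaped polygons *)

Section Geometry.
Variable R : realType.
Implicit Types x y c : R * R.

Lemma pair_ext x y : x.1 = y.1 -> x.2 = y.2 -> x = y.
Proof. by case: x => ? ?; case: y => ? ? /= -> ->. Qed.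

Lemma enorm_sqr x : enorm x ^+ 2 = x.1 ^+ 2 + x.2 ^+ 2.
Proof. by rewrite sqr_sqrtr// addr_ge0// sqr_ge0. Qed.

Lemma enorm_ge0 x : 0 <= enorm x.
Proof. exact: sqrtr_ge0. Qed.

Lemma enorm_lt x (s : R) : 0 < s -> (enorm x < s) = (x.1 ^+ 2 + x.2 ^+ 2 < s ^+ 2).
Proof.
by move=> s0; rewrite -enorm_sqr ltr_pXn2r// nnegrE ?enorm_ge0// ltW.
Qed.

Lemma enorm_fst x : `|x.1| <= enorm x.
Proof. by rewrite -sqrtr_sqr ler_sqrt ?addr_ge0 ?sqr_ge0// lerDl sqr_ge0. Qed.

Lemma enorm_snd x : `|x.2| <= enorm x.
Proof. by rewrite -sqrtr_sqr ler_sqrt ?addr_ge0 ?sqr_ge0// lerDr sqr_ge0. Qed.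

Lemma continuous_sqr_dist c : continuous (fun x => (x.1 - c.1) ^+ 2 + (x.2 - c.2) ^+ 2).
Proof.
move=> x; have c1 : (fun x : R * R => x.1 - c.1) @ x --> x.1 - c.1.
  by apply: cvgB; [exact: cvg_fst|exact: cvg_cst].
have c2 : (fun x : R * R => x.2 - c.2) @ x --> x.2 - c.2.
  by apply: cvgB; [exact: cvg_snd|exact: cvg_cst].
rewrite (_ : (fun x0 : R * R => _) = fun x0 =>
  (x0.1 - c.1) * (x0.1 - c.1) + (x0.2 - c.2) * (x0.2 - c.2)).
  by apply: cvgD; apply: cvgM.
by apply/funext => z; rewrite !expr2.
Qed.

Lemma open_disc c (s : R) : 0 < s -> open (disc c s).
Proof.
move=> s0.
have -> : disc c s = (fun x => (x.1 - c.1) ^+ 2 + (x.2 - c.2) ^+ 2) @^-1` [set t | t < s ^+ 2].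
  by apply/seteqP; split=> x; rewrite /disc/= enorm_lt.
apply: open_comp; last exact: open_lt.
by move=> x _; exact: continuous_sqr_dist.
Qed.

Lemma disc_center c (s : R) : 0 < s -> disc c s c.
Proof. by move=> s0; rewrite /disc/= enorm_lt//= !subrr expr0n/= addr0 exprn_gt0. Qed.

(* For z in D near x, the same point lies on the segment from z to a point
   [g z] close to y, hence still in the disc. *)
Lemma star_closure (D : set (R * R)) c (s : R) x y t : 0 < s ->
  star_shaped D (disc c s) -> closure D x -> disc c s y -> 0 <= t < 1 ->
  D ((1 - t) *: y + t *: x).
Proof.
move=> s0 star Dx By /andP[t0 t1].
have t10 : 1 - t != 0 by rewrite subr_eq0 gt_eqF.
pose g z : R * R := affmap (y.1 + t / (1 - t) * x.1, y.2 + t / (1 - t) * x.2)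
  (- (t / (1 - t)), 0) (0, - (t / (1 - t))) z.
have gx : g x = y by apply: pair_ext; rewrite /g/affmap/=; ring.
have : nbhs x (g @^-1` disc c s).
  apply: (@continuous_affmap R _ _ _ x); rewrite -/(g x) gx.
  by apply: open_nbhs_nbhs; split => //; exact: open_disc.
move=> /Dx[z [Dz gz]].
have := star z (g z) t Dz gz t0 (ltW t1).
rewrite (_ : (1 - t) *: g z + t *: z = (1 - t) *: y + t *: x)//.
by apply: pair_ext; rewrite /g/affmap/= /GRing.scale/=; field.
Qed.

(** Cramer's identities: [det2 p q] times either coordinate of [r] is a combination of [det2 p r]
    and [det2 q r]. *)
Lemma det2_eq0 (p q r : R * R) : det2 p q != 0 -> det2 p r = 0 -> det2 q r = 0 -> r = (0, 0).
Proof.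
rewrite /det2 => pq pr qr; apply: pair_ext; apply: (mulfI pq) => /=; rewrite mulr0.
- have -> : (p.1 * q.2 - p.2 * q.1) * r.1 =
    p.1 * - (q.1 * r.2 - q.2 * r.1) + q.1 * (p.1 * r.2 - p.2 * r.1) by ring.
  by rewrite pr qr oppr0 !mulr0 addr0.
- have -> : (p.1 * q.2 - p.2 * q.1) * r.2 =
    p.2 * - (q.1 * r.2 - q.2 * r.1) + q.2 * (p.1 * r.2 - p.2 * r.1) by ring.
  by rewrite pr qr oppr0 !mulr0 addr0.
Qed.

Lemma ordS_neq n (i : 'I_n) : (3 <= n)%N -> ordS i != i.
Proof.
move=> n3; apply/eqP => /(congr1 val)/= /eqP; apply/negP.
have := ltn_ord i; rewrite leq_eqVlt => /predU1P[lt|lt].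
  by rewrite [X in (_ %% X)%N]/= -[X in (_ %% X)%N]lt modnn; lia.
by rewrite modn_small// neq_ltn ltnSn orbT.
Qed.

Lemma ordS_const n (T : Type) (f : 'I_n -> T) : (forall i, f (ordS i) = f i) ->
  forall i j, f i = f j.
Proof.
move=> fS; suff H m (lm : (m < n)%N) (l0 : (0 < n)%N) : f (Ordinal lm) = f (Ordinal l0).
  move=> [i li] [j lj]; have l0 : (0 < n)%N by apply: leq_ltn_trans li.
  by rewrite (H i li l0) (H j lj l0).
elim: m lm => [|m IH] lm; first by congr f; exact: val_inj.
have lm' : (m < n)%N by exact: ltnW.
by rewrite -(IH lm') -[RHS]fS; congr f; apply: val_inj; rewrite /= modn_small.
Qed.

(* [tri] parametrises, through [affmap c a w] with [a] the first vertex and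
   [w] the edge vector, the triangle with apex [c] over an edge. *)
Definition tri : set (R * R) := [set z | 0 < z.1 < 1 /\ 0 <= z.2 < z.1].

Section Star.
Variables (n : nat) (v : 'I_n -> R * R) (D : set (R * R)) (c : R * R) (s : R).
Hypothesis polyD : polygon v D.
Hypothesis s_gt0 : 0 < s.
Hypothesis starD : star_shaped D (disc c s).

Definition evec i : R * R := v (ordS i) - v i.
(** Twice the signed area of the triangle with apex [c] over edge [i], and the Jacobian of its
    parametrisation. *)
Definition edet i : R := det2 (v i - c) (evec i).

Let n3 : (3 <= n)%N. Proof. by case: polyD. Qed.
Let simple (i j : 'I_n) (r t : R) : 0 <= r < 1 -> 0 <= t < 1 ->
        edge_pt v i r = edge_pt v j t -> i = j /\ r = t.
Proof. case: polyD => _ H _ _ _; exact: H. Qed.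
Let oD : open D. Proof. by case: polyD. Qed.
Let bdD : closure D `\` D =
  [set x | exists (i : 'I_n) (t : R), 0 <= t <= 1 /\ x = edge_pt v i t].
Proof. by case: polyD. Qed.

Lemma edge_pt_bd i t : 0 <= t <= 1 -> (closure D `\` D) (edge_pt v i t).
Proof. by move=> t01; rewrite bdD; exists i, t. Qed.

Lemma edge_ptE i t : edge_pt v i t = affmap (v i) (evec i) (0, 0) (t, 0).
Proof. by apply: pair_ext; rewrite /edge_pt/affmap/evec /= /GRing.scale/=; ring. Qed.

Lemma edge_pt0 i : edge_pt v i 0 = v i.
Proof. by rewrite edge_ptE; apply: pair_ext => /=; ring. Qed.

Lemma edge_pt1 i : edge_pt v i 1 = v (ordS i).
Proof. by rewrite edge_ptE; apply: pair_ext => /=; ring. Qed.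

(** The endpoint of an edge is counted as the start of the next one: simplicity of the polygon
    yields uniqueness only for parameters in [0, 1[. *)
Lemma bd_edge_pt x : (closure D `\` D) x ->
  exists i t, 0 <= t < 1 /\ x = edge_pt v i t.
Proof.
rewrite bdD => -[i [t [/andP[t0]]]]; rewrite le_eqVlt => /predU1P[->|t1] ->.
  by exists (ordS i), 0; rewrite lexx ltr01 edge_pt0 edge_pt1.
by exists i, t; rewrite t0 t1.
Qed.

Lemma star_nonempty : exists x, D x.
Proof.
have i : 'I_n by apply: (@Ordinal _ 0); apply: leq_trans n3.
have [cl _] := @edge_pt_bd i 0 ltac:(by rewrite lexx ler01).
by have [x []] := cl setT filterT; exists x.
Qed.

(** As soon as [D] has a point, star-shapedness at [t = 0] returns the point of the disc itself. *)
Lemma disc_sub : disc c s `<=` D.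
Proof.
move=> y By; have [x Dx] := star_nonempty.
have := starD Dx By (lexx 0) ler01.
by rewrite subr0 scale1r scale0r addr0.
Qed.

Lemma star_center : D c.
Proof. exact/disc_sub/disc_center. Qed.

Lemma star_ray x k : closure D x -> 0 <= k < 1 -> D ((1 - k) *: c + k *: x).
Proof. by move=> clx k01; apply: (star_closure s_gt0 starD) => //; exact: disc_center. Qed.

(** A ray from [c] meets the boundary at most once: of two such points, the nearer would lie in [D]
    by [star_ray]. *)
Lemma ray_inj x y k : (closure D `\` D) x -> (closure D `\` D) y -> 0 < k ->
  y - c = k *: (x - c) -> k = 1.
Proof.
move=> [clx nDx] [cly nDy] k0 E; have [k1|k1|//] := ltgtP k 1.
- exfalso; apply: nDy.
  rewrite (_ : y = (1 - k) *: c + k *: x); first by apply: star_ray => //; rewrite ltW.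
  by rewrite -[LHS](subrK c) E scalerBr scalerBl scale1r addrC addrA addrAC.
- exfalso; apply: nDx.
  rewrite (_ : x = (1 - k^-1) *: c + k^-1 *: y).
    by apply: star_ray => //; rewrite invr_ge0 (ltW k0)/= invf_lt1.
  rewrite -[y in RHS](subrK c) E scalerDr scalerA mulVf ?gt_eqF// scale1r scalerBl scale1r.
  by rewrite [x - c + _]addrC addrA subrK addrC subrK.
Qed.

Lemma evec_neq0 i : 0 < enorm (evec i) ^+ 2.
Proof.
rewrite lt_neqAle sqr_ge0 andbT eq_sym sqrf_eq0; apply/eqP => e0.
have : enorm (evec i) ^+ 2 = 0 by rewrite e0 expr0n.
rewrite enorm_sqr => /eqP; rewrite paddr_eq0 ?sqr_ge0// !sqrf_eq0 => /andP[/eqP w1 /eqP w2].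
have [] := @simple i (ordS i) 0 0 _ _ _; rewrite ?lexx ?ltr01 //.
  by rewrite !edge_pt0; apply: pair_ext; apply/eqP; rewrite -subr_eq0 -oppr_eq0 opprB; apply/eqP.
by move=> /esym/eqP; rewrite (negbTE (ordS_neq i n3)).
Qed.

(** [|edet i|] divided by the edge length is the distance from [c] to the line of the edge. Were it
    below [s], the foot [y] of the perpendicular would lie in the disc. Then either [y] is on the
    edge, or one endpoint of the edge lies strictly between [y] and the other one; in each case a
    boundary point would be in [D]. *)
Lemma edet_ge i : s * edge_length v i <= `|edet i|.
Proof.
rewrite leNgt; apply/negP => lt.
have w0 := evec_neq0 i; have wsq := enorm_sqr (evec i).
rewrite /edge_length -/(evec i) in lt.
have dlt : edet i ^+ 2 < s ^+ 2 * enorm (evec i) ^+ 2.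
  rewrite -exprMn -[X in X < _]real_normK ?num_real// ltr_pXn2r ?nnegrE//.
  by rewrite mulr_ge0 ?enorm_ge0// ltW.
move: wsq w0 dlt; move: (enorm _ ^+ 2) => N wsq N0 dlt.
pose a := v i - c.
(* The parameter, along the line of the edge, of the orthogonal projection of [c]. *)
pose t := - (a.1 * (evec i).1 + a.2 * (evec i).2) / N.
pose y := affmap (v i) (evec i) (0, 0) (t, 0).
have By : disc c s y.
  rewrite /disc/= enorm_lt//.
  have -> : (y - c).1 ^+ 2 + (y - c).2 ^+ 2 = edet i ^+ 2 / N.
    have E : (y - c).1 ^+ 2 + (y - c).2 ^+ 2 =
       a.1 ^+ 2 + a.2 ^+ 2 + 2 * t * (a.1 * (evec i).1 + a.2 * (evec i).2) +
       t ^+ 2 * ((evec i).1 ^+ 2 + (evec i).2 ^+ 2).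
      by rewrite /y/affmap/a/=; ring.
    rewrite E -wsq /edet /det2 -/a /t.
    apply: (mulIf (lt0r_neq0 N0)); rewrite divfK ?lt0r_neq0//.
    have F A B : (A + 2 * (- B / N) * B + (- B / N) ^+ 2 * N) * N = A * N - B ^+ 2.
      by field; rewrite lt0r_neq0.
    by rewrite F wsq; ring.
  by rewrite ltr_pdivrMr.
have [t0|t0] := ltP t 0.
  have [cl1 _] := @edge_pt_bd i 1 ltac:(by rewrite lexx ler01).
  have [_ nD] := @edge_pt_bd i 0 ltac:(by rewrite lexx ler01).
  apply: nD; rewrite edge_pt0.
  have := @star_closure D c s _ y (- t / (1 - t)) s_gt0 starD cl1 By.
  have -> : (1 - - t / (1 - t)) *: y + (- t / (1 - t)) *: edge_pt v i 1 = v i.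
    by rewrite edge_ptE /y; apply: pair_ext; rewrite /affmap/= /GRing.scale/=;
      field; lra.
  apply; rewrite divr_ge0 ?ltr_pdivrMr; lra.
have [t1|t1] := ltP 1 t.
  have [cl0 _] := @edge_pt_bd i 0 ltac:(by rewrite lexx ler01).
  have [_ nD] := @edge_pt_bd i 1 ltac:(by rewrite lexx ler01).
  apply: nD; rewrite edge_pt1.
  have := @star_closure D c s _ y ((t - 1) / t) s_gt0 starD cl0 By.
  have -> : (1 - (t - 1) / t) *: y + ((t - 1) / t) *: edge_pt v i 0 = v (ordS i).
    rewrite -edge_pt1 !edge_ptE /y; apply: pair_ext; rewrite /affmap/= /GRing.scale/=;
      field; lra.
  apply; rewrite divr_ge0 ?ltr_pdivrMr; lra.
have [_ nD] := @edge_pt_bd i t ltac:(by rewrite t0 t1).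
by apply: nD; rewrite edge_ptE; exact: disc_sub.
Qed.

Lemma edet_neq0 i : edet i != 0.
Proof.
rewrite -normr_gt0 (lt_le_trans _ (edet_ge i))// mulr_gt0//.
by rewrite lt_neqAle enorm_ge0 andbT eq_sym -sqrf_eq0 gt_eqF// evec_neq0.
Qed.

(** Cramer's rule for the inverse of [affmap c (v i - c) (evec i)]. *)
Definition einv i x : R * R :=
  (det2 (x - c) (evec i) / edet i, det2 (v i - c) (x - c) / edet i).

Lemma einvK i : cancel (einv i) (affmap c (v i - c) (evec i)).
Proof.
move=> x; have := edet_neq0 i; rewrite /einv/affmap/edet/det2/=.
move: (evec i) => w d0; apply: pair_ext => /=; by field.
Qed.

Lemma affmapK i : cancel (affmap c (v i - c) (evec i)) (einv i).
Proof.
move=> x; have := edet_neq0 i; rewrite /einv/affmap/edet/det2/=.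
move: (evec i) => w d0; apply: pair_ext => /=; by field.
Qed.

Lemma affmap_edge i r t :
  affmap c (v i - c) (evec i) (r, r * t) = c + r *: (edge_pt v i t - c).
Proof.
rewrite edge_ptE; apply: pair_ext; rewrite /affmap/= /GRing.scale/=; ring.
Qed.

(** Half open: the side towards [v i] belongs to it, while the apex, the edge and the side towards
    the next vertex do not. This makes the pieces disjoint while they still cover [D] without
    [c]. *)
Definition etri i : set (R * R) := einv i @^-1` tri.

Lemma etri_edge i x : etri i x -> exists r t,
  [/\ 0 < r < 1, 0 <= t < 1 & x = c + r *: (edge_pt v i t - c)].
Proof.
move=> tx; have := einvK i x; move: tx; rewrite /etri/=.
case: (einv i x) => r u [/= r01 /andP[u0 ur]] <-.
have /andP[r0 r1] := r01.
exists r, (u / r); split=> //; first by rewrite divr_ge0 ?ltr_pdivrMr ?mul1r// ltW.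
by rewrite -affmap_edge mulrCA divff ?mulr1// gt_eqF.
Qed.

Lemma edge_etri i r t : 0 < r < 1 -> 0 <= t < 1 -> etri i (c + r *: (edge_pt v i t - c)).
Proof.
move=> r01 /andP[t0 t1]; rewrite -affmap_edge /etri/= affmapK; split => //=.
have /andP[r0 _] := r01.
by rewrite mulr_ge0 ?(ltW r0)//= gtr_pMr.
Qed.

(** The two boundary points seen from [c] in the direction of [x] are on one ray, hence equal by
    [ray_inj]; simplicity then identifies the edges. *)
Lemma etri_disjoint i j x : etri i x -> etri j x -> i = j.
Proof.
move=> /etri_edge[r [t [/andP[r0 r1] t01 E1]]] /etri_edge[r' [t' [/andP[r'0 r'1] t'01 E2]]].
have t1 : 0 <= t <= 1 by case/andP: t01 => -> /ltW ->.
have t'1 : 0 <= t' <= 1 by case/andP: t'01 => -> /ltW ->.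
have E : edge_pt v j t' - c = (r / r') *: (edge_pt v i t - c).
  apply: (@scalerI _ _ r'); first by rewrite gt_eqF.
  rewrite scalerA mulrCA divff ?gt_eqF// mulr1.
  by apply: (addrI c); rewrite -E1 -E2.
have rr' := ray_inj (edge_pt_bd i t1) (edge_pt_bd j t'1) (divr_gt0 r0 r'0) E.
move: E; rewrite rr' scale1r => /addIr E.
by have [] := simple t'01 t01 E.
Qed.

Lemma etri_sub i : etri i `<=` D.
Proof.
move=> x /etri_edge[r [t [/andP[r0 r1] t01 ->]]].
have t1 : 0 <= t <= 1 by case/andP: t01 => -> /ltW ->.
have [clx _] := edge_pt_bd i t1.
have := @star_ray _ r clx; rewrite (ltW r0) r1 => /(_ isT).
by rewrite scalerBl scale1r scalerBr addrAC addrA.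
Qed.

(** Follow the ray from [c] through [x] to the supremum [k] of its parameters in [D]. The point
    reached is in the closure of [D] but, [D] being open, not in [D]; it lies on some edge, and [x]
    in the triangle below that edge. *)
Lemma star_cover x : D x -> x != c -> exists i, etri i x.
Proof.
move=> Dx xc.
pose u := x - c.
pose q k := affmap c u (0, 0) (k, 0).
have cq : continuous (fun k => q k).
  move=> k; apply: (@continuous_comp _ _ _ (fun k : R => (k, 0 : R)) (affmap c u (0, 0))).
    by apply: (@cvg_pair _ _ _ _ (nbhs k) (nbhs (0 : R))) => /=; [exact: cvg_id|exact: cvg_cst].
  exact: continuous_affmap.
pose S := [set k : R | D (q k)].
have q1 : q 1 = x by apply: pair_ext; rewrite /q/affmap/u/=; ring.
have S1 : S 1 by rewrite /S/= q1.
have [M DM] : boxed D by apply: boxedP; case: polyD.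
have u0 : 0 < `|u.1| + `|u.2|.
  rewrite lt_neqAle addr_ge0// andbT eq_sym paddr_eq0// !normr_eq0; apply/negP.
  move=> /andP[/eqP u1 /eqP u2]; move/eqP: xc; apply.
  by apply: pair_ext; apply: subr0_eq; [exact: u1|exact: u2].
have supS : has_sup S.
  split; first by exists 1.
  exists ((2 * M + `|c.1| + `|c.2|) / (`|u.1| + `|u.2|)) => k Sk.
  rewrite ler_pdivlMr//; have [k0|k0] := leP k 0.
    apply: (@le_trans _ _ 0); first by rewrite mulr_le0_ge0// ltW.
    have [M0 _] := DM _ Dx; have M0' := le_trans (normr_ge0 _) M0.
    by rewrite !addr_ge0// mulr_ge0.
  have [] := DM _ Sk; rewrite /q/affmap/= !mul0r !addr0 => h1 h2.
  have k1 : k * `|u.1| <= M + `|c.1|.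
    rewrite -[k in leLHS]gtr0_norm// -normrM.
    rewrite -[k * u.1](addrK c.1) (le_trans (ler_normB _ _))// lerD2r.
    by rewrite addrC.
  have k2 : k * `|u.2| <= M + `|c.2|.
    rewrite -[k in leLHS]gtr0_norm// -normrM.
    rewrite -[k * u.2](addrK c.2) (le_trans (ler_normB _ _))// lerD2r.
    by rewrite addrC.
  rewrite mulrDr; lra.
pose k := sup S.
have k1 : 1 <= k by apply: sup_upper_bound.
have clk : closure D (q k).
  move=> B nB; have /cq : nbhs (q k) B by [].
  move=> /nbhs_ballP[e /= e0 eB].
  have [k' Sk' kk'] := sup_adherent e0 supS.
  exists (q k'); split => //; apply: eB; rewrite /ball/= ger0_norm.
    by rewrite -/k in kk'; lra.
  by rewrite subr_ge0; apply: sup_upper_bound.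
have nDk : ~ D (q k).
  move=> Dk; have nD : nbhs (q k) D by apply: open_nbhs_nbhs.
  have /nbhs_ballP[e /= e0 eB] := cq k _ nD.
  have : S (k + e / 2).
    by apply: eB; rewrite /ball/= opprD addNKr normrN gtr0_norm ?divr_gt0// ltr_pdivrMr//; lra.
  move=> /(sup_upper_bound supS); rewrite -/k; lra.
have k1' : 1 < k.
  rewrite lt_neqAle k1 andbT; apply/eqP => k1'; apply: nDk; by rewrite -k1' q1.
have [i [t [t01 E]]] := bd_edge_pt (conj clk nDk).
exists i.
rewrite (_ : x = c + k^-1 *: (edge_pt v i t - c)).
  by apply: edge_etri => //; rewrite invr_gt0 invf_lt1; lra.
have kN0 : k != 0 by rewrite gt_eqF// (lt_trans ltr01).
by rewrite -E; apply: pair_ext; rewrite /q/affmap/u/= /GRing.scale/=; field.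
Qed.

(* If two consecutive triangles had opposite orientations, they would overlap
   near their common vertex: some ray from [c] would meet both edges. *)
Lemma edet_sign_next i : 0 < edet i * edet (ordS i).
Proof.
rewrite lt_neqAle eq_sym mulf_neq0 ?edet_neq0//= leNgt; apply/negP => neg.
pose j := ordS i; pose b := v j - c.
pose al := edet i; pose be := edet j; pose K := det2 (evec i) (evec j).
have al0 : al != 0 by exact: edet_neq0.
have be0 : be != 0 by exact: edet_neq0.
have alE : al = det2 b (evec i) by rewrite /al/edet/det2/b/j/evec/=; ring.
pose Y := 1 + (`|K - be| + 1) / `|al|; pose X := (K - al * Y) / be.
have nal : 0 < `|al| by rewrite normr_gt0.
have Y1 : 1 < Y by rewrite ltrDl divr_gt0// ltr_wpDl.
have aY : `|al| * Y = `|al| + `|K - be| + 1.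
  by rewrite /Y mulrDr mulr1 mulrCA divff ?mulr1 ?addrA// gt_eqF.
have X1 : 1 < X.
  have := ler_norm (K - be); have := ler_norm (- (K - be)); rewrite normrN => h1 h2.
  move: aY neg; rewrite -/al -/be /X; case: (ltgtP be 0) be0 => // be0 _.
    rewrite ltr_ndivlMr//; have [a0|a0|a0] := ltgtP al 0; last by rewrite a0 eqxx in al0.
      by rewrite nmulr_rlt0// ltNge ltW.
    rewrite gtr0_norm// => aY _; lra.
  rewrite ltr_pdivlMr//; have [a0|a0|a0] := ltgtP al 0; last by rewrite a0 eqxx in al0.
    rewrite ltr0_norm// => aY _; lra.
  by rewrite pmulr_rlt0// ltNge ltW.
have XY : be * X + al * Y = K by rewrite /X; field.
have X0 : X != 0 by lra.
have Y0 : Y != 0 by lra.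
have P01 : 0 <= 1 - X^-1 < 1.
  by rewrite subr_ge0 invf_le1 ?ltrBlDr ?ltrDl ?invr_gt0; lra.
have Q01 : 0 <= Y^-1 < 1 by rewrite invr_ge0 invf_lt1; lra.
pose P := edge_pt v i (1 - X^-1); pose Q := edge_pt v j Y^-1.
have PE : P - c = affmap b (evec i) (0, 0) (- X^-1, 0).
  by rewrite /P edge_ptE /b /j /evec; apply: pair_ext; rewrite /affmap/=; ring.
have QE : Q - c = affmap b (evec j) (0, 0) (Y^-1, 0).
  by rewrite /Q edge_ptE /b /j; apply: pair_ext; rewrite /affmap/=; ring.
(* The ratio of the components of [Q - c] and [P - c] transverse to [b]. The opposite signs make it
   positive: the points are on the same ray, not on opposite ones. *)
pose k := - (be * X) / (al * Y).
have k0 : 0 < k.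
  rewrite /k mulNr -mulrN -invrN.
  have aYb : - (al * Y) * (be * X) > 0.
    rewrite mulNr oppr_gt0 mulrACA pmulr_llt0//.
    by rewrite mulr_gt0; lra.
  rewrite (_ : be * X / _ = (- (al * Y) * (be * X)) / (al * Y) ^+ 2); last first.
    by field; rewrite al0 Y0.
  by rewrite divr_gt0// exprn_even_gt0//= mulf_neq0.
have QP : Q - c = k *: (P - c).
  apply/eqP; rewrite -subr_eq0; apply/eqP.
  apply: (@det2_eq0 b (P - c)).
  - have -> : det2 b (P - c) = - al / X.
      by rewrite PE alE /det2/affmap/=; field.
    by rewrite mulf_neq0 ?oppr_eq0 ?invr_eq0.
  - rewrite PE QE /k.
    have -> : det2 b (affmap b (evec j) (0, 0) (Y^-1, 0) - - (be * X) / (al * Y) *: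
        affmap b (evec i) (0, 0) (- X^-1, 0)) =
        det2 b (evec j) / Y - (be * X) / (al * Y) * (det2 b (evec i)) / X.
      rewrite /det2/affmap/= /GRing.scale/=; field; by rewrite X0 Y0.
    by rewrite -alE -[det2 b (evec j)]/be; field; rewrite X0 Y0.
  - have -> : det2 (P - c) (Q - c - k *: (P - c)) = det2 (P - c) (Q - c).
      by rewrite /det2/= /GRing.scale/=; ring.
    rewrite PE QE.
    have -> : det2 (affmap b (evec i) (0, 0) (- X^-1, 0)) (affmap b (evec j) (0, 0) (Y^-1, 0))
       = det2 b (evec j) / Y + det2 b (evec i) / X - K / (X * Y).
      by rewrite /K/det2/affmap/=; field; rewrite X0 Y0.
    by rewrite -alE -[det2 b (evec j)]/be -XY; field; rewrite X0 Y0.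
have P1 : 0 <= 1 - X^-1 <= 1 by case/andP: P01 => -> /ltW ->.
have Q1 : 0 <= Y^-1 <= 1 by case/andP: Q01 => -> /ltW ->.
have k1 := ray_inj (edge_pt_bd i P1) (edge_pt_bd j Q1) k0 QP.
move: QP; rewrite k1 scale1r => /addIr E.
have [/eqP] := simple Q01 P01 E.
by rewrite (negbTE (ordS_neq i n3)).
Qed.

(** [sg] records whether the vertices run counterclockwise or clockwise around [c]; [polygon] allows
    both. *)
Lemma edet_sign : exists2 sg : R, sg ^+ 2 = 1 & forall i, `|edet i| = sg * edet i.
Proof.
have i0 : 'I_n by apply: (@Ordinal _ 0); apply: leq_trans n3.
have sgE i : Num.sg (edet i) = Num.sg (edet i0).
  apply: (ordS_const (f := fun i => Num.sg (edet i))) => {}i.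
  have := edet_sign_next i; have := edet_neq0 i.
  case: (ltgtP (edet i) 0) => // e0 _.
    by rewrite nmulr_rgt0// => e1; rewrite !ltr0_sg.
  by rewrite pmulr_rgt0// => e1; rewrite !gtr0_sg.
exists (Num.sg (edet i0)); first by rewrite sqr_sg edet_neq0.
by move=> i; rewrite -(sgE i) -normrEsg.
Qed.

End Star.
End Geometry.

(** * Green's formula *)

Section Green.
Variable R : realType.
Notation leb := (@lebesgue_measure R).
Notation leb2 := ((leb \x leb)%E).
Notation "'I01' h" := (\int[leb]_(t in `[0%R : R, 1%R : R]) h t)%R (at level 10).

Lemma continuous_curry (f : R * R -> R) (p u : R * R) : continuous f ->
  continuous (fun t : R => f (p.1 + t * u.1, p.2 + t * u.2)).
Proof.
move=> cf t; apply: (@continuous_comp _ _ _ (fun t : R => (p.1 + t * u.1, p.2 + t * u.2)) f).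
  apply: (@cvg_pair _ _ _ _ (nbhs (p.1 + t * u.1)) (nbhs (p.2 + t * u.2))) => /=;
    by apply: cvgD; [exact: cvg_cst|apply: cvgM; [exact: cvg_id|exact: cvg_cst]].
exact: cf.
Qed.

Lemma integrable01 (h : R -> R) (a b : R) : continuous h ->
  leb.-integrable `[a, b] (EFin \o h).
Proof.
move=> ch; apply: continuous_compact_integrable; first exact: segment_compact.
exact: continuous_subspaceT.
Qed.

Lemma FTC_is_derive (F f : R -> R) (a b : R) : a < b ->
  (forall t, is_derive t (1 : R) F (f t)) -> continuous f ->
  (\int[leb]_(t in `[a, b]) (f t)%:E = (F b - F a)%:E)%E.
Proof.
move=> ab dF cf.
have cF : continuous F.
  by move=> t; apply/differentiable_continuous/derivable1_diffP; have [] := dF t.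
rewrite (@continuous_FTC2 R f F a b ab)//.
- exact: continuous_subspaceT.
- split.
  + by move=> t _; have [] := dF t.
  + exact/cvg_at_right_filter/cF.
  + exact/cvg_at_left_filter/cF.
- by move=> t _; rewrite derive1E; have [] := dF t.
Qed.

Lemma measurable_tri : measurable (@tri R).
Proof.
have -> : @tri R = ([set z | 0 < z.1] `&` [set z | z.1 < 1]) `&`
   (~` [set z | z.2 < 0] `&` [set z | 0 < z.1 - z.2]).
  apply/seteqP; split=> z; rewrite /tri/=.
    move=> [/andP[? ?] /andP[? ?]]; do !split => //; first by apply/negP; rewrite -leNgt.
    by rewrite subr_gt0.
  by move=> [[? ?] [/negP]]; rewrite -leNgt subr_gt0 => ? ?; do !split => //; apply/andP.
have mo (g : R * R -> R) : continuous g ->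
    measurable [set z | 0 < g z] /\ measurable [set z | g z < 0].
  move=> cg; split; apply: open_measurable2.
    by apply: (@open_comp _ _ g [set t | 0 < t]) => [x _|]; [exact: cg|exact: open_gt].
  by apply: (@open_comp _ _ g [set t | t < 0]) => [x _|]; [exact: cg|exact: open_lt].
have c1 : continuous (fun z : R * R => z.1) by move=> z; exact: cvg_fst.
have c2 : continuous (fun z : R * R => z.2) by move=> z; exact: cvg_snd.
apply: measurableI; apply: measurableI.
- by case: (mo _ c1).
- apply: open_measurable2.
  by apply: (@open_comp _ _ (fun z : R * R => z.1) [set t | t < 1]) => [x _|]; [exact: c1|exact: open_lt].
- by apply: measurableC; case: (mo _ c2).
- by case: (mo (fun z => z.1 - z.2)) => // z; apply: cvgB; [exact: c1|exact: c2].
Qed.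

Lemma boxed_tri : boxed (@tri R).
Proof.
exists 1 => z [/andP[z0 z1] /andP[z2 z3]].
by rewrite gtr0_norm// ger0_norm// (ltW z1) (ltW (lt_trans z3 z1)).
Qed.

Lemma tri_integrable (g : R * R -> R) : continuous g ->
  leb2.-integrable setT ((EFin \o g) \_ (@tri R)).
Proof.
move=> cg; apply/(integrable_mkcond _ _).1; first exact: measurable_tri.
by apply: continuous_integrable => //; [exact: measurable_tri|exact: boxed_tri].
Qed.

(** Fubini on [tri] with the inner integral over the second coordinate; [tri_slice2] takes the other
    order. The inner integral is supplied as a continuous function [h], because the fundamental
    theorem of calculus will give it in closed form. *)
Lemma tri_slice1 (g : R * R -> R) (h : R -> R) : continuous g -> continuous h ->
  (forall r, 0 < r -> (\int[leb]_(t in `[0%R, r]) (g (r, t))%:E = (h r)%:E)%E) ->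
  dint (@tri R) g = I01 h.
Proof.
move=> cg ch gh; rewrite /dint /Rintegral; congr fine.
rewrite integral_mkcond -(integral12_prod_meas1 (tri_integrable cg)).
rewrite integral_itv_bndoo; last first.
  apply/measurable_EFinP/measurable_funTS; exact: continuous_measurable_fun.
rewrite [RHS]integral_mkcond; apply: eq_integral => r _; rewrite /fubini_F patchE.
case: ifPn => [|]; rewrite ?inE ?notin_setE/= in_itv/=; last first.
  move=> r01; apply: integral0_eq => t _; rewrite patchE; case: ifPn => //.
  by rewrite inE /tri/= => -[].
move=> r01; have /andP[r0 r1] := r01; rewrite -gh// -integral_itv_bndo_bndc; last first.
  apply/measurable_EFinP/measurable_funTS; apply: continuous_measurable_fun.
  have := @continuous_curry g (r, 0) (0, 1) cg => /=.
  by under eq_fun do rewrite mulr0 addr0 mulr1 add0r.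
rewrite [RHS]integral_mkcond; apply: eq_integral => t _; rewrite !patchE.
congr (if _ then _ else _); apply/idP/idP; rewrite !inE /tri/= in_itv/=.
  by case.
by [].
Qed.

Lemma tri_slice2 (g : R * R -> R) (h : R -> R) : continuous g -> continuous h ->
  (forall t, t < 1 -> (\int[leb]_(r in `[t, 1%R]) (g (r, t))%:E = (h t)%:E)%E) ->
  dint (@tri R) g = I01 h.
Proof.
move=> cg ch gh; rewrite /dint /Rintegral; congr fine.
rewrite integral_mkcond -(integral21_prod_meas1 (tri_integrable cg)).
rewrite -integral_itv_bndo_bndc; last first.
  apply/measurable_EFinP/measurable_funTS; exact: continuous_measurable_fun.
rewrite [RHS]integral_mkcond; apply: eq_integral => t _; rewrite /fubini_G patchE.
case: ifPn => [|]; rewrite ?inE ?notin_setE/= in_itv/=; last first.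
  move=> t01; apply: integral0_eq => r _; rewrite patchE; case: ifPn => //.
  rewrite inE /tri/= => -[/andP[r0 r1] /andP[t0 tr]]; exfalso; apply: t01.
  by rewrite t0 (lt_trans tr).
move=> /andP[t0 t1]; rewrite -gh// integral_itv_bndoo; last first.
  apply/measurable_EFinP/measurable_funTS; apply: continuous_measurable_fun.
  have := @continuous_curry g (0, t) (1, 0) cg => /=.
  by under eq_fun do rewrite mulr0 addr0 mulr1 add0r.
rewrite [RHS]integral_mkcond; apply: eq_integral => r _; rewrite !patchE.
congr (if _ then _ else _); apply/idP/idP; rewrite !inE /tri/= in_itv/=.
  by move=> [/andP[r0 r1] /andP[_ tr]]; rewrite tr.
by move=> /andP[tr r1]; rewrite (le_lt_trans t0 tr) r1 t0 tr.
Qed.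

Lemma dint_lin (D : set (R * R)) (a b : R) (f g : R * R -> R) : measurable D ->
  leb2.-integrable D (EFin \o f) -> leb2.-integrable D (EFin \o g) ->
  dint D (fun x => a * f x + b * g x) = a * dint D f + b * dint D g.
Proof.
move=> mD fi gi; rewrite /dint.
have Z (k : R) h : leb2.-integrable D (EFin \o h) ->
  leb2.-integrable D (EFin \o (fun x => k * h x)).
  move=> hi; rewrite (_ : EFin \o _ = fun x => (k%:E * (EFin \o h) x)%E).
    exact: integrableZl.
  by apply/funext => x.
by rewrite RintegralD ?RintegralZl//; exact: Z.
Qed.

Lemma I01_lin (a b : R) (f g : R -> R) : continuous f -> continuous g ->
  I01 (fun x => a * f x + b * g x) = a * I01 f + b * I01 g.
Proof.
move=> cf cg.
have Z (k : R) (h : R -> R) : continuous h -> continuous (fun x : R => k * h x).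
  by move=> ch x; apply: cvgM; [exact: cvg_cst|exact: ch].
by rewrite RintegralD ?RintegralZl//; apply: integrable01 => //; exact: Z.
Qed.

(** The derivatives of [psi] in its two variables are the derivatives of [phi] along [a] and [w].
    Each is integrated over [tri] along its own direction and leaves a difference of side integrals;
    Cramer's rule then isolates the partial derivatives. For a triangle of the fan, [I1] belongs to
    the edge, [I2] and [I3] to the sides towards the next and the current vertex. *)
Lemma tri_green (phi : R * R -> R) (p a w : R * R) : C1 phi ->
  let psi z := phi (affmap p a w z) in
  let I1 := I01 (fun t => psi (1, t)) in
  let I2 := I01 (fun t => psi (t, t)) in
  let I3 := I01 (fun t => psi (t, 0)) in
  det2 a w * dint (@tri R) (pd 0 phi \o affmap p a w) =
    w.2 * I1 - (w.2 + a.2) * I2 + a.2 * I3 /\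
  det2 a w * dint (@tri R) (pd 1 phi \o affmap p a w) =
    - w.1 * I1 + (w.1 + a.1) * I2 - a.1 * I3.
Proof.
move=> Cphi psi I1 I2 I3; have [cphi _ cdphi] := Cphi.
have cA := @continuous_affmap R p a w.
have cpsi : continuous psi by move=> z; apply: continuous_comp; [exact: cA|exact: cphi].
have cd i : continuous (pd i phi \o affmap p a w).
  by move=> z; apply: continuous_comp; [exact: cA|exact: cdphi].
have ccd (x y : R) : continuous (fun z => x * (pd 0 phi \o affmap p a w) z +
    y * (pd 1 phi \o affmap p a w) z).
  by move=> z; apply: cvgD; apply: cvgM; [exact: cvg_cst|exact: cd|exact: cvg_cst|exact: cd].
have c1 : continuous (fun t : R => psi (1, t)).
  have := @continuous_curry psi (1, 0) (0, 1) cpsi => /=.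
  by under eq_fun do rewrite mulr0 addr0 mulr1 add0r.
have c2 : continuous (fun t : R => psi (t, t)).
  have := @continuous_curry psi (0, 0) (1, 1) cpsi => /=.
  by under eq_fun do rewrite mulr1 add0r.
have c3 : continuous (fun t : R => psi (t, 0)).
  have := @continuous_curry psi (0, 0) (1, 0) cpsi => /=.
  by under eq_fun do rewrite mulr0 addr0 mulr1 add0r.
have ds r t : is_derive r (1 : R) (fun s => psi (s, t))
    (a.1 * (pd 0 phi \o affmap p a w) (r, t) + a.2 * (pd 1 phi \o affmap p a w) (r, t)).
  have := @C1_line R phi (p.1 + t * w.1, p.2 + t * w.2) a r Cphi => /=.
  rewrite (_ : (fun s => _) = (fun s => psi (s, t))); last first.
    by apply/funext => s; rewrite /psi/affmap/=; congr (phi (_, _)); ring.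
  by rewrite /affmap/= ![_ + t * _ + r * _]addrAC.
have dt r t : is_derive t (1 : R) (fun s => psi (r, s))
    (w.1 * (pd 0 phi \o affmap p a w) (r, t) + w.2 * (pd 1 phi \o affmap p a w) (r, t)).
  exact: (@C1_line R phi (p.1 + r * a.1, p.2 + r * a.2) w t Cphi).
have Et : dint (@tri R) (fun z => w.1 * (pd 0 phi \o affmap p a w) z +
    w.2 * (pd 1 phi \o affmap p a w) z) = I2 - I3.
  rewrite (@tri_slice1 _ (fun t => 1 * psi (t, t) + (-1) * psi (t, 0)))//.
  - by rewrite I01_lin// mul1r mulN1r.
  - by move=> t; apply: cvgD; apply: cvgM; [exact: cvg_cst|exact: c2|exact: cvg_cst|exact: c3].
  - move=> r r0; rewrite (@FTC_is_derive (fun s => psi (r, s)))//; first by congr EFin; ring.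
    have := @continuous_curry _ (r, 0) (0, 1) (ccd w.1 w.2) => /=.
    by under eq_fun do rewrite mulr0 addr0 mulr1 add0r.
have Es : dint (@tri R) (fun z => a.1 * (pd 0 phi \o affmap p a w) z +
    a.2 * (pd 1 phi \o affmap p a w) z) = I1 - I2.
  rewrite (@tri_slice2 _ (fun t => 1 * psi (1, t) + (-1) * psi (t, t)))//.
  - by rewrite I01_lin// mul1r mulN1r.
  - by move=> t; apply: cvgD; apply: cvgM; [exact: cvg_cst|exact: c1|exact: cvg_cst|exact: c2].
  - move=> t t1; rewrite (@FTC_is_derive (fun s => psi (s, t)))//; first by congr EFin; ring.
    have := @continuous_curry _ (0, t) (1, 0) (ccd a.1 a.2) => /=.
    by under eq_fun do rewrite mulr0 addr0 mulr1 add0r.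
have ci i : leb2.-integrable (@tri R) (EFin \o (pd i phi \o affmap p a w)).
  by apply: continuous_integrable => //; [exact: measurable_tri|exact: boxed_tri].
have mt := measurable_tri.
move: Et Es; rewrite !dint_lin//; move: (dint _ (pd 0 phi \o _)) (dint _ (pd 1 phi \o _)) => X Y Et Es.
have -> : I1 = a.1 * X + a.2 * Y + I2 by rewrite Es subrK.
have -> : I3 = I2 - (w.1 * X + w.2 * Y) by rewrite Et opprB addrC subrK.
by rewrite /det2; split; ring.
Qed.

Section Star.
Variables (n : nat) (v : 'I_n -> R * R) (D : set (R * R)) (c : R * R) (s : R).
Hypothesis polyD : polygon v D.
Hypothesis s_gt0 : 0 < s.
Hypothesis starD : star_shaped D (disc c s).

Let edet0 i : edet v c i != 0. Proof. exact: edet_neq0 polyD s_gt0 starD i. Qed.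

Lemma measurable_etri i : measurable (etri v c i).
Proof.
pose a := v i - c; pose w := evec v i; pose d := edet v c i.
(* [einv] is again affine, so the triangle is the preimage of [tri] under an [affmap] with explicit
   coefficients. *)
have -> : etri v c i = affmap (- (c.1 * w.2 - c.2 * w.1) / d, - (a.1 * c.2 - a.2 * c.1) / d)
    (w.2 / d, - a.2 / d) (- w.1 / d, a.1 / d) @^-1` (@tri R).
  rewrite /etri (_ : einv v c i = affmap (- (c.1 * w.2 - c.2 * w.1) / d, - (a.1 * c.2 - a.2 * c.1) / d)
    (w.2 / d, - a.2 / d) (- w.1 / d, a.1 / d))//; apply/funext => x.
  rewrite /einv /affmap /det2 -/a -/w -/d; apply: (@pair_ext R) => /=; field;
    exact: edet0.
apply: measurable_affmap_pre; exact: measurable_tri.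
Qed.

Lemma dint_star (f : R * R -> R) : continuous f ->
  dint D f = \sum_(i < n) `|edet v c i| *
    dint (@tri R) (f \o affmap c (v i - c) (evec v i)).
Proof.
move=> cf.
have oD : open D by case: polyD.
have bD : boxed D by apply: boxedP; case: polyD.
have mD := open_measurable2 oD.
have mc : measurable [set c].
  rewrite (_ : [set c] = [set c.1] `*` [set c.2]); first exact: measurableX.
  by apply/seteqP; split=> [x ->//|x [/= x1 x2]]; exact: (@pair_ext R).
have fi := continuous_integrable cf mD bD.
have c0 : leb2 [set c] = 0%E.
  rewrite (_ : [set c] = [set c.1] `*` [set c.2]).
    by rewrite product_measure1E//= lebesgue_measure_set1 mul0e.
  by apply/seteqP; split=> [x ->//|x [/= x1 x2]]; exact: (@pair_ext R).
have cover : D `\` [set c] = \big[setU/set0]_(i <- index_enum 'I_n) etri v c i.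
  apply/seteqP; split => [x [Dx xc]|x].
    have xc' : x != c by exact/eqP.
    have [i ix] := star_cover polyD s_gt0 starD Dx xc'.
    by rewrite -bigcup_seq; exists i => //=; rewrite mem_index_enum.
  rewrite -bigcup_seq => -[i _ ix]; split; first exact: (etri_sub polyD s_gt0 starD ix).
  move=> /= xc; move: ix; rewrite xc /etri/tri/= /einv/= => -[/andP[+ _] _].
  by rewrite subrr /det2/= !mul0r subrr mul0r ltxx.
transitivity (\sum_(i < n) dint (etri v c i) f); last first.
  apply: eq_bigr => i _; rewrite (@dint_affine R c (v i - c) (evec v i))//.
  - congr (_ * dint _ _); apply/seteqP; split => x; rewrite /etri/=;
    by rewrite (affmapK polyD s_gt0 starD).
  - exact: measurable_etri.
  - have -> : affmap c (v i - c) (evec v i) @^-1` etri v c i = @tri R.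
      by apply/seteqP; split => x; rewrite /etri/= (affmapK polyD s_gt0 starD).
    exact: boxed_tri.
  - exact: edet0.
rewrite /dint /Rintegral (@negligible_integral _ _ _ leb2 D [set c])// cover.
rewrite integral_bigsetU_EFin//.
- apply/esym/sum_fine => i _.
  apply: integrable_fin_num => //; first exact: measurable_etri.
  apply: continuous_integrable => //; first exact: measurable_etri.
  by have [M DM] := bD; exists M => x /(etri_sub polyD s_gt0 starD)/DM.
- exact: measurable_etri.
- exact: index_enum_uniq.
- by move=> i j _ _ [x [xi xj]]; exact: (etri_disjoint polyD s_gt0 starD xi xj).
- by apply/measurable_EFinP; apply: measurable_funTS; exact: continuous_measurable_fun2.
Qed.

Lemma edge_length_gt0 i : 0 < edge_length v i.
Proof.
have h := evec_neq0 polyD i.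
by rewrite /edge_length lt_neqAle enorm_ge0 andbT eq_sym -sqrf_eq0 gt_eqF.
Qed.

(** [nu] is the outward unit normal, its orientation corrected by [sg]. Each segment from [c] to a
    vertex is a side of two consecutive triangles, and its contributions cancel. Along an edge
    [nu . (x - c)] is constant, namely the distance from [c] to its line, which [edet_ge] bounds
    below. *)
Lemma green : exists nu : 'I_n -> 'I_2 -> R,
  [/\ forall e i, `|nu e i| <= 1,
      forall i phi, C1 phi -> dint D (pd i phi) = \sum_(e < n) nu e i * eint v e phi &
      forall e t, s <= nu e 0 * ((edge_pt v e t).1 - c.1) + nu e 1 * ((edge_pt v e t).2 - c.2)].
Proof.
have [sg sg1 sgE] := edet_sign polyD s_gt0 starD.
have nsg : `|sg| = 1.
  by apply/eqP; rewrite -(@eqrXn2 _ 2)// -normrX sg1 normr1 expr1n.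
exists (fun e i => sg * (if i == 0 then (evec v e).2 else - (evec v e).1) / edge_length v e).
split.
- move=> e i; rewrite !normrM nsg mul1r normfV (gtr0_norm (edge_length_gt0 e)).
  rewrite ler_pdivrMr ?edge_length_gt0// mul1r.
  by case: ifP => _; rewrite ?normrN; [exact: enorm_snd|exact: enorm_fst].
- move=> i phi Cphi; have [cphi _ cdphi] := Cphi.
  rewrite dint_star//.
  pose H e := I01 (fun t => phi (affmap c (v e - c) (0, 0) (t, 0))).
  have telescope (F : 'I_n -> R) : \sum_(e < n) (F (ordS e) - F e) = 0.
    rewrite sumrB [X in _ - X](reindex (@ordS n)) ?subrr//.
    exact/onW_bij/ordS_bij.
  have E1 e : I01 (fun t => phi (affmap c (v e - c) (evec v e) (1, t))) =
      I01 (fun t => phi (edge_pt v e t)).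
    apply: eq_Rintegral => t _; congr phi; rewrite edge_ptE.
    by apply: (@pair_ext R); rewrite /affmap/=; ring.
  have E2 e : I01 (fun t => phi (affmap c (v e - c) (evec v e) (t, t))) = H (ordS e).
    apply: eq_Rintegral => t _; congr phi.
    by apply: (@pair_ext R); rewrite /affmap/evec/=; ring.
  have E3 e : I01 (fun t => phi (affmap c (v e - c) (evec v e) (t, 0))) = H e.
    by apply: eq_Rintegral => t _; congr phi; apply: (@pair_ext R); rewrite /affmap/=; ring.
  elim/ord2P: i => /=.
  (* A vanishing telescoping sum is added so that both sides agree triangle by triangle. *)
  + rewrite -[RHS]addr0 -[X in _ + X](mulr0 sg).
    rewrite -[X in _ + sg * X](telescope (fun e => - (v e - c).2 * H e)) mulr_sumr -big_split.
    apply: eq_bigr => e _; have [T _] := @tri_green phi c (v e - c) (evec v e) Cphi.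
    have L0 : edge_length v e != 0 by rewrite gt_eqF// edge_length_gt0.
    rewrite E1 E2 E3 -[det2 _ _]/(edet v c e) in T.
    by rewrite sgE -[LHS]mulrA T /eint /evec/=; field.
  + rewrite -[RHS]addr0 -[X in _ + X](mulr0 sg).
    rewrite -[X in _ + sg * X](telescope (fun e => (v e - c).1 * H e)) mulr_sumr -big_split.
    apply: eq_bigr => e _; have [_ T] := @tri_green phi c (v e - c) (evec v e) Cphi.
    have L0 : edge_length v e != 0 by rewrite gt_eqF// edge_length_gt0.
    rewrite E1 E2 E3 -[det2 _ _]/(edet v c e) in T.
    by rewrite sgE -[LHS]mulrA T /eint /evec/=; field.
- move=> e t /=; have := edet_ge polyD s_gt0 starD e; rewrite sgE.
  rewrite -ler_pdivlMr ?edge_length_gt0// => /le_trans; apply.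
  rewrite /edet/det2/evec/= /GRing.scale/= le_eqVlt; apply/orP; left; apply/eqP.
  by field; rewrite gt_eqF// edge_length_gt0.
Qed.

End Star.
End Green.

(** * Polynomial functions *)

Section Polynomials.
Variable R : realType.
Implicit Types f g : R * R -> R.

Definition linset (S : set (R * R -> R)) :=
  S (fun=> 0) /\ forall k f g, S f -> S g -> S (fun x => k * f x + g x).

Lemma linsetZ S k f : linset S -> S f -> S (fun x => k * f x).
Proof.
move=> [S0 SL] Sf; have := SL k _ _ Sf S0.
by under eq_fun do rewrite addr0.
Qed.

Lemma linsetD S f g : linset S -> S f -> S g -> S (fun x => f x + g x).
Proof.
move=> [S0 SL] Sf Sg; have := SL 1 _ _ Sf Sg.
by under eq_fun do rewrite mul1r.
Qed.

Lemma linset_sum S (I : Type) (r : seq I) (P : pred I) (F : I -> R * R -> R) : linset S ->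
  (forall i, P i -> S (F i)) -> S (fun x => \sum_(i <- r | P i) F i x).
Proof.
move=> SL SF; elim: r => [|i r IH].
  by under eq_fun do rewrite big_nil; case: SL.
have [Pi|Pi] := boolP (P i).
  under eq_fun do rewrite big_cons Pi.
  by apply: linsetD => //; exact: SF.
by under eq_fun do rewrite big_cons (negbTE Pi).
Qed.

Definition mono (a b : nat) : R * R -> R := fun x => x.1 ^+ a * x.2 ^+ b.

Lemma poly_space_lin (j : int) : linset (poly_space j).
Proof.
split.
  exists (fun _ _ => 0); apply/funext => x; rewrite big1// => a _; rewrite big1// => b _.
  by rewrite !mul0r.
move=> k f g [c ->] [d ->]; exists (fun a b => k * c a b + d a b); apply/funext => x.
rewrite mulr_sumr -big_split; apply: eq_bigr => a _.
rewrite mulr_sumr -big_split; apply: eq_bigr => b _ /=; ring.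
Qed.

Lemma poly_space_mono (j : int) a b : (a + b)%:Z <= j -> poly_space j (mono a b).
Proof.
move=> abj; have aj : (a < `|j|.+1)%N by lia.
have bj : (b < `|j|.+1)%N by lia.
exists (fun a' b' => ((a' == a) && (b' == b))%:R); apply/funext => x; rewrite /mono.
rewrite (bigD1 (Ordinal aj))//= [X in _ + X]big1 ?addr0; last first.
  move=> i; rewrite -val_eqE/= => /negbTE ia; apply: big1 => k _.
  by rewrite ia !mul0r.
rewrite (bigD1 (Ordinal bj))//= [X in _ + X]big1 ?addr0; last first.
  by move=> i; rewrite -val_eqE/= => /andP[_ /negbTE ib]; rewrite ib andbF !mul0r.
by rewrite !eqxx mul1r.
Qed.

(** The induction principle for polynomials: a property closed under linear combinations, packaged
    as a set, has to be checked on monomials only. *)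
Lemma poly_space_sub (j : int) (S : set (R * R -> R)) : linset S ->
  (forall a b, (a + b)%:Z <= j -> S (mono a b)) -> poly_space j `<=` S.
Proof.
move=> SL Sm f [c ->]; apply: linset_sum => // a _; apply: linset_sum => // b ab.
have := linsetZ (c a b) SL (Sm _ _ ab).
by rewrite /mono; under eq_fun do rewrite mulrA.
Qed.

Lemma poly_space_le (i j : int) : i <= j -> poly_space i `<=` @poly_space R j.
Proof.
move=> ij; apply: poly_space_sub; first exact: poly_space_lin.
by move=> a b ab; apply: poly_space_mono; rewrite (le_trans ab).
Qed.

Lemma C1_lin : linset (@C1 R).
Proof.
split; first exact: C1_cst.
by move=> k f g Cf Cg; apply: C1D => //; exact: C1Z.
Qed.

Lemma C1X f m : C1 f -> C1 (fun x => f x ^+ m) /\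
  forall i x, pd i (fun x => f x ^+ m) x = m%:R * f x ^+ m.-1 * pd i f x.
Proof.
move=> Cf; elim: m => [|m [Cm Em]].
  split; first exact: C1_cst.
  by move=> i x; rewrite mul0r mul0r -(pd_cst i (1 : R) x).
have E : (fun x => f x ^+ m.+1) = (fun x => f x * f x ^+ m).
  by apply/funext => x; rewrite exprS.
rewrite E; split; first exact: C1M.
move=> i x; rewrite pdM// Em; case: m {Cm Em E} => [|m] /=; first by rewrite expr0; ring.
by rewrite exprS -[in RHS]natr1; ring.
Qed.

Lemma C1_mono a b : C1 (mono a b).
Proof.
apply: C1M; first exact: (C1X a (C1_xcoord R 0)).1.
exact: (C1X b (C1_xcoord R 1)).1.
Qed.

Lemma pd_mono i a b x : pd i (mono a b) x =
  if i == 0 then a%:R * mono a.-1 b x else b%:R * mono a b.-1 x.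
Proof.
have [C0 E0] := C1X a (C1_xcoord R 0); have [C2 E2] := C1X b (C1_xcoord R 1).
rewrite /mono (@pdM R i (fun x => x.1 ^+ a) (fun x => x.2 ^+ b))//.
rewrite E0 E2 !pd_xcoord; elim/ord2P: i => /=; rewrite /xcoord/=; ring.
Qed.

Lemma poly_C1 (j : int) f : poly_space j f -> C1 f.
Proof. by apply: poly_space_sub; [exact: C1_lin|move=> a b _; exact: C1_mono]. Qed.

Lemma poly_pd (j : int) i f : poly_space j f -> poly_space (j - 1) (pd i f).
Proof.
(* [C1] is carried along because [pd] is linear only on differentiable functions. *)
suff : poly_space j `<=` [set f : R * R -> R | C1 f /\ poly_space (j - 1) (pd i f)] by move=> H /H[].
have PL := poly_space_lin (j - 1).
apply: poly_space_sub => /=.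
  split.
    split; first exact: C1_cst.
    rewrite (_ : pd i _ = fun=> 0); first by case: PL.
    by apply/funext => x; exact: pd_cst.
  move=> k g h [Cg Pg] [Ch Ph]; split; first by case: C1_lin => _; apply.
  rewrite (_ : pd i _ = fun x => k * pd i g x + pd i h x).
    by case: PL => _; apply.
  by apply/funext => x; rewrite pdD ?pdZ//; exact: C1Z.
move=> a b ab; split; first exact: C1_mono.
have -> : pd i (mono a b) = fun x => if i == 0 then a%:R * mono a.-1 b x else b%:R * mono a b.-1 x.
  by apply/funext => x; exact: pd_mono.
elim/ord2P: i => /=.
  (* For exponent 0 the truncated predecessor does not lower the degree, but the factor in front is
     0. *)
  case: a ab => [|a] ab.
    by under eq_fun do rewrite mul0r; case: PL.
  by apply: linsetZ => //; apply: poly_space_mono; lia.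
case: b ab => [|b] ab.
  by under eq_fun do rewrite mul0r; case: PL.
by apply: linsetZ => //; apply: poly_space_mono; lia.
Qed.

Lemma poly_mul_xcoord (j : int) i f : poly_space j f -> poly_space (j + 1) (fun x => xcoord i x * f x).
Proof.
move: f; apply: poly_space_sub.
  have [P0 PL] := poly_space_lin (j + 1); split => /=.
    by under eq_fun do rewrite mulr0.
  move=> k f g Pf Pg; rewrite (_ : (fun x => _) = fun x => k * (xcoord i x * f x) + xcoord i x * g x).
    exact: PL.
  by apply/funext => x; ring.
move=> a b ab /=; elim/ord2P: i.
  rewrite (_ : (fun x => _) = mono a.+1 b); first by apply: poly_space_mono; lia.
  by apply/funext => x; rewrite /mono/xcoord/= exprS mulrA.
rewrite (_ : (fun x => _) = mono a b.+1); first by apply: poly_space_mono; lia.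
by apply/funext => x; rewrite /mono/xcoord/= exprS; ring.
Qed.

(** A dilated monomial is rebuilt from 1 by multiplying with one affine factor at a time, each
    raising the degree by one. *)
Lemma poly_dilation (j : int) (c : R * R) (h : R) f : poly_space j f ->
  poly_space j (f \o affmap c (h, 0) (0, h)).
Proof.
move: f; apply: poly_space_sub.
  by have [P0 PL] := poly_space_lin j; split => //= k f g; exact: PL.
have step (m : int) i (d : R) f : poly_space m f -> poly_space (m + 1) (fun x => (d + h * xcoord i x) * f x).
  move=> Pf; have := (poly_space_lin (m + 1)).2 d f (fun x => h * (xcoord i x * f x)).
  rewrite (_ : (fun x => d * f x + _) = fun x => (d + h * xcoord i x) * f x); last first.
    by apply/funext => x; ring.
  apply; first by apply: poly_space_le Pf; lia.
  by apply: linsetZ; [exact: poly_space_lin|exact: poly_mul_xcoord].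
move=> a b ab; apply: (@poly_space_le (a + b)%:Z) => //.
elim: a {ab} => [|a IH].
  elim: b => [|b IH].
    rewrite (_ : _ \o _ = mono 0 0); first exact: poly_space_mono.
    by apply/funext => x; rewrite /mono/= !expr0.
  have := step _ 1 c.2 _ IH.
  rewrite (_ : (0 + b)%N%:Z + 1 = (0 + b.+1)%N%:Z); last by lia.
  rewrite (_ : (fun x => _) = mono 0 b.+1 \o affmap c (h, 0) (0, h))//.
  by apply/funext => x; rewrite /mono/affmap/xcoord/= exprS; ring.
have := step _ 0 c.1 _ IH.
rewrite (_ : (a + b)%N%:Z + 1 = (a.+1 + b)%N%:Z); last by lia.
rewrite (_ : (fun x => _) = mono a.+1 b \o affmap c (h, 0) (0, h))//.
by apply/funext => x; rewrite /mono/affmap/xcoord/= exprS; ring.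
Qed.

End Polynomials.

(** * L^2 inner products *)

Section L2.
Context d (T : measurableType d) (R : realType) (mu : {measure set T -> \bar R}) (D : set T).
Hypothesis mD : measurable D.
Implicit Types f g h : T -> R.

(** Stated for any measure, so that it covers [inL2] on [D] as well as [inL2_edge] on the
    parametrised edges. *)
Definition L2fun f := measurable_fun D f /\ mu.-integrable D (fun x => (f x ^+ 2)%:E).

(** The product is dominated by the sum of the two squares. *)
Lemma L2_mul_integrable f g : L2fun f -> L2fun g ->
  mu.-integrable D (EFin \o (fun x => f x * g x)).
Proof.
move=> [mf fi] [mg gi].
apply: (le_integrable mD _ _ (integrableD mD fi gi)).
  by apply/measurable_EFinP; exact: measurable_funM.
move=> x _ /=; rewrite lee_fin ler_norml.
rewrite ger0_norm ?addr_ge0 ?sqr_ge0//.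
by apply/andP; split; nra.
Qed.

Lemma L2_lin (k : R) f g : L2fun f -> L2fun g -> L2fun (fun x => k * f x + g x).
Proof.
move=> Lf Lg; have [mf fi] := Lf; have [mg gi] := Lg; split.
  by apply: measurable_funD => //; apply: measurable_funM.
have fg := L2_mul_integrable Lf Lg.
have -> : (fun x => ((k * f x + g x) ^+ 2)%:E) = (fun x => (k ^+ 2)%:E * (f x ^+ 2)%:E +
    ((2 * k)%:E * (f x * g x)%:E + (g x ^+ 2)%:E))%E.
  by apply/funext => x; rewrite -!EFinM -!EFinD; congr EFin; ring.
by do 2 (apply: integrableD => //; first exact: integrableZl).
Qed.

Lemma L2_bilin (k : R) f g h : L2fun f -> L2fun g -> L2fun h ->
  Rintegral mu D (fun x => (k * f x + g x) * h x) =
  k * Rintegral mu D (fun x => f x * h x) + Rintegral mu D (fun x => g x * h x).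
Proof.
move=> Lf Lg Lh; have fh := L2_mul_integrable Lf Lh; have gh := L2_mul_integrable Lg Lh.
rewrite -RintegralZl// -RintegralD//; first by congr Rintegral; apply/funext => x; ring.
exact: (integrableZl mD k fh).
Qed.

Lemma L2_bounded f (K : R) : (mu D < +oo)%E -> measurable_fun D f ->
  (forall x, D x -> `|f x| <= K) -> L2fun f.
Proof.
move=> Doo mf fK; split => //.
apply: (measurable_bounded_integrable mD) => //; first exact: measurable_funX.
exists (K ^+ 2); split; first by rewrite num_real.
move=> y Ky x Dx /=; rewrite normrX (le_trans _ (ltW Ky))//.
by rewrite ler_pXn2r ?nnegrE ?fK// (le_trans _ (fK _ Dx)).
Qed.

End L2.

Section Form.
Variable R : realType.
Notation F := (R * R -> R).
Implicit Types (V : set F) (I : F -> R) (f g h : F).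

(* The L^2 inner products of [D] and of its edges, both of which occur as
   [I (fun x => f x * g x)], treated at once. *)
Definition l2form V I := [/\ linset V,
  (forall k f g h, V f -> V g -> V h -> I (fun x => (k * f x + g x) * h x) =
     k * I (fun x => f x * h x) + I (fun x => g x * h x)) &
  (forall f, V f -> 0 <= I (fun x => f x ^+ 2))].

Lemma formC I f g : I (fun x => f x * g x) = I (fun x => g x * f x).
Proof. by congr (I _); apply/funext => x; rewrite mulrC. Qed.

Lemma quad_discr (A B C : R) : 0 <= A ->
  (forall t, 0 <= t ^+ 2 * A + 2 * t * B + C) -> B ^+ 2 <= A * C.
Proof.
move=> A0 Q; have [A00|AN] := eqVneq A 0.
  have [->|BN] := eqVneq B 0; first by rewrite A00 expr0n/= mul0r.
  (* Without quadratic term the expression would equal -1 at this point. *)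
  have := Q (- (C + 1) / (2 * B)); rewrite A00 mulr0 add0r.
  rewrite (_ : 2 * _ * B = - (C + 1)); last by field.
  by rewrite opprD addrAC addNr add0r oppr_ge0 ler10.
have Ap : 0 < A by rewrite lt_neqAle eq_sym AN.
have := Q (- B / A); rewrite (_ : _ + _ + _ = C - B ^+ 2 / A); last by field.
by rewrite subr_ge0 ler_pdivrMr// mulrC.
Qed.

Lemma sum_cauchy_schwarz n (a b : 'I_n -> R) :
  (\sum_(e < n) a e * b e) ^+ 2 <= (\sum_(e < n) a e ^+ 2) * (\sum_(e < n) b e ^+ 2).
Proof.
apply: quad_discr => [|t]; first by apply: sumr_ge0 => e _; exact: sqr_ge0.
have -> : t ^+ 2 * (\sum_(e < n) a e ^+ 2) + 2 * t * (\sum_(e < n) a e * b e) +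
    \sum_(e < n) b e ^+ 2 = \sum_(e < n) (t * a e + b e) ^+ 2.
  rewrite !mulr_sumr -!big_split; apply: eq_bigr => e _ /=; ring.
by apply: sumr_ge0 => e _; exact: sqr_ge0.
Qed.

Section Theory.
Variables (V : set F) (I : F -> R).
Hypothesis VI : l2form V I.

Let VL : linset V. Proof. by case: VI. Qed.
Let IL k f g h : V f -> V g -> V h -> I (fun x => (k * f x + g x) * h x) =
     k * I (fun x => f x * h x) + I (fun x => g x * h x).
Proof. by case: VI => _ H _; exact: H. Qed.
Let Ige0 f : V f -> 0 <= I (fun x => f x ^+ 2).
Proof. by case: VI => _ _; apply. Qed.
Let V0 : V (fun=> 0). Proof. by case: VL. Qed.

Lemma form0 f : V f -> I (fun x => 0 * f x) = 0.
Proof.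
move=> Vf; have /= E := IL 1 V0 V0 Vf; rewrite !mul1r addr0 in E.
by apply/eqP; rewrite -(inj_eq (addrI (I (fun x => 0 * f x)))) -E addr0.
Qed.

Lemma formB f g h : V f -> V g -> V h -> I (fun x => (f x - g x) * h x) =
  I (fun x => f x * h x) - I (fun x => g x * h x).
Proof.
move=> Vf Vg Vh; have := IL (-1) Vg Vf Vh.
rewrite (_ : (fun x => (-1 * _ + _) * _) = fun x => (f x - g x) * h x); last first.
  by apply/funext => x; ring.
by rewrite mulN1r addrC.
Qed.

Lemma V_B f g : V f -> V g -> V (fun x => f x - g x).
Proof.
move=> Vf Vg; have := VL.2 (-1) _ _ Vg Vf.
by rewrite (_ : (fun x => -1 * g x + f x) = fun x => f x - g x)//; apply/funext => x; ring.
Qed.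

Lemma form_sum (J : Type) (r : seq J) (P : pred J) (G : J -> F) h :
  (forall j, P j -> V (G j)) -> V h ->
  I (fun x => (\sum_(j <- r | P j) G j x) * h x) = \sum_(j <- r | P j) I (fun x => G j x * h x).
Proof.
move=> VG Vh; elim: r => [|j r IH].
  rewrite big_nil; transitivity (I (fun x => 0 * h x)); last exact: form0.
  by congr (I _); apply/funext => x; rewrite big_nil.
rewrite big_cons; have [Pj|Pj] := boolP (P j); last first.
  by rewrite -IH; congr (I _); apply/funext => x; rewrite big_cons (negbTE Pj).
have Vj := VG _ Pj; rewrite -IH -[X in X + _]mul1r -IL//; last exact: linset_sum.
by congr (I _); apply/funext => x; rewrite big_cons Pj mul1r.
Qed.

Lemma l2norm_ge0 f : 0 <= l2norm I f.
Proof. exact: sqrtr_ge0. Qed.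

Lemma l2norm_sqr f : V f -> l2norm I f ^+ 2 = I (fun x => f x * f x).
Proof.
move=> Vf; rewrite sqr_sqrtr ?Ige0//.
Qed.

Lemma cauchy_schwarz f g : V f -> V g ->
  `|I (fun x => f x * g x)| <= l2norm I f * l2norm I g.
Proof.
move=> Vf Vg; have A0 := l2norm_ge0 f; have C0 := l2norm_ge0 g.
rewrite -ler_sqr ?nnegrE ?mulr_ge0// real_normK ?num_real// exprMn.
apply: quad_discr => [|t]; first exact: sqr_ge0.
have Vh := VL.2 t _ _ Vf Vg; have := Ige0 Vh.
under [X in I X]eq_fun do rewrite expr2.
rewrite IL// (formC _ f) (formC _ g) !IL// !l2norm_sqr// (formC _ g f).
by move/le_trans; apply; rewrite le_eqVlt; apply/orP; left; apply/eqP; ring.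
Qed.

Lemma l2normB f g : V f -> V g -> l2norm I (fun x => f x - g x) <= l2norm I f + l2norm I g.
Proof.
move=> Vf Vg; rewrite -ler_sqr ?nnegrE ?addr_ge0 ?l2norm_ge0//.
have Vd := V_B Vf Vg; rewrite l2norm_sqr// formB// (formC _ f) (formC _ g) !formB//.
rewrite sqrrD !l2norm_sqr// (formC _ g f) opprB addrA.
have := cauchy_schwarz Vf Vg; rewrite ler_norml => /andP[+ _]; lra.
Qed.

Lemma orth_lin r : V r -> linset [set g | V g /\ I (fun x => r x * g x) = 0].
Proof.
move=> Vr; split; first by split=> //; rewrite formC form0.
move=> c g1 g2 [V1 E1] [V2 E2]; split; first exact: VL.2.
by rewrite formC IL// formC E1 formC E2 mulr0 addr0.
Qed.

(** Gram-Schmidt for a form that may be degenerate. The new vector is reduced to its part [r]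
    orthogonal to the previous ones, and the component of [f - p] along [r] is added to [p]. That
    the result is in the span is expressed by membership in every linear set containing the
    generators. *)
Lemma form_proj (J : eqType) (e : J -> F) (s : seq J) f : (forall j, j \in s -> V (e j)) -> V f ->
  exists p, [/\ V p, forall S, linset S -> (forall j, j \in s -> S (e j)) -> S p &
    forall j, j \in s -> I (fun x => p x * e j x) = I (fun x => f x * e j x)].
Proof.
elim: s f => [|j s IH] f Ve Vf.
  by exists (fun=> 0); split => // S [].
have Ves i : i \in s -> V (e i) by move=> si; apply: Ve; rewrite inE si orbT.
have Vj : V (e j) by apply: Ve; rewrite mem_head.
have [p [Vp Sp Op]] := IH f Ves Vf.
have [q [Vq Sq Oq]] := IH (e j) Ves Vj.
pose r x := e j x - q x; have Vr : V r by exact: V_B.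
pose fp x := f x - p x; have Vfp : V fp by exact: V_B.
pose k := I (fun x => fp x * r x) / I (fun x => r x * r x).
(* If [r] has norm zero the quotient [k] is 0 by convention; the equation persists, since
   Cauchy-Schwarz kills its right-hand side too. *)
have kE : k * I (fun x => r x * r x) = I (fun x => fp x * r x).
  rewrite /k; have [r0|r0] := eqVneq (I (fun x => r x * r x)) 0; last by rewrite divfK.
  rewrite r0 mulr0; apply/esym/eqP; rewrite -normr_le0 (le_trans (cauchy_schwarz Vfp Vr))//.
  have : l2norm I r ^+ 2 = 0 by rewrite l2norm_sqr.
  by move=> /eqP; rewrite sqrf_eq0 => /eqP ->; rewrite mulr0.
have Or i : i \in s -> I (fun x => r x * e i x) = 0.
  by move=> si; rewrite formB ?Oq ?subrr//; exact: Ves.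
exists (fun x => k * r x + p x); split.
- exact: VL.2.
- move=> S SL Se; have Ses i : i \in s -> S (e i) by move=> si; apply: Se; rewrite inE si orbT.
  apply: SL.2; last exact: Sp.
  have := SL.2 (-1) _ _ (Sq _ SL Ses) (Se _ (mem_head _ _)).
  rewrite (_ : (fun x => _) = r)//; apply/funext => x; rewrite /r; ring.
- move=> i; rewrite inE => /predU1P[->|si]; last by rewrite IL ?Or ?Op ?mulr0 ?add0r//; exact: Ves.
  pose h x := f x - (k * r x + p x).
  have Vh : V h by apply: V_B => //; exact: VL.2.
  apply/esym/eqP; rewrite -subr_eq0 -formB//; last exact: VL.2.
  apply/eqP; rewrite -/h.
  have hs l : l \in s -> I (fun x => h x * e l x) = 0.
    move=> sl; have Vl := Ves _ sl.
    by rewrite formB ?IL ?Or ?Op ?mulr0 ?add0r ?subrr//; exact: VL.2.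
  have hq : I (fun x => h x * q x) = 0.
    suff : [set g | V g /\ I (fun x => h x * g x) = 0] q by case.
    by apply: Sq => [|l sl]; [exact: orth_lin|split; [exact: Ves|exact: hs]].
  have -> : I (fun x => h x * e j x) = I (fun x => h x * r x).
    by rewrite formC -[RHS]formC /r formB// ![I (fun x => _ * h x)]formC hq subr0.
  have -> : h = fun x => fp x - k * r x by apply/funext => x; rewrite /h/fp; ring.
  have := IL (- k) Vr Vfp Vr.
  rewrite (_ : (fun x => (- k * r x + fp x) * r x) = fun x => (fp x - k * r x) * r x); last first.
    by apply/funext => x; ring.
  by move=> ->; rewrite mulNr kE addNr.
Qed.

Lemma form_cvg (u : nat -> F) f h : (forall m, V (u m)) -> V f -> V h ->
  l2norm I (u m \- f) @[m --> \oo] --> (0 : R) ->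
  I (fun x => u m x * h x) @[m --> \oo] --> I (fun x => f x * h x).
Proof.
move=> Vu Vf Vh uf; apply/cvgrPdist_le => eps eps0.
have e0 : 0 < eps / (l2norm I h + 1) by rewrite divr_gt0// ltr_wpDl// l2norm_ge0.
move/cvgrPdist_le : uf => /(_ _ e0); apply: filterS => m.
rewrite sub0r normrN ger0_norm ?l2norm_ge0// => le.
rewrite -formB// (_ : I _ = - I (fun x => (u m x - f x) * h x)).
  rewrite normrN (le_trans (cauchy_schwarz _ Vh))//; first exact: V_B.
  apply: (le_trans (ler_wpM2r (l2norm_ge0 h) le)).
  rewrite mulrAC ler_pdivrMr ?ltr_wpDl ?l2norm_ge0// ler_wpM2l ?(ltW eps0)//.
  by rewrite lerDl ler01.
by rewrite !formB// opprB.
Qed.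

(** If [r] is the part of [e j] orthogonal to the other generators, then pairing the sum with [r]
    leaves [b j] times the square norm of [r], and Cauchy-Schwarz bounds [b j]. Definiteness on the
    combinations makes that norm nonzero. *)
Lemma coef_bound (J : eqType) (e : J -> F) (s : seq J) : uniq s ->
  (forall j, j \in s -> V (e j)) ->
  (forall b : J -> R, I (fun x => (\sum_(j <- s) b j * e j x) ^+ 2) = 0 ->
     forall j, j \in s -> b j = 0) ->
  exists2 K : R, 0 <= K & forall (b : J -> R) j, j \in s ->
    `|b j| <= K * l2norm I (fun x => \sum_(j <- s) b j * e j x).
Proof.
move=> us Ve def.
(* The induction enlarges the set [t] of coefficients bounded by one common [K], while the sum
   always runs over [s]. *)
suff H (t : seq J) : {subset t <= s} -> exists2 K : R, 0 <= K & forall (b : J -> R) j, j \in t ->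
    `|b j| <= K * l2norm I (fun x => \sum_(j <- s) b j * e j x).
  by have [K K0 HK] := H s (fun _ => id); exists K.
have Vsum (b : J -> R) (t' : seq J) (P : pred J) : {subset t' <= s} ->
    V (fun x => \sum_(j <- t' | P j) b j * e j x).
  move=> ts; rewrite (_ : (fun x => _) = fun x => \sum_(j <- t' | P j && (j \in s)) b j * e j x).
    by apply: linset_sum => // j /andP[_ sj]; apply: linsetZ => //; exact: Ve.
  apply/funext => x; rewrite big_seq_cond [RHS]big_seq_cond; apply: eq_bigl => j.
  by case jt : (j \in t') => //=; rewrite (ts _ jt) andbT.
elim: t => [|j t IH] ts; first by exists 0.
have sj : j \in s by apply: ts; rewrite mem_head.
have [K K0 HK] := IH (fun i ti => ts i (mem_behead (s := j :: t) ti)).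
pose s' := [seq i <- s | i != j].
have s's i : i \in s' -> i \in s by rewrite mem_filter => /andP[].
have [p [Vp Sp Op]] := form_proj (fun i si => Ve i (s's i si)) (Ve _ sj).
pose r x := e j x - p x; have Vr : V r by apply: V_B => //; exact: Ve.
have Or i : i \in s' -> I (fun x => r x * e i x) = 0.
  by move=> si; rewrite formB ?Op ?subrr//; apply: Ve => //; exact: s's.
have [b0 pE] : exists b : J -> R, p = fun x => \sum_(i <- s') b i * e i x.
  apply: (Sp [set g | exists b : J -> R, g = fun x => \sum_(i <- s') b i * e i x]).
    split; first by exists (fun=> 0); apply/funext => x; rewrite big1// => i _; rewrite mul0r.
    move=> k g1 g2 [b1 ->] [b2 ->]; exists (fun i => k * b1 i + b2 i); apply/funext => x.
    by rewrite mulr_sumr -big_split; apply: eq_bigr => i _ /=; ring.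
  move=> i si; exists (fun l => (l == i)%:R); apply/funext => x.
  rewrite (bigD1_seq i)//= ?filter_uniq// eqxx mul1r big1 ?addr0// => l /negbTE ->.
  by rewrite mul0r.
(* [r] is itself a combination with coefficient 1 at [j], so a zero norm would contradict [def]. *)
have rr : I (fun x => r x * r x) != 0.
  apply/eqP => r0; have := def (fun i => if i == j then 1 else - b0 i) _ j sj.
  move=> H; suff /H : I (fun x => (\sum_(i <- s) (if i == j then 1 else - b0 i) * e i x) ^+ 2) = 0.
    by rewrite eqxx => /eqP; rewrite oner_eq0.
  transitivity (I (fun x => r x * r x)); last exact: r0.
  congr (I _); apply/funext => x; rewrite expr2.
  rewrite (_ : \sum_(i <- s) _ = r x)// (bigD1_seq j)//= eqxx mul1r /r pE big_filter -sumrN.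
  by congr (_ + _); apply: eq_bigr => i /negbTE ->; rewrite mulNr.
have Orp : I (fun x => r x * p x) = 0.
  suff : [set g | V g /\ I (fun x => r x * g x) = 0] p by case.
  apply: Sp => [|l sl]; first exact: orth_lin.
  by split; [exact/Ve/s's|exact: Or].
exists (K + l2norm I r / `|I (fun x => r x * r x)|).
  by rewrite addr_ge0// divr_ge0// l2norm_ge0.
move=> b i; rewrite inE mulrDl => /predU1P[->|ti]; last first.
  by rewrite (le_trans (HK b i ti))// lerDl mulr_ge0 ?l2norm_ge0// divr_ge0// l2norm_ge0.
set f := fun x => \sum_(i <- s) b i * e i x.
have Vf : V f by exact: Vsum.
have fr : I (fun x => f x * r x) = b j * I (fun x => r x * r x).
  have Vbe l : l \in s -> V (fun x => b l * e l x) by move=> sl; apply: linsetZ => //; exact: Ve.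
  have IZ l g : l \in s -> V g -> I (fun x => (b l * e l x) * g x) = b l * I (fun x => e l x * g x).
    move=> sl Vg; have := IL (b l) (Ve _ sl) V0 Vg; rewrite form0// addr0 => <-.
    by congr (I _); apply/funext => x; rewrite addr0.
  have -> : f = fun x => 1 * (b j * e j x) + \sum_(i <- s | i != j) b i * e i x.
    by apply/funext => x; rewrite /f (bigD1_seq j)//= mul1r.
  have Vbj := Vbe _ sj; rewrite IL ?mul1r//; last exact: Vsum.
  rewrite IZ// [X in _ + X](_ : _ = 0) ?addr0.
    congr (_ * _); rewrite [in RHS]/r formB//; last exact: Ve.
    by rewrite [X in _ - X]formC Orp subr0.
  transitivity (I (fun x => (\sum_(i <- s | (i != j) && (i \in s)) b i * e i x) * r x)).
    congr (I _); apply/funext => x; congr (_ * _).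
    by rewrite big_seq_cond; apply: eq_bigl => l; rewrite andbC.
  rewrite form_sum//; last by move=> l /andP[_ sl]; exact: Vbe.
  apply: big1 => l /andP[lj sl]; rewrite IZ// formC Or ?mulr0//.
  by rewrite mem_filter lj.
have r0 : 0 < `|I (fun x => r x * r x)| by rewrite normr_gt0.
apply: (@le_trans _ _ (l2norm I r / `|I (fun x => r x * r x)| * l2norm I f)).
  by rewrite mulrAC ler_pdivlMr// -normrM -fr mulrC cauchy_schwarz.
by rewrite lerDr mulr_ge0// l2norm_ge0.
Qed.

End Theory.
End Form.

(** * The inner products on the domain and its edges; inverse estimates for polynomials *)

Section Instances.
Variable R : realType.
Notation leb := (@lebesgue_measure R).
Notation leb2 := ((leb \x leb)%E).
Implicit Types (D : set (R * R)) (f g : R * R -> R).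

Lemma dint_form D : measurable D -> l2form (inL2 D) (dint D).
Proof.
move=> mD; split.
- split.
    split; first exact: measurable_cst.
    rewrite expr0n; exact: integrable0.
  move=> k f g Lf Lg.
  exact: (@L2_lin _ (measurableTypeR R * measurableTypeR R)%type R leb2 D mD k f g Lf Lg).
- move=> k f g h Lf Lg Lh.
  exact: (@L2_bilin _ (measurableTypeR R * measurableTypeR R)%type R leb2 D mD k f g h Lf Lg Lh).
- move=> f _; apply: Rintegral_ge0 => x _; exact: sqr_ge0.
Qed.

Lemma eint_form n (v : 'I_n -> R * R) e : l2form (inL2_edge v e) (eint v e).
Proof.
have m01 : measurable (`[0%R : R, 1%R : R]%classic) by exact: measurable_itv.
split.
- split.
    split; first exact: measurable_cst.
    rewrite expr0n; exact: integrable0.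
  move=> k f g Lf Lg; exact: (@L2_lin _ (measurableTypeR R) R leb _ m01 k (f \o edge_pt v e) (g \o edge_pt v e) Lf Lg).
- move=> k f g h Lf Lg Lh; rewrite /eint mulrCA -mulrDr; congr (_ * _).
  exact: (@L2_bilin _ (measurableTypeR R) R leb _ m01 k (f \o edge_pt v e)
    (g \o edge_pt v e) (h \o edge_pt v e) Lf Lg Lh).
- move=> f _; rewrite mulr_ge0//; first exact: enorm_ge0.
  apply: Rintegral_ge0 => x _; exact: sqr_ge0.
Qed.

Lemma leb2_boxed_lty D : measurable D -> boxed D -> (leb2 D < +oo)%E.
Proof.
move=> mD [M DM].
rewrite (le_lt_trans (@leb2_boxed R D (0, 0) `|M| mD _ _)) ?ltry// => x /DM[x1 x2].
by rewrite /= !subr0; split; rewrite (le_trans _ (ler_norm M)).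
Qed.

Lemma continuous_inL2 D f : open D -> boxed D -> continuous f -> inL2 D f.
Proof.
move=> oD bD cf; have mD := open_measurable2 oD; have [K fK] := continuous_boxed cf bD.
apply: (@L2_bounded _ _ _ leb2 D mD f K) => //; first exact: leb2_boxed_lty.
exact: continuous_measurable_fun2.
Qed.

Lemma continuous_edge n (v : 'I_n -> R * R) e f : continuous f ->
  continuous (fun t : R => f (edge_pt v e t)).
Proof.
move=> cf t; apply: (@continuous_comp _ _ _ (fun t : R => edge_pt v e t) f); last exact: cf.
rewrite (_ : (fun t => edge_pt v e t) = fun t => (((1 - t) * (v e).1 + t * (v (ordS e)).1),
  ((1 - t) * (v e).2 + t * (v (ordS e)).2))); last by apply/funext.
apply: (@cvg_pair _ _ _ _ (nbhs ((1 - t) * (v e).1 + t * (v (ordS e)).1))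
  (nbhs ((1 - t) * (v e).2 + t * (v (ordS e)).2))) => /=;
  (apply: cvgD; apply: cvgM; [apply: cvgB; [exact: cvg_cst|exact: cvg_id]|exact: cvg_cst|
    exact: cvg_id|exact: cvg_cst]).
Qed.

Lemma continuous_inL2_edge n (v : 'I_n -> R * R) e f : continuous f -> inL2_edge v e f.
Proof.
move=> cf; have ce := @continuous_edge n v e f cf; split.
  by apply: measurable_funTS; exact: continuous_measurable_fun.
apply: continuous_compact_integrable; first exact: segment_compact.
apply: continuous_subspaceT => t; rewrite (_ : (fun x => _) = fun x =>
  f (edge_pt v e x) * f (edge_pt v e x)); last by apply/funext => x; rewrite expr2.
by apply: cvgM; exact: ce.
Qed.

Lemma dint_sub_sqr (D E : set (R * R)) f : measurable E -> measurable D -> boxed D ->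
  E `<=` D -> continuous f ->
  dint E (fun x => f x ^+ 2) <= dint D (fun x => f x ^+ 2).
Proof.
move=> mE mD bD ED cf.
have cf2 : continuous (fun x => f x ^+ 2).
  by move=> x; under [X in continuous_at _ X]eq_fun do rewrite expr2; apply: cvgM; exact: cf.
have bE : boxed E by have [M DM] := bD; exists M => x /ED/DM.
rewrite /dint /Rintegral fine_le//.
- by apply: integrable_fin_num => //; exact: continuous_integrable.
- by apply: integrable_fin_num => //; exact: continuous_integrable.
apply: ge0_subset_integral => //.
  by apply/measurable_EFinP; exact: continuous_measurable_fun2.
by move=> x _; rewrite lee_fin sqr_ge0.
Qed.

Lemma dint_sqr_le D f (h K : R) (c : R * R) : open D -> 0 <= h ->
  (forall x, D x -> `|x.1 - c.1| <= h /\ `|x.2 - c.2| <= h) -> boxed D -> continuous f ->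
  (forall x, D x -> `|f x| <= K) -> dint D (fun x => f x ^+ 2) <= (2 * h * K) ^+ 2.
Proof.
move=> oD h0 Dh bD cf fK; have mD := open_measurable2 oD.
have cf2 : continuous (fun x => f x ^+ 2).
  by move=> y; under [X in continuous_at _ X]eq_fun do rewrite expr2; apply: cvgM; exact: cf.
have Doo := leb2_boxed_lty mD bD.
apply: (@le_trans _ _ (dint D (fun=> K ^+ 2))).
  apply: le_Rintegral => //; first exact: continuous_integrable.
    by apply: continuous_integrable => // x; exact: cvg_cst.
  move=> x Dx; rewrite -[f x ^+ 2]real_normK ?num_real// ler_pXn2r ?nnegrE ?fK//.
  by rewrite (le_trans _ (fK _ Dx)).
rewrite /dint Rintegral_cst// exprMn mulrC ler_wpM2r ?sqr_ge0//.
rewrite -lee_fin fineK ?ge0_fin_numE//; exact: (leb2_boxed mD h0 Dh).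
Qed.

(** Where [f] does not vanish, continuity keeps its square above half its value on a box in [D],
    which has positive area. *)
Lemma dint_sqr_eq0 D f : open D -> boxed D -> continuous f ->
  dint D (fun x => f x ^+ 2) = 0 -> forall x, D x -> f x = 0.
Proof.
move=> oD bD cf f0 x Dx; apply/eqP; apply/negPn/negP => fx.
have mD := open_measurable2 oD.
have cf2 : continuous (fun x => f x ^+ 2).
  by move=> y; under [X in continuous_at _ X]eq_fun do rewrite expr2; apply: cvgM; exact: cf.
have fx2 : 0 < f x ^+ 2 / 2 by rewrite divr_gt0// exprn_even_gt0.
have nD : nbhs x D by exact: open_nbhs_nbhs.
have /cvgrPdist_lt/(_ _ fx2) nf := cf2 x.
have : nbhs x (D `&` [set y | `|f x ^+ 2 - f y ^+ 2| < f x ^+ 2 / 2]) by exact: filterI.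
move=> /nbhs_ballP[e /= e0 eB].
pose B : set (R * R) := `]x.1 - e, x.1 + e[%classic `*` `]x.2 - e, x.2 + e[%classic.
have mB : measurable B by exact: measurableX.
have BD y : B y -> D y /\ f x ^+ 2 / 2 <= f y ^+ 2.
  move=> [/=]; rewrite !in_itv/= -!ltr_distl => y1 y2.
  have [Dy /=] : (D `&` [set y | `|f x ^+ 2 - f y ^+ 2| < f x ^+ 2 / 2]) y.
    by apply: eB; split; rewrite /ball/= distrC.
  rewrite ltr_norml => /andP[b1 b2]; split=> //; lra.
have fi : leb2.-integrable D (EFin \o (fun x => f x ^+ 2)) by exact: continuous_integrable.
have I0 : (\int[leb2]_(y in D) (f y ^+ 2)%:E = 0)%E.
  transitivity ((dint D (fun y => f y ^+ 2))%:E); last by rewrite f0.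
  by rewrite /dint/Rintegral fineK//; apply: integrable_fin_num => //; exact: fi.
have mf2 : measurable_fun D (fun y => (f y ^+ 2)%:E).
  by apply/measurable_EFinP; exact: continuous_measurable_fun2.
have : (\int[leb2]_(y in B) (f x ^+ 2 / 2)%:E <= 0)%E.
  rewrite -I0; apply: (@le_trans _ _ (\int[leb2]_(y in B) (f y ^+ 2)%:E)%E).
    apply: ge0_le_integral => //.
    - by move=> y _; rewrite lee_fin ltW.
    - by apply/measurable_EFinP; exact: continuous_measurable_fun2.
    - by move=> y /BD[_ h]; rewrite lee_fin.
  apply: ge0_subset_integral => //; last by move=> y /BD[].
  by move=> y _; rewrite lee_fin sqr_ge0.
have lebB : leb2 B = ((2 * e) * (2 * e))%:E.
  rewrite /B product_measure1E//= !lebesgue_measure_itv/= !lte_fin.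
  rewrite !ltrBlDr -!addrA !ltrDl !addr_gt0//= -!EFinD -!EFinM; congr EFin; ring.
rewrite integral_cst// [X in (_ * X)%E]lebB -EFinM lee_fin leNgt.
by rewrite pmulr_rgt0// !mulr_gt0.
Qed.

Lemma poly_zero_interval (N : nat) (b : nat -> R) (r : R) : 0 < r ->
  (forall x, 0 < x < r -> \sum_(a < N) b a * x ^+ a = 0) ->
  forall a, (a < N)%N -> b a = 0.
Proof.
move=> r0 H a aN; pose p := \poly_(a < N) b a.
suff p0 : p = 0 by have := coef_poly N b a; rewrite -/p p0 coef0 aN.
apply/eqP/negPn/negP => pN0.
(* The multiples [d], ..., [N * d] are [N] distinct roots inside the interval, too many for a
   nonzero polynomial of size at most [N]. *)
pose d := r / N.+1%:R.
have d0 : 0 < d by rewrite divr_gt0.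
pose rs := [seq i.+1%:R * d | i <- iota 0 N].
have rr : all (root p) rs.
  apply/allP => _ /mapP[i iN ->]; rewrite mem_iota add0n in iN.
  rewrite rootE horner_poly; apply/eqP; apply: H.
  rewrite mulr_gt0//= /d mulrA ltr_pdivrMr// mulrC ltr_pM2l// ltr_nat ltnS.
  by case/andP: iN.
have ur : uniq rs.
  rewrite map_inj_uniq ?iota_uniq// => i j /(mulIf (lt0r_neq0 d0))/eqP.
  by rewrite eqr_nat eqSS => /eqP.
have := max_poly_roots pN0 rr ur; rewrite size_map size_iota ltnNge => /negP; apply.
exact: size_poly.
Qed.

Lemma eq_is_derive (F : R -> R) (t a b : R) :
  is_derive t (1 : R) F a -> is_derive t (1 : R) F b -> a = b.
Proof. by move=> [_ <-] [_ <-]. Qed.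

Lemma pd_dilation (c : R * R) (h : R) f i y : C1 f -> C1 (f \o affmap c (h, 0) (0, h)) ->
  pd i (f \o affmap c (h, 0) (0, h)) y = h * pd i f (affmap c (h, 0) (0, h) y).
Proof.
move=> Cf CQ; have [_ dQ _] := CQ; elim/ord2P: i.
  apply: (eq_is_derive (is_derive_pd0 (dQ 0 y))).
  have := @C1_line R f (c.1, c.2 + h * y.2) (h, 0) y.1 Cf => /=; rewrite mul0r addr0.
  have -> : (fun s => f (c.1 + s * h, c.2 + h * y.2 + s * 0)) =
      (fun t => (f \o affmap c (h, 0) (0, h)) (t, y.2)).
    by apply/funext => s; rewrite /affmap/=; congr (f (_, _)); ring.
  by congr (is_derive _ _ _ (_ * pd _ _ _)); rewrite /affmap/=; congr (_, _); ring.
apply: (eq_is_derive (is_derive_pd1 (dQ 1 y))).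
have := @C1_line R f (c.1 + h * y.1, c.2) (0, h) y.2 Cf => /=; rewrite mul0r add0r.
have -> : (fun s => f (c.1 + h * y.1 + s * 0, c.2 + s * h)) =
    (fun t => (f \o affmap c (h, 0) (0, h)) (y.1, t)).
  by apply/funext => s; rewrite /affmap/=; congr (f (_, _)); ring.
by congr (is_derive _ _ _ (_ * pd _ _ _)); rewrite /affmap/=; congr (_, _); ring.
Qed.

(** A square of exponents rather than the triangle given by the total degree: sums over it are
    iterated sums, and independence reduces to one variable at a time. *)
Definition exps (N : nat) : seq (nat * nat) := [seq (a, b) | a <- iota 0 N, b <- iota 0 N].

Lemma mem_exps N j : (j \in exps N) = (j.1 < N)%N && (j.2 < N)%N.
Proof.
case: j => a b; apply/allpairsPdep/andP => /= [[a' [b' []]]|[aN bN]].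
  by rewrite !mem_iota => /andP[_ aN] /andP[_ bN] [-> ->].
by exists a, b; rewrite !mem_iota.
Qed.

Lemma sum_exps N (G : nat -> nat -> R) :
  \sum_(j <- exps N) G j.1 j.2 = \sum_(a < N) \sum_(b < N) G a b.
Proof.
rewrite big_allpairs_dep/= -(big_mkord xpredT (fun a => \sum_(b < N) G a b)) /index_iota subn0.
by apply: eq_bigr => a _; rewrite -(big_mkord xpredT (fun b => G a b)) /index_iota subn0.
Qed.

Lemma poly_space_exps (k : nat) f : poly_space k%:Z f ->
  exists b : nat * nat -> R, f = fun x => \sum_(j <- exps k.+1) b j * @mono R j.1 j.2 x.
Proof.
move: f; apply: poly_space_sub.
  split; first by exists (fun=> 0); apply/funext => x; rewrite big1// => j _; rewrite mul0r.
  move=> l f g [b1 ->] [b2 ->]; exists (fun j => l * b1 j + b2 j); apply/funext => x.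
  by rewrite mulr_sumr -big_split; apply: eq_bigr => j _ /=; ring.
move=> a b ab; exists (fun j => (j == (a, b))%:R); apply/funext => x.
have us : uniq (exps k.+1) by rewrite allpairs_uniq ?iota_uniq// => -[? ?] [? ?] _ _ /= [-> ->].
rewrite (bigD1_seq (a, b))//= ?mem_exps/=; last by apply/andP; lia.
by rewrite eqxx mul1r big1 ?addr0// => j /negbTE ->; rewrite mul0r.
Qed.

Lemma mono_independent N (b : nat -> nat -> R) (r : R) : 0 < r ->
  (forall x y, 0 < x < r -> 0 < y < r -> \sum_(i < N) \sum_(j < N) b i j * (x ^+ i * y ^+ j) = 0) ->
  forall i j, (i < N)%N -> (j < N)%N -> b i j = 0.
Proof.
move=> r0 H i j iN jN.
apply: (@poly_zero_interval N (b i) r r0) => // y yr.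
apply: (@poly_zero_interval N (fun i => \sum_(j < N) b i j * y ^+ j) r r0) => // x xr.
rewrite -[RHS](H x y xr yr); apply: eq_bigr => l _; rewrite mulr_suml.
by apply: eq_bigr => m _; rewrite mulrAC mulrA.
Qed.

(* After the dilation to the unit box, the monomials are linearly independent
   in L^2 of the fixed disc of radius [rho], which bounds the coefficients. *)
Lemma inverse_estimate (k : nat) (rho : R) : 0 < rho ->
  exists2 K : R, 0 <= K & forall (D : set (R * R)) (c : R * R) (h : R) q,
    open D -> boxed D -> disc c (rho * h) `<=` D -> 0 < h -> poly_space k%:Z q ->
    forall x, `|x.1 - c.1| <= h -> `|x.2 - c.2| <= h ->
      `|q x| <= K / h * l2norm (dint D) q /\
      forall i, `|pd i q x| <= K / h ^+ 2 * l2norm (dint D) q.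
Proof.
move=> rho0; set B : set (R * R) := disc (0, 0) rho.
have oB : open B by exact: open_disc.
have bB : boxed B.
  exists rho => x; have h1 := enorm_fst x; have h2 := enorm_snd x.
  rewrite /B/disc/mkset (_ : x - (0, 0) = x); last exact: subr0.
  move=> /ltW Bx.
  by split; [rewrite (le_trans h1)|rewrite (le_trans h2)].
have mB := open_measurable2 oB.
have FB := dint_form mB.
pose s := exps k.+1; pose e (j : nat * nat) := @mono R j.1 j.2.
have us : uniq s by rewrite allpairs_uniq ?iota_uniq// => -[? ?] [? ?] _ _ /= [-> ->].
have cm a b : continuous (@mono R a b) by have [] := C1_mono R a b.
have Ve j : j \in s -> inL2 B (e j) by move=> _; apply: continuous_inL2 => //; exact: cm.
have csum (b : nat * nat -> R) : continuous (fun x => \sum_(j <- s) b j * e j x).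
  apply: (@linset_sum R (fun f => continuous f)) => [|j _].
    split; first by move=> x; exact: cvg_cst.
    by move=> l f g cf cg x; apply: cvgD; [apply: cvgM; [exact: cvg_cst|exact: cf]|exact: cg].
  by move=> x; apply: cvgM; [exact: cvg_cst|exact: cm].
have [K K0 HK] : exists2 K : R, 0 <= K & forall (b : nat * nat -> R) j, j \in s ->
    `|b j| <= K * l2norm (dint B) (fun x => \sum_(j <- s) b j * e j x).
  apply: (coef_bound FB us Ve) => b b0 [i j]; rewrite mem_exps/= => /andP[ik jk].
  have Z := dint_sqr_eq0 oB bB (csum b) b0.
  (* The square with side [rho / 2] in the positive quadrant is contained in the disc [B]. *)
  apply: (@mono_independent k.+1 (fun i j => b (i, j)) (rho / 2)) => //; first by rewrite divr_gt0.
  move=> x y /andP[x0 xr] /andP[y0 yr].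
  rewrite -(sum_exps k.+1 (fun i j => b (i, j) * (x ^+ i * y ^+ j))).
  rewrite -[RHS](Z (x, y)).
    by apply: eq_bigr => -[].
  rewrite /B/disc/= enorm_lt//= !subr0; nra.
pose N := k.+1%:R ^+ 2 : R.
have N0 : 0 <= N by exact: sqr_ge0.
(* [N] monomials, each of modulus at most 1 on the unit box; differentiation costs an exponent, at
   most [k]; [K] bounds the coefficients. *)
exists (N * k.+1%:R * K); first by rewrite !mulr_ge0.
move=> D c h q oD bD BD h0 Pq x x1 x2.
pose A := affmap c (h, 0) (0, h); pose Q := q \o A.
have Cq := poly_C1 Pq; have PQ := poly_dilation c h Pq; have CQ := poly_C1 PQ.
have [b QE] := poly_space_exps PQ.
have cq : continuous q by case: Cq.
(* The dilation multiplies areas by [h ^+ 2] and maps [B] onto the disc contained in [D]. *)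
have QB : l2norm (dint B) Q <= h^-1 * l2norm (dint D) q.
  rewrite -ler_sqr ?nnegrE ?mulr_ge0 ?invr_ge0 ?(ltW h0) ?sqrtr_ge0//.
  rewrite exprMn !sqr_sqrtr; last 2 first.
    by apply: Rintegral_ge0 => z _; exact: sqr_ge0.
    by apply: Rintegral_ge0 => z _; exact: sqr_ge0.
  have rh : 0 < rho * h by rewrite mulr_gt0.
  have AB : A @^-1` disc c (rho * h) = B.
    have E z : (A z - c).1 ^+ 2 + (A z - c).2 ^+ 2 =
        h ^+ 2 * ((z - (0, 0)).1 ^+ 2 + (z - (0, 0)).2 ^+ 2).
      by rewrite /A/affmap/=; ring.
    apply/seteqP; split => z; rewrite /B/disc/mkset/preimage/mkset !enorm_lt// E exprMn mulrC ltr_pM2r ?exprn_gt0//.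
  have cq2 : continuous (fun x => q x ^+ 2).
    by move=> y; under [X in continuous_at _ X]eq_fun do rewrite expr2; apply: cvgM; exact: cq.
  have := @dint_affine R c (h, 0) (0, h) (fun x => q x ^+ 2) (disc c (rho * h)) cq2.
  rewrite -/A AB => /(_ (open_measurable2 (@open_disc R c _ rh)) bB).
  rewrite /det2/= !mul0r subr0 mulf_neq0 ?gt_eqF// => /(_ isT).
  rewrite gtr0_norm ?mulr_gt0// => E.
  have -> : dint B (fun z => Q z ^+ 2) = h^-1 ^+ 2 * dint (disc c (rho * h)) (fun x => q x ^+ 2).
    by rewrite E mulrA -expr2 -exprMn mulVf ?gt_eqF// expr1n mul1r.
  rewrite ler_wpM2l ?sqr_ge0// dint_sub_sqr//.
    by apply: open_measurable2; apply: open_disc.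
  exact: open_measurable2.
pose y := ((x.1 - c.1) / h, (x.2 - c.2) / h).
have Ay : A y = x.
  apply: pair_ext; rewrite /A/affmap/y/=; field; exact: lt0r_neq0.
have y1 : `|y.1| <= 1 by rewrite /y/= normrM normfV (gtr0_norm h0) ler_pdivrMr// mul1r.
have y2 : `|y.2| <= 1 by rewrite /y/= normrM normfV (gtr0_norm h0) ler_pdivrMr// mul1r.
have mono1 m l : `|@mono R m l y| <= 1.
  by rewrite normrM !normrX mulr_ile1 ?exprn_ge0// exprn_ile1.
have bQ j : j \in s -> `|b j| <= K * (h^-1 * l2norm (dint D) q).
  by move=> sj; rewrite (le_trans (HK b j sj))// ler_wpM2l//; rewrite -QE.
set M := K * (h^-1 * l2norm (dint D) q) in bQ.
have M0 : 0 <= M by rewrite !mulr_ge0 ?invr_ge0 ?(ltW h0) ?sqrtr_ge0.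
have sumM (G : nat * nat -> R) (L : R) : (forall j, j \in s -> `|G j| <= L) ->
    `|\sum_(j <- s) G j| <= N * L.
  move=> GL; rewrite (le_trans (ler_norm_sum _ _ _))//.
  have -> : N * L = \sum_(j <- s) L.
    by rewrite big_const_seq count_predT iter_addr_0 size_allpairs !size_iota -mulr_natl natrM /N expr2.
  by rewrite !big_seq; apply: ler_sum => j sj; exact: GL.
have k1 : 1 <= k.+1%:R :> R by rewrite ler1n.
split.
  have -> : q x = (q \o affmap c (h, 0) (0, h)) y by rewrite /= -/A Ay.
  rewrite QE.
  apply: (@le_trans _ _ (N * M)).
    by apply: sumM => j sj; rewrite normrM -[leRHS]mulr1 ler_pM ?bQ ?mono1.
  rewrite /M (_ : N * _ = N * K / h * l2norm (dint D) q); last by rewrite !mulrA.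
  rewrite ler_wpM2r ?sqrtr_ge0// ler_wpM2r ?invr_ge0 ?(ltW h0)// ler_wpM2r//.
  by rewrite ler_peMr.
move=> i.
have -> : pd i q x = h^-1 * pd i Q y.
  by rewrite pd_dilation// -/A Ay mulKf// gt_eqF.
have -> : pd i Q y = \sum_(j <- s) b j * pd i (@mono R j.1 j.2) y.
  rewrite /Q /A QE -/s; elim: {us Ve csum HK sumM bQ} s => [|j t IH].
    by under [X in pd _ X]eq_fun do rewrite big_nil; rewrite big_nil pd_cst.
  have Ct : C1 (fun x => \sum_(j <- t) b j * @mono R j.1 j.2 x).
    by apply: linset_sum => [|l _]; [exact: C1_lin|apply: C1Z; exact: C1_mono].
  under [X in pd _ X]eq_fun do rewrite big_cons.
  by rewrite pdD ?pdZ ?big_cons ?IH//; [exact: C1_mono|apply: C1Z; exact: C1_mono].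
rewrite normrM normfV (gtr0_norm h0).
apply: (@le_trans _ _ (h^-1 * (N * (k.+1%:R * M)))).
  rewrite ler_wpM2l ?invr_ge0 ?(ltW h0)//.
  apply: sumM => j sj; rewrite normrM mulrC ler_pM ?bQ//.
  rewrite pd_mono; move: sj; rewrite mem_exps => /andP[jk jk'].
  by case: ifP => _; rewrite normrM normr_nat -[leRHS]mulr1 ler_pM ?mono1 ?ler_nat// ltnW.
rewrite /M le_eqVlt; apply/orP; left; apply/eqP; field; exact: lt0r_neq0.
Qed.

End Instances.

(** * Traces and the estimates *)

Section Domain.
Variable R : realType.
Implicit Types (D : set (R * R)) (x y c : R * R).

Lemma enorm_le_sum x : enorm x <= `|x.1| + `|x.2|.
Proof.
rewrite -ler_sqr ?nnegrE ?addr_ge0 ?enorm_ge0// enorm_sqr sqrrD !real_normK ?num_real//.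
by rewrite -addrA addrCA -[leLHS]add0r lerD// ?addrA mulrn_wge0// mulr_ge0.
Qed.

Lemma enorm_le_diam D x y : boxed D -> D x -> D y -> enorm (x - y) <= diam D.
Proof.
move=> [M DM] Dx Dy; apply: sup_upper_bound; last by exists x, y.
split; first by exists (enorm (x - y)), x, y.
exists (2 * M + 2 * M) => _ [a [b [/DM[a1 a2] /DM[b1 b2] ->]]].
rewrite (le_trans (enorm_le_sum _))//.
have := ler_normB a.1 b.1; have := ler_normB a.2 b.2; rewrite /=; lra.
Qed.

Lemma diam_gt0 D : open D -> boxed D -> D !=set0 -> 0 < diam D.
Proof.
move=> oD bD [x Dx]; have /nbhs_ballP[e /= e0 eD] : nbhs x D by exact: open_nbhs_nbhs.
have Dy : D (x.1 - e / 2, x.2).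
  apply: eD; split; rewrite /ball/= ?subrr ?normr0//.
  by rewrite opprB addrC subrK gtr0_norm ?divr_gt0// ltr_pdivrMr//; lra.
apply: lt_le_trans (enorm_le_diam bD Dx Dy); apply: lt_le_trans (enorm_fst _).
by rewrite /= opprB addrC subrK gtr0_norm ?divr_gt0.
Qed.

Lemma closure_near D c x (h : R) : boxed D -> D c -> h = diam D -> closure D x ->
  `|x.1 - c.1| <= h /\ `|x.2 - c.2| <= h.
Proof.
move=> bD Dc -> clx.
have near y : D y -> `|y.1 - c.1| <= diam D /\ `|y.2 - c.2| <= diam D.
  move=> Dy; have le := enorm_le_diam bD Dy Dc.
  by split; [have := enorm_fst (y - c)|have := enorm_snd (y - c)] => /le_trans; apply.
suff H (g : R * R -> R) : continuous g -> (forall y, D y -> `|g y| <= diam D) -> `|g x| <= diam D.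
  split; first apply: (H (fun y => y.1 - c.1)) => [y|y /near[]//].
    by apply: cvgB; [exact: cvg_fst|exact: cvg_cst].
  apply: (H (fun y => y.2 - c.2)) => [y|y /near[]//].
  by apply: cvgB; [exact: cvg_snd|exact: cvg_cst].
move=> cg Dg; rewrite leNgt; apply/negP => lt.
have : nbhs x [set y | diam D < `|g y|].
  have cn : {for x, continuous (fun y => `|g y|)} by apply: continuous_comp; [exact: cg|exact: norm_continuous].
  by apply: (cn [set t | diam D < t]); apply: open_nbhs_nbhs; split => //; exact: open_gt.
by move=> /clx[y [/Dg le]]; rewrite /= ltNge le.
Qed.

Lemma squeeze_cvg0 (f g : nat -> R) : (forall m, 0 <= f m <= g m) ->
  g m @[m --> \oo] --> (0 : R) -> f m @[m --> \oo] --> (0 : R).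
Proof.
move=> fg g0; apply: (@squeeze_cvgr _ _ _ _ (fun=> 0) g) => //; last exact: cvg_cst.
exact: nearW.
Qed.

Lemma cvg_sum_ord n (f : 'I_n -> nat -> R) (l : 'I_n -> R) :
  (forall e, f e m @[m --> \oo] --> l e) ->
  \sum_(e < n) f e m @[m --> \oo] --> \sum_(e < n) l e.
Proof.
move=> fl; elim: (index_enum _) => [|e s IH].
  by under eq_fun do rewrite big_nil; rewrite big_nil; exact: cvg_cst.
by under eq_fun do rewrite big_cons; rewrite big_cons; exact: (cvgD (fl e) IH).
Qed.

End Domain.

Section Sums.
Context d (T : measurableType d) (R : realType) (mu : {measure set T -> \bar R}) (D : set T).
Hypothesis mD : measurable D.

Lemma Rintegral_sum (I : Type) (s : seq I) (F : I -> T -> R) :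
  (forall i, mu.-integrable D (EFin \o F i)) ->
  mu.-integrable D (EFin \o (fun x => \sum_(i <- s) F i x)) /\
  Rintegral mu D (fun x => \sum_(i <- s) F i x) = \sum_(i <- s) Rintegral mu D (F i).
Proof.
move=> Fi; elim: s => [|i s [IHi IH]].
  under [X in Rintegral _ _ X]eq_fun do rewrite big_nil.
  under [X in EFin \o X]eq_fun do rewrite big_nil.
  by rewrite big_nil Rintegral_cst// mul0r; split => //; exact: integrable0.
have E : (fun x => \sum_(j <- i :: s) F j x) = (fun x => F i x + \sum_(j <- s) F j x).
  by apply/funext => x; rewrite big_cons.
rewrite E RintegralD// IH big_cons; split => //.
exact: (integrableD mD (Fi i) IHi).
Qed.

End Sums.

(** * Projections onto polynomials *)

Section Projection.
Variable R : realType.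
Implicit Types (f q : R * R -> R) (V : set (R * R -> R)).

(** Since [l2proj] selects some solution, existence is the point. On an edge the restricted
    monomials are linearly dependent, which [form_proj] tolerates. *)
Lemma l2projP V I (j : int) f : l2form V I -> poly_space j `<=` V -> V f ->
  is_l2proj I j f (l2proj I j f).
Proof.
move=> VI PV Vf; apply: xgetPex.
pose s := [seq e <- exps `|j|.+1 | (e.1 + e.2)%:Z <= j].
have se a b : (a + b)%:Z <= j -> (a, b) \in s.
  by move=> ab; rewrite mem_filter/= ab mem_exps/=; apply/andP; lia.
have es e : e \in s -> poly_space j (@mono R e.1 e.2).
  by rewrite mem_filter => /andP[ej _]; exact: poly_space_mono.
have [p [Vp Sp Op]] := form_proj VI (fun e se => PV _ (es e se)) Vf.
exists p; split; first by apply: Sp; [exact: poly_space_lin|exact: es].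
have O a b : (a + b)%:Z <= j -> I (fun x => (f x - p x) * mono a b x) = 0.
  move=> ab; rewrite (formB VI Vf Vp (PV _ (es _ (se _ _ ab)))).
  by rewrite (Op _ (se _ _ ab)) subrr.
move=> q Pq; suff [Vq] : [set q | V q /\ I (fun x => (f x - p x) * q x) = 0] q.
  by rewrite (formB VI Vf Vp Vq) => /eqP; rewrite subr_eq0 => /eqP.
move: q Pq; apply: poly_space_sub; first by apply: (orth_lin VI); exact: (V_B VI).
by move=> a b ab; split; [exact: PV (es _ (se _ _ ab))|exact: O].
Qed.

Lemma l2proj_le V I (j : int) f q : l2form V I -> poly_space j `<=` V -> V f -> poly_space j q ->
  `|I (fun x => f x * q x)| <= l2norm I (l2proj I j f) * l2norm I q.
Proof.
move=> VI PV Vf Pq; have [Pp <-] // := l2projP VI PV Vf.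
by apply: (cauchy_schwarz VI); exact: PV.
Qed.

End Projection.

Lemma le_sqrt_sum2 (R : realType) (F : 'I_2 -> 'I_2 -> R) i j : 0 <= F i j ->
  F i j <= Num.sqrt (\sum_(a < 2) \sum_(b < 2) F a b ^+ 2).
Proof.
move=> F0; rewrite -[leLHS]ger0_norm// -sqrtr_sqr ler_wsqrtr// (bigD1 i)//= (bigD1 j)//= -addrA lerDl.
by rewrite addr_ge0//; do ?(apply: sumr_ge0 => ? _); exact: sqr_ge0.
Qed.

Lemma sum2_le (R : realType) (F : 'I_2 -> 'I_2 -> R) B : (forall i j, F i j <= B) ->
  \sum_(i < 2) \sum_(j < 2) F i j <= 4 * B.
Proof.
move=> FB; rewrite !sum2; have := FB 0 0; have := FB 0 1; have := FB 1 0; have := FB 1 1.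
lra.
Qed.

(** * Stability of the projection on a given polygon *)

Section Estimates.
Variable R : realType.
Variables (k r : nat) (rho K : R) (n : nat) (v : 'I_n -> R * R) (D : set (R * R)) (c : R * R).
Variable nu : 'I_n -> 'I_2 -> R.
Notation h := (diam D).
Hypothesis rho0 : 0 < rho.
Hypothesis K0 : 0 <= K.
Hypothesis n_gt0 : (0 < n)%N.
Hypothesis oD : open D.
Hypothesis bD : boxed D.
Hypothesis h0 : 0 < h.
Hypothesis Dnear : forall x, D x -> `|x.1 - c.1| <= h /\ `|x.2 - c.2| <= h.
Hypothesis Enear : forall e (t : R), 0 <= t <= 1 ->
  `|(edge_pt v e t).1 - c.1| <= h /\ `|(edge_pt v e t).2 - c.2| <= h.
Hypothesis edge_long : forall e, rho * h <= edge_length v e.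
Hypothesis nu_le1 : forall e i, `|nu e i| <= 1.
Hypothesis green : forall i phi, C1 phi ->
  dint D (pd i phi) = \sum_(e < n) nu e i * eint v e phi.
Hypothesis nu_radial : forall e t,
  rho * h <= nu e 0 * ((edge_pt v e t).1 - c.1) + nu e 1 * ((edge_pt v e t).2 - c.2).

Let mD : measurable D. Proof. exact: open_measurable2. Qed.
Let FD : l2form (inL2 D) (dint D). Proof. exact: dint_form. Qed.
Let FE e : l2form (inL2_edge v e) (eint v e). Proof. exact: eint_form. Qed.

Let dintL (a b : R) (f g : R * R -> R) : continuous f -> continuous g ->
  dint D (fun x => a * f x + b * g x) = a * dint D f + b * dint D g.
Proof. by move=> cf cg; apply: dint_lin => //; exact: continuous_integrable. Qed.

Let cM (f g : R * R -> R) : continuous f -> continuous g -> continuous (fun x => f x * g x).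
Proof. by move=> cf cg x; apply: cvgM; [exact: cf|exact: cg]. Qed.

Lemma C1_inL2 f : C1 f -> inL2 D f.
Proof. by move=> [cf _ _]; exact: continuous_inL2. Qed.

Lemma C1_inL2_edge e f : C1 f -> inL2_edge v e f.
Proof. by move=> [cf _ _]; exact: continuous_inL2_edge. Qed.

Lemma pd_inL2 i f : C1 f -> inL2 D (pd i f).
Proof. by move=> [_ _ cf]; exact: continuous_inL2. Qed.

Lemma edge_gt0 e : 0 < edge_length v e.
Proof. by rewrite (lt_le_trans _ (edge_long e))// mulr_gt0. Qed.

Lemma eint_le e f g : continuous f -> continuous g ->
  (forall t, 0 <= t <= 1 -> f (edge_pt v e t) <= g (edge_pt v e t)) -> eint v e f <= eint v e g.
Proof.
move=> cf cg fg; rewrite /eint ler_wpM2l ?(ltW (edge_gt0 e))//.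
apply: le_Rintegral; first exact: measurable_itv.
- by apply: integrable01; exact: continuous_edge.
- by apply: integrable01; exact: continuous_edge.
- by move=> t /=; rewrite in_itv/=; exact: fg.
Qed.

Lemma eint_cst e a : eint v e (fun=> a) = edge_length v e * a.
Proof.
rewrite /eint Rintegral_cst; last exact: measurable_itv.
have l1 : fine (@lebesgue_measure R `[0%R, 1%R]%classic) = 1.
  by rewrite lebesgue_measure_itv/= lte_fin ltr01 oppr0 addr0.
by rewrite [X in a * X]l1 mulr1.
Qed.

Definition perimeter := \sum_(e < n) edge_length v e.

Lemma perimeter_ge : rho * h <= perimeter.
Proof.
rewrite /perimeter (bigD1 (Ordinal n_gt0))//= (le_trans (edge_long (Ordinal n_gt0)))//.
by rewrite lerDl sumr_ge0// => e _; exact: ltW (edge_gt0 e).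
Qed.

Definition xoff i : R * R -> R := fun x => xcoord i x - xcoord i c.

Lemma C1_xoff i : C1 (xoff i).
Proof. by apply: C1B; [exact: C1_xcoord|exact: C1_cst]. Qed.

Lemma pd_xoff i j x : pd i (xoff j) x = (i == j)%:R.
Proof.
rewrite (pdB i x (C1_xcoord R j) (C1_cst (xcoord j c))) pd_xcoord.
by rewrite (pd_cst i (xcoord j c)) subr0.
Qed.

(* Green's formula for the radial field [phi (x - c)], whose normal component
   is at least [rho h phi] on the boundary. *)
Lemma radial_green phi : C1 phi -> (forall x, 0 <= phi x) ->
  rho * h * \sum_(e < n) eint v e phi <=
  \sum_(i < 2) dint D (pd i (fun x => phi x * xoff i x)).
Proof.
move=> Cphi phi0.
have Cp i : C1 (fun x => phi x * xoff i x) by apply: C1M => //; exact: C1_xoff.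
rewrite (eq_bigr (fun i => \sum_(e < n) nu e i * eint v e (fun x => phi x * xoff i x))); last first.
  by move=> i _; rewrite green.
rewrite exchange_big mulr_sumr; apply: ler_sum => e _; rewrite sum2.
have V i : inL2_edge v e (fun x => phi x * xoff i x) by exact: C1_inL2_edge.
have V1 : inL2_edge v e (fun=> 1) by apply: C1_inL2_edge; exact: C1_cst.
have VP : inL2_edge v e phi by exact: C1_inL2_edge.
have [VL IL _] := FE e.
(* Bilinearity paired with the constant 1 makes [eint] linear. *)
have lin a f g : inL2_edge v e f -> inL2_edge v e g ->
    a * eint v e f + eint v e g = eint v e (fun x => a * f x + g x).
  move=> Vf Vg; have := IL a f g _ Vf Vg V1.
  by under eq_fun do rewrite mulr1; under [X in _ * eint _ _ X]eq_fun do rewrite mulr1;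
    under [X in _ + eint _ _ X]eq_fun do rewrite mulr1; move=> ->.
have V0 : inL2_edge v e (fun=> 0) by case: VL.
have e0 : eint v e (fun=> 0) = 0 by rewrite eint_cst mulr0.
have eZ a f : inL2_edge v e f -> a * eint v e f = eint v e (fun x => a * f x).
  move=> Vf; have := lin a f _ Vf V0; rewrite e0 addr0 => ->.
  by congr (eint _ _ _); apply/funext => x; rewrite addr0.
have C1p := C1Z (nu e 1) (Cp 1).
rewrite (eZ (rho * h))// (eZ (nu e 1))// lin//; last exact: C1_inL2_edge.
apply: eint_le.
- by have [] := C1Z (rho * h) Cphi.
- by have [] := C1D (C1Z (nu e 0) (Cp 0)) C1p.
- move=> t _; rewrite /xoff /xcoord.
  have := ler_wpM2r (phi0 (edge_pt v e t)) (nu_radial e t).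
  set z := edge_pt v e t; rewrite eqxx /=.
  by move/le_trans; apply; rewrite le_eqVlt; apply/orP; left; apply/eqP; ring.
Qed.

(** The divergence of [x - c] is 2 and the area is at most [(2 * h) ^+ 2], so [rho * h] times the
    perimeter is at most [8 * h ^+ 2]. *)
Lemma perimeter_le : perimeter <= 8 * h / rho.
Proof.
have := radial_green (C1_cst (1 : R)) (fun=> ler01).
have -> : \sum_(e < n) eint v e (fun=> 1) = perimeter.
  by apply: eq_bigr => e _; rewrite eint_cst mulr1.
have E i : dint D (pd i (fun x => 1 * xoff i x)) = dint D (fun=> 1).
  congr dint; apply/funext => x; rewrite (_ : (fun x => _) = xoff i) ?pd_xoff ?eqxx//.
  by apply/funext => y; rewrite mul1r.
rewrite sum2 !E => le.
have A1 : dint D (fun=> 1) <= (2 * h * 1) ^+ 2.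
  rewrite (_ : (fun=> 1) = fun x : R * R => (1 : R) ^+ 2); last by apply/funext => x; rewrite expr1n.
  apply: (@dint_sqr_le R D (fun=> 1) h 1 c) => //; first exact: ltW.
  - by move=> x; exact: cvg_cst.
  - by move=> x _; rewrite normr1.
rewrite ler_pdivlMr// -(ler_pM2r h0).
rewrite (_ : perimeter * rho * h = rho * h * perimeter); last by ring.
by rewrite (le_trans le)//; nra.
Qed.

Lemma weak_pdP i u : inH1 D u -> is_weak_pd D i u (weak_pd D i u).
Proof. by move=> [_ /(_ i)]; exact: xgetPex. Qed.

Lemma weak_pd_inL2 i u : inH1 D u -> inL2 D (weak_pd D i u).
Proof. by move=> /(weak_pdP i)[]. Qed.

(** For the smooth approximants of [u] this is [green] applied to a product. Each term is an inner
    product with a fixed function, so [form_cvg] passes to the limit in all of them. *)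
Lemma integration_by_parts u g q i : inH1 D u -> is_trace v D u g -> C1 q ->
  dint D (fun x => weak_pd D i u x * q x) =
  - dint D (fun x => u x * pd i q x) + \sum_(e < n) nu e i * eint v e (fun x => g x * q x).
Proof.
move=> Hu [Lg [phi [sphi cu cdu cg]]] Cq.
have Cphi m : C1 (phi m) by exact: smooth_C1.
have Lu : inL2 D u by case: Hu.
have T1 := form_cvg FD (fun m => pd_inL2 i (Cphi m)) (weak_pd_inL2 i Hu) (C1_inL2 Cq) (cdu i).
have T2 := form_cvg FD (fun m => C1_inL2 (Cphi m)) Lu (pd_inL2 i Cq) cu.
have T3 e := form_cvg (FE e) (fun m => C1_inL2_edge e (Cphi m)) (Lg e) (C1_inL2_edge e Cq) (cg e).
have T4 : \sum_(e < n) nu e i * eint v e (fun x => phi m x * q x) @[m --> \oo] -->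
    \sum_(e < n) nu e i * eint v e (fun x => g x * q x).
  apply: cvg_sum_ord => e; apply: cvgM; [exact: cvg_cst|exact: T3].
have E : (fun m => dint D (fun x => pd i (phi m) x * q x)) =
    (fun m => - dint D (fun x => phi m x * pd i q x) + \sum_(e < n) nu e i * eint v e (fun x => phi m x * q x)).
  apply/funext => m; rewrite -green; last exact: C1M.
  have [cp _ /(_ i) cdp] := Cphi m; have [cq _ /(_ i) cdq] := Cq.
  have -> : pd i (fun x => phi m x * q x) = fun x => 1 * (phi m x * pd i q x) + 1 * (pd i (phi m) x * q x).
    by apply/funext => x; rewrite pdM// !mul1r [q x * _]mulrC.
  by rewrite (dintL 1 1 (cM cp cdq) (cM cdp cq)) !mul1r addKr.
rewrite E in T1; exact: (cvg_unique _ T1 (cvgD (cvgN T2) T4)).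
Qed.

(* [radial_green] with [phi = w ^ 2] is a trace inequality for smooth [w]. *)
Lemma trace_unique u g g' : inH1 D u -> is_trace v D u g -> is_trace v D u g' ->
  forall e, eint v e g = eint v e g'.
Proof.
move=> Hu [Lg [phi [sphi cu cdu cg]]] [Lg' [psi [spsi cu' cdu' cg']]] e.
have Cphi m : C1 (phi m) by exact: smooth_C1.
have Cpsi m : C1 (psi m) by exact: smooth_C1.
have Lu : inL2 D u by case: Hu.
(* Both sequences approximate [u], hence [w] tends to 0 in H^1. *)
pose w m x := phi m x - psi m x.
have Cw m : C1 (w m) by exact: C1B.
have Lw m := C1_inL2 (Cw m).
have triangle V I (VI : l2form V I) (f1 f2 : nat -> R * R -> R) f :
    (forall m, V (f1 m)) -> (forall m, V (f2 m)) -> V f ->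
    l2norm I (f1 m \- f) @[m --> \oo] --> (0 : R) ->
    l2norm I (f2 m \- f) @[m --> \oo] --> (0 : R) ->
    l2norm I (fun x => f1 m x - f2 m x) @[m --> \oo] --> (0 : R).
  move=> V1 V2 Vf c1 c2.
  apply: (@squeeze_cvg0 R _ (fun m => l2norm I (f1 m \- f) + l2norm I (f2 m \- f))); last first.
    by have := cvgD c1 c2; rewrite addr0; exact.
  move=> m; rewrite sqrtr_ge0/=.
  rewrite (_ : (fun x => f1 m x - f2 m x) = fun x => (f1 m \- f) x - (f2 m \- f) x); last first.
    by apply/funext => x /=; ring.
  by apply: (l2normB VI); apply: (V_B VI).
have w0 : l2norm (dint D) (w m) @[m --> \oo] --> (0 : R).
  by apply: (triangle _ _ FD _ _ u) => // m; exact: C1_inL2.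
have dw0 i : l2norm (dint D) (pd i (w m)) @[m --> \oo] --> (0 : R).
  rewrite (_ : (fun m => _) = fun m => l2norm (dint D) (fun x => pd i (phi m) x - pd i (psi m) x)).
    apply: (triangle _ _ FD _ _ (weak_pd D i u)) => // [m|m|]; try exact: pd_inL2.
    exact: weak_pd_inL2.
  by apply/funext => m; congr l2norm; apply/funext => x; rewrite pdB.
have V1 : inL2_edge v e (fun=> 1) by apply: C1_inL2_edge; exact: C1_cst.
have Lwe m : inL2_edge v e (w m) by exact: C1_inL2_edge.
have rh : 0 < rho * h by rewrite mulr_gt0.
(* The divergence of [w ^+ 2 * (x - c)] is twice the square of [w] plus twice [w] times the radial
   derivative; the coordinates of [x - c] are at most [h]. *)
pose Z m := (2 * l2norm (dint D) (w m) ^+ 2 + 2 * h * l2norm (dint D) (w m) *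
  (l2norm (dint D) (pd 0 (w m)) + l2norm (dint D) (pd 1 (w m)))) / (rho * h).
have Z0 : Z m @[m --> \oo] --> (0 : R).
  rewrite -[X in _ --> X](_ : (2 * 0 ^+ 2 + 2 * h * 0 * (0 + 0)) / (rho * h) = 0); last first.
    by rewrite expr0n/= !mulr0 mul0r addr0 mul0r.
  apply: cvgM; last exact: cvg_cst.
  apply: cvgD; first by apply: cvgM; [exact: cvg_cst|exact: (cvg_comp _ _ w0 (@exprn_continuous _ 2 0))].
  by apply: cvgM; [apply: cvgM => //; exact: cvg_cst|apply: cvgD].
have wZ m : l2norm (eint v e) (w m) ^+ 2 <= Z m.
  have Cw2 : C1 (fun x => w m x * w m x) by exact: C1M.
  have := radial_green Cw2 (fun x => sqr_ge0 _).
  rewrite /Z ler_pdivlMr// => le.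
  rewrite mulrC (le_trans _ (le_trans le _))//.
    rewrite ler_pM2l// (l2norm_sqr (FE e))// (bigD1 e)//= lerDl; apply: sumr_ge0 => l _.
    have [_ _ H] := FE l; have := H (w m) (C1_inL2_edge l (Cw m)).
    by under eq_fun do rewrite expr2.
  have Ei i : dint D (pd i (fun x => w m x * w m x * xoff i x)) =
      dint D (fun x => w m x * w m x) + 2 * dint D (fun x => (w m x * xoff i x) * pd i (w m) x).
    have -> : pd i (fun x => w m x * w m x * xoff i x) =
       fun x => 1 * (w m x * w m x) + 2 * ((w m x * xoff i x) * pd i (w m) x).
      by apply/funext => x; rewrite (pdM i x Cw2 (C1_xoff i)) (pdM i x (Cw m) (Cw m)) pd_xoff eqxx mulr1n; ring.
    have [cw _ /(_ i) cdw] := Cw m; have [cx _ _] := C1_xoff i.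
    by rewrite (dintL 1 2 (cM cw cw) (cM (cM cw cx) cdw)) mul1r.
  have Bi i : `|dint D (fun x => (w m x * xoff i x) * pd i (w m) x)| <=
     h * l2norm (dint D) (w m) * l2norm (dint D) (pd i (w m)).
    have Lwx : inL2 D (fun x => w m x * xoff i x) by apply: C1_inL2; apply: C1M => //; exact: C1_xoff.
    rewrite (le_trans (cauchy_schwarz FD Lwx (pd_inL2 i (Cw m))))//.
    rewrite ler_wpM2r ?sqrtr_ge0// -ler_sqr ?nnegrE ?mulr_ge0 ?sqrtr_ge0 ?(ltW h0)//.
    rewrite exprMn !(l2norm_sqr FD)//.
    have [cw2 _ _] := Cw2; have [cwx _ _] := C1M (Cw m) (C1_xoff i).
    rewrite -[_ * dint D _]addr0 -[X in _ + X](mul0r (dint D (fun x => w m x * w m x))) -(dintL _ _ cw2 cw2).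
    apply: le_Rintegral => //; first by apply: continuous_integrable => //; exact: cM.
      by apply: continuous_integrable => //; have [] := C1D (C1Z (h ^+ 2) Cw2) (C1Z 0 Cw2).
    move=> x Dx; rewrite mul0r addr0.
    rewrite (_ : _ * _ = xoff i x ^+ 2 * (w m x * w m x)); last by ring.
    rewrite ler_wpM2r//; first by rewrite -expr2 sqr_ge0.
    rewrite -[xoff i x ^+ 2]real_normK ?num_real// ler_pXn2r ?nnegrE ?(ltW h0)//.
    by have [] := Dnear Dx; rewrite /xoff/xcoord; case: ifP.
  rewrite sum2 !Ei (l2norm_sqr FD)//.
  have aux (a b0 b1 N n0 n1 : R) : b0 <= h * N * n0 -> b1 <= h * N * n1 ->
    a + 2 * b0 + (a + 2 * b1) <= 2 * a + 2 * h * N * (n0 + n1) by lra.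
  exact: aux (le_trans (ler_norm _) (Bi 0)) (le_trans (ler_norm _) (Bi 1)).
have we0 : l2norm (eint v e) (w m) ^+ 2 @[m --> \oo] --> (0 : R).
  by apply: squeeze_cvg0 Z0 => m; rewrite sqr_ge0 wZ.
have T1 := form_cvg (FE e) (fun m => C1_inL2_edge e (Cphi m)) (Lg e) V1 (cg e).
have T2 := form_cvg (FE e) (fun m => C1_inL2_edge e (Cpsi m)) (Lg' e) V1 (cg' e).
have e1 f : eint v e (fun x => f x * 1) = eint v e f.
  by congr (eint _ _ _); apply/funext => x; rewrite mulr1.
pose d m := eint v e (fun x => phi m x * 1) - eint v e (fun x => psi m x * 1).
have T : d m @[m --> \oo] --> eint v e g - eint v e g' by have := cvgB T1 T2; rewrite !e1; exact.
have T' : d m ^+ 2 @[m --> \oo] --> (0 : R).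
  have E0 : edge_length v e * l2norm (eint v e) (w m) ^+ 2 @[m --> \oo] --> (0 : R).
    by rewrite -[X in _ --> X](mulr0 (edge_length v e)); apply: cvgM; [exact: cvg_cst|].
  apply: squeeze_cvg0 E0 => m; rewrite sqr_ge0/= /d.
  rewrite -(formB (FE e) (C1_inL2_edge e (Cphi m)) (C1_inL2_edge e (Cpsi m)) V1) -/(w m).
  rewrite -[X in X <= _]real_normK ?num_real//.
  have CS := cauchy_schwarz (FE e) (Lwe m) V1.
  have N1 : l2norm (eint v e) (fun=> 1) ^+ 2 = edge_length v e.
    by rewrite (l2norm_sqr (FE e))// e1 eint_cst mulr1.
  by rewrite mulrC -{1}N1 -exprMn ler_pXn2r ?nnegrE ?mulr_ge0 ?sqrtr_ge0.
have T'' : d m ^+ 2 @[m --> \oo] --> (eint v e g - eint v e g') ^+ 2.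
  exact: (cvg_comp _ _ T (@exprn_continuous _ 2 (eint v e g - eint v e g'))).
have d0 : (eint v e g - eint v e g') ^+ 2 = 0 by exact: (cvg_unique _ T'' T').
by apply/eqP; rewrite -subr_eq0 -sqrf_eq0 d0.
Qed.

(** The square root of the bound that [perimeter_le] gives for [perimeter / h]. *)
Definition trace_const := Num.sqrt (8 / rho).

Lemma trace_const_sqr : trace_const ^+ 2 = 8 / rho.
Proof. by rewrite sqr_sqrtr// divr_ge0// ltW. Qed.

Lemma trace_const_ge0 : 0 <= trace_const. Proof. exact: sqrtr_ge0. Qed.

Definition edge_sum (j : int) g := \sum_(e < n) l2norm (eint v e) (l2proj (eint v e) j g) ^+ 2.

(** On an edge the norm of [q] is at most [M] times the square root of the length. Cauchy-Schwarz
    over the edges leaves the square roots of the perimeter and of [edge_sum], and the powers of [h]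
    in their bounds cancel. *)
Lemma boundary_le (w : 'I_n -> R) (j : int) g q (B M : R) :
  (forall e, `|w e| <= 1) -> (forall e, inL2_edge v e g) -> poly_space j q -> 0 <= M -> 0 <= B ->
  (forall e (t : R), 0 <= t <= 1 -> `|q (edge_pt v e t)| <= M) -> h * edge_sum j g <= B ^+ 2 ->
  `|\sum_(e < n) w e * eint v e (fun x => g x * q x)| <= trace_const * B * M.
Proof.
move=> w1 Lg Pq M0 B0 qM SB.
have Cq := poly_C1 Pq; have Lq e : inL2_edge v e q by exact: C1_inL2_edge.
pose a e := Num.sqrt (edge_length v e).
pose b e := l2norm (eint v e) (l2proj (eint v e) j g).
have asqr e : a e ^+ 2 = edge_length v e by rewrite sqr_sqrtr// ltW ?edge_gt0.
have qe e : l2norm (eint v e) q <= a e * M.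
  rewrite -ler_sqr ?nnegrE ?mulr_ge0 ?sqrtr_ge0// exprMn asqr (l2norm_sqr (FE e))// -eint_cst.
  apply: eint_le => [||t t1].
  - by have [] := C1M Cq Cq.
  - by move=> x; exact: cvg_cst.
  - by rewrite -expr2 -[X in X <= _]real_normK ?num_real// ler_pXn2r ?nnegrE ?qM.
apply: (@le_trans _ _ (\sum_(e < n) a e * b e * M)).
  apply: (le_trans (ler_norm_sum _ _ _)); apply: ler_sum => e _.
  rewrite normrM (le_trans (ler_wpM2r (normr_ge0 _) (w1 e)))// mul1r.
  have PV : poly_space j `<=` inL2_edge v e by move=> f /poly_C1; exact: C1_inL2_edge.
  rewrite (le_trans (l2proj_le (FE e) PV (Lg e) Pq))// -/(b e).
  by rewrite [a e * _]mulrC -mulrA ler_wpM2l// sqrtr_ge0.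
rewrite -mulr_suml ler_wpM2r// -ler_sqr ?nnegrE ?mulr_ge0 ?trace_const_ge0//; last first.
  by apply: sumr_ge0 => e _; rewrite mulr_ge0// sqrtr_ge0.
rewrite (le_trans (sum_cauchy_schwarz a b))// exprMn trace_const_sqr.
have -> : \sum_(e < n) a e ^+ 2 = perimeter by apply: eq_bigr.
rewrite -[X in _ * X]/(edge_sum j g).
have S0 : 0 <= edge_sum j g by apply: sumr_ge0 => e _; exact: sqr_ge0.
rewrite (le_trans (ler_wpM2r S0 perimeter_le))//.
rewrite [leLHS](_ : _ = 8 / rho * (h * edge_sum j g)); last by ring.
by rewrite ler_wpM2l// divr_ge0// ltW.
Qed.

Definition near_center x := `|x.1 - c.1| <= h /\ `|x.2 - c.2| <= h.

(** The path of [mvt2] stays in the square around [c] even where it leaves [D], and each of its two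
    legs is at most [2 * h] long. *)
Lemma oscillation q (M : R) x y : C1 q -> 0 <= M ->
  (forall i x, near_center x -> `|pd i q x| <= M) -> near_center x -> near_center y ->
  `|q y - q x| <= 4 * h * M.
Proof.
move=> Cq M0 qM Nx Ny; have [xi [eta [xiE etaE ->]]] := mvt2 x y Cq.
have btw (a b z m : R) : a <= z <= b \/ b <= z <= a -> `|a - m| <= h -> `|b - m| <= h -> `|z - m| <= h.
  by rewrite !ler_norml; lra.
have N1 : near_center (xi, y.2) by case: Nx Ny => Nx1 _ [Ny1 ?]; split => //=; exact: btw xiE Nx1 Ny1.
have N2 : near_center (x.1, eta) by case: Nx Ny => ? Nx2 [_ Ny2]; split => //=; exact: btw etaE Nx2 Ny2.
have d1 : `|y.1 - x.1| <= 2 * h.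
  by case: Nx Ny => + _ [+ _]; rewrite !ler_norml; lra.
have d2 : `|y.2 - x.2| <= 2 * h.
  by case: Nx Ny => _ + [_ +]; rewrite !ler_norml; lra.
rewrite (le_trans (ler_normD _ _))// !normrM.
have := ler_pM (normr_ge0 _) (normr_ge0 _) (qM 0 _ N1) d1.
have := ler_pM (normr_ge0 _) (normr_ge0 _) (qM 1 _ N2) d2.
lra.
Qed.

(** The value at [x] differs from the boundary mean by at most the oscillation, and the mean is at
    most [B / rho] in modulus since the perimeter is at least [rho * h]. *)
Lemma mean_bound q (M B : R) x : C1 q -> 0 <= M ->
  (forall i x, near_center x -> `|pd i q x| <= M) -> `|bint v q| <= B * h -> near_center x ->
  `|q x| <= B / rho + 4 * h * M.
Proof.
move=> Cq M0 qM qB Nx; have [cq _ _] := Cq.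
have osc e t : 0 <= t <= 1 -> `|q (edge_pt v e t) - q x| <= 4 * h * M.
  by move=> t1; apply: oscillation => //; exact: Enear.
have ccst (a : R) : continuous (fun _ : R * R => a) by move=> y; exact: cvg_cst.
have lo : (q x - 4 * h * M) * perimeter <= bint v q.
  rewrite mulrC mulr_suml; apply: ler_sum => e _; rewrite -eint_cst; apply: eint_le => // t t1.
  by have := osc e t t1; rewrite ler_norml; lra.
have up : bint v q <= (q x + 4 * h * M) * perimeter.
  rewrite mulrC mulr_suml; apply: ler_sum => e _; rewrite -eint_cst; apply: eint_le => // t t1.
  by have := osc e t t1; rewrite ler_norml; lra.
(* For [a <= 0] the lower bound on the perimeter goes the wrong way; there [B >= 0] suffices, which
   [qB] implies. *)
have aux a : a * perimeter <= B * h -> a <= B / rho.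
  have [a0 _|a0 le] := leP a 0.
    rewrite (le_trans a0)// divr_ge0 ?(ltW rho0)//.
    by rewrite -(pmulr_lge0 _ h0) (le_trans _ qB).
  rewrite ler_pdivlMr// -(ler_pM2r h0) -mulrA (le_trans _ le)// ler_wpM2l ?(ltW a0)//.
  exact: perimeter_ge.
move: qB; rewrite !ler_norml => /andP[b1 b2].
have := aux _ (le_trans lo b2).
have : (- q x - 4 * h * M) <= B / rho.
  by apply: aux; rewrite (_ : _ * _ = - ((q x + 4 * h * M) * perimeter)); [lra|ring].
lra.
Qed.

Lemma sup_l2norm q (M : R) : continuous q -> 0 <= M -> (forall x, near_center x -> `|q x| <= M) ->
  l2norm (dint D) q <= 2 * h * M.
Proof.
move=> cq M0 qM; have h2 := ltW h0.
rewrite -[leRHS]ger0_norm ?mulr_ge0// -sqrtr_sqr ler_wsqrtr//.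
by apply: (@dint_sqr_le R D q h M c) => // x Dx; apply: qM; exact: Dnear.
Qed.

Hypothesis inverse : forall q, poly_space k%:Z q -> forall x, near_center x ->
  `|q x| <= K / h * l2norm (dint D) q /\
  forall i, `|pd i q x| <= K / h ^+ 2 * l2norm (dint D) q.

Let N q := l2norm (dint D) q.
Let N0 q : 0 <= N q. Proof. exact: sqrtr_ge0. Qed.
Let hN0 : h != 0. Proof. exact: lt0r_neq0. Qed.

Lemma l2norm_pd_le q i : poly_space k%:Z q -> N (pd i q) <= 2 * K / h * N q.
Proof.
move=> Pq; have [_ _ cq] := poly_C1 Pq.
have M0 : 0 <= K / h ^+ 2 * N q by rewrite mulr_ge0// divr_ge0// exprn_ge0// ltW.
have := sup_l2norm (cq i) M0 (fun x Nx => (inverse Pq Nx).2 i).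
by move/le_trans; apply; rewrite le_eqVlt; apply/orP; left; apply/eqP; field.
Qed.

Lemma hess_form_sum A B : (forall i j, inL2 D (A i j)) -> (forall i j, inL2 D (B i j)) ->
  hess_form D A B = \sum_(i < 2) \sum_(j < 2) dint D (fun x => A i j x * B i j x).
Proof.
move=> LA LB.
pose mu2 := (@lebesgue_measure R \x @lebesgue_measure R)%E.
have AB i j : mu2.-integrable D (EFin \o (fun x => A i j x * B i j x)).
  exact: (@L2_mul_integrable _ (measurableTypeR R * measurableTypeR R)%type R mu2 D mD _ _ (LA i j) (LB i j)).
have S i := @Rintegral_sum _ (measurableTypeR R * measurableTypeR R)%type R mu2 D mD _
  (index_enum 'I_2) _ (AB i).
have [_] := @Rintegral_sum _ (measurableTypeR R * measurableTypeR R)%type R mu2 D mD _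
  (index_enum 'I_2) _ (fun i => (S i).1).
rewrite /hess_form /dint => ->; apply: eq_bigr => i _; exact: (S i).2.
Qed.

Variable xi : R * R -> R.
Variable T : R.
Hypothesis T0 : 0 <= T.
Hypothesis Hxi : inH2 D xi.
Hypothesis kr : (maxn 3 k <= r)%N.
Hypothesis proj_le : N (l2proj (dint D) (k%:Z - 4) xi) <= T.
Hypothesis edge_le : h * edge_sum r%:Z (trace v D xi) <= T ^+ 2.
Hypothesis edge_pd_le : forall i,
  h * edge_sum (r%:Z - 1) (trace v D (weak_pd D i xi)) <= (T / h) ^+ 2.
Variable p : R * R -> R.
Hypothesis Pp : is_PiDelta k v D xi p.

(** The existence of a trace, which makes the chosen one genuine, is part of [is_PiDelta]. *)
Let tr : is_trace v D xi (trace v D xi).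
Proof. by case: Pp => _ _ _ [g [tg _]]; apply: xgetPex; exists g. Qed.

Let tr_pd i : is_trace v D (weak_pd D i xi) (trace v D (weak_pd D i xi)).
Proof. by case: Pp => _ _ /(_ i)[g [tg _]] _; apply: xgetPex; exists g. Qed.

Let Th0 : 0 <= T / h. Proof. by rewrite divr_ge0// ltW. Qed.

Let hess_poly i j : poly_space (k%:Z - 2) (hess p i j).
Proof. by case: Pp => Pk _ _ _; have := poly_pd i (poly_pd j Pk); rewrite -addrA. Qed.

Let deg (a b : nat) : a%:Z - b%:Z <= a%:Z.
Proof. by rewrite lerBlDr lerDl. Qed.

Let deg3 : k%:Z - 2 - 1 <= r%:Z. Proof. clear -kr; lia. Qed.

Let deg2 : k%:Z - 2 <= r%:Z - 1. Proof. clear -kr; lia. Qed.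

Let r_gt0 : (0 < r)%N. Proof. clear -kr; lia. Qed.

(** Four index pairs; for each, two inverse estimates in [D] give [(2 * K) ^+ 2] and the two
    boundary sums give [trace_const * K] each. *)
Definition hess_const := 4 * (4 * K ^+ 2 + 2 * trace_const * K).

(* After two integrations by parts, [xi] and its traces only meet polynomials
   of degrees at most [k - 4] in [D] and [r], [r - 1] on the edges, and may be
   replaced by their projections. *)
Lemma weak_hess_le i j :
  `|dint D (fun x => weak_hess D xi i j x * hess p i j x)| <=
  (4 * K ^+ 2 + 2 * trace_const * K) * (T * N (hess p i j) / h ^+ 2).
Proof.
have Pq := hess_poly i j; set q := hess p i j in Pq *.
have [H1 H2] := Hxi; have [Lxi _] := H1.
have Cq := poly_C1 Pq; have Pdq := poly_pd i Pq; have Cdq := poly_C1 Pdq.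
(* The inverse estimates are available in degree [k] only, so lower degrees are raised to it. *)
have dq : poly_space k%:Z q := poly_space_le (deg k 2) Pq.
have ddq : poly_space (k%:Z - 4) (pd j (pd i q)) by have := poly_pd j Pdq; rewrite -!addrA.
have dqk : poly_space k%:Z (pd i q).
  by apply: poly_space_le (poly_pd i dq); exact: (deg k 1).
rewrite /weak_hess (integration_by_parts i (H2 j) (tr_pd j) Cq).
rewrite (integration_by_parts j H1 tr Cdq).
have [[Ltr _] Ltr_pd] := (tr, fun j => (tr_pd j).1).
have PV : poly_space (k%:Z - 4) `<=` inL2 D by move=> f /poly_C1; exact: C1_inL2.
have b1 := l2proj_le FD PV Lxi ddq.
have M1 : 0 <= K / h * N q by rewrite mulr_ge0// divr_ge0// ltW.
have M2 : 0 <= K / h ^+ 2 * N q by rewrite mulr_ge0// divr_ge0// exprn_ge0// ltW.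
have Pr : poly_space r%:Z (pd i q) := poly_space_le deg3 Pdq.
have Pr1 : poly_space (r%:Z - 1) q := poly_space_le deg2 Pq.
have b2 : `|\sum_(e < n) nu e j * eint v e (fun x => trace v D xi x * pd i q x)| <=
    trace_const * T * (K / h ^+ 2 * N q).
  apply: (@boundary_le (nu^~ j) _ _ _ T _ _ Ltr Pr M2 T0 _ edge_le) => [e|e t t1]; first exact: nu_le1.
  exact: (inverse dq (Enear e t1)).2.
have b3 : `|\sum_(e < n) nu e i * eint v e (fun x => trace v D (weak_pd D j xi) x * q x)| <=
    trace_const * (T / h) * (K / h * N q).
  apply: (@boundary_le (nu^~ i) _ _ _ (T / h) _ _ (Ltr_pd j) Pr1 M1 Th0 _ (edge_pd_le j)) => [e|e t t1].
    exact: nu_le1.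
  exact: (inverse dq (Enear e t1)).1.
have {}b1 : `|dint D (fun x => xi x * pd j (pd i q) x)| <= T * (2 * K / h * (2 * K / h * N q)).
  rewrite (le_trans b1)// ler_pM ?sqrtr_ge0//.
  rewrite (le_trans (l2norm_pd_le j dqk))// ler_wpM2l ?l2norm_pd_le//.
  by rewrite divr_ge0 ?mulr_ge0// ltW.
rewrite (_ : (4 * _ + _) * _ = T * (2 * K / h * (2 * K / h * N q)) +
  (trace_const * T * (K / h ^+ 2 * N q) + trace_const * (T / h) * (K / h * N q))); last by field.
rewrite opprD opprK -addrA.
apply: (le_trans (ler_normD _ _)); apply: (lerD b1).
apply: (le_trans (ler_normD _ _)); apply: lerD _ b3.
by rewrite normrN.
Qed.

Lemma hess_le i j : N (hess p i j) <= h2seminorm D p.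
Proof.
exact: (@le_sqrt_sum2 R (fun i j => N (hess p i j)) i j (sqrtr_ge0 _)).
Qed.

Lemma h2seminorm_le : h ^+ 2 * h2seminorm D p <= hess_const * T.
Proof.
set H := h2seminorm D p.
have Lh i j : inL2 D (hess p i j) by apply: C1_inL2; exact: (poly_C1 (hess_poly i j)).
have [H1 H2] := Hxi; have Lw i j : inL2 D (weak_hess D xi i j) by exact: weak_pd_inL2.
have S0 : 0 <= \sum_(i < 2) \sum_(j < 2) N (hess p i j) ^+ 2.
  by do 2 (apply: sumr_ge0 => ? _); exact: sqr_ge0.
have HE : H ^+ 2 = \sum_(i < 2) \sum_(j < 2) dint D (fun x => weak_hess D xi i j x * hess p i j x).
  have [Pk Pq _ _] := Pp; rewrite -hess_form_sum// -Pq// hess_form_sum// /H sqr_sqrtr//.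
  by apply: eq_bigr => i _; apply: eq_bigr => j _; rewrite (l2norm_sqr FD).
set A := 4 * K ^+ 2 + 2 * trace_const * K.
have A0 : 0 <= A by rewrite addr_ge0// !mulr_ge0 ?sqr_ge0 ?trace_const_ge0.
have b i j : dint D (fun x => weak_hess D xi i j x * hess p i j x) <= A * (T * H / h ^+ 2).
  rewrite (le_trans (ler_norm _))// (le_trans (weak_hess_le i j))// -/A ler_wpM2l//.
  by rewrite ler_wpM2r ?invr_ge0 ?exprn_ge0 ?(ltW h0)// ler_wpM2l// hess_le.
have le : H ^+ 2 <= 4 * A * T * H / h ^+ 2.
  rewrite HE (_ : 4 * A * T * H / h ^+ 2 = 4 * (A * (T * H / h ^+ 2))); last by ring.
  exact: sum2_le.
(* [le] is quadratic in [H] on the left and linear on the right, so one factor is divided out. *)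
have [->|Hn] := eqVneq H 0; first by rewrite mulr0 /hess_const -/A !mulr_ge0.
have Hp : 0 < H by rewrite lt_neqAle eq_sym Hn sqrtr_ge0.
rewrite -(ler_pM2r Hp) /hess_const -/A [leLHS](_ : _ = H ^+ 2 * h ^+ 2); last by ring.
by rewrite -ler_pdivlMr ?exprn_gt0.
Qed.

(** The two terms of [mean_bound] for a first derivative of [p]: its boundary mean, and its
    oscillation controlled through the inverse estimate by the second derivatives. [value_const]
    arises in the same way one order lower. *)
Definition grad_const := trace_const / rho + 4 * K * hess_const.

Lemma hess_const_ge0 : 0 <= hess_const.
Proof. by rewrite /hess_const mulr_ge0// addr_ge0// !mulr_ge0 ?sqr_ge0 ?trace_const_ge0. Qed.

(** [boundary_le] with all weights and the polynomial equal to 1; [j] is a natural number so that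
    constants belong to the space. *)
Lemma bint_le u (j : nat) (B : R) : inH1 D u -> is_trace v D u (trace v D u) -> 0 <= B ->
  h * edge_sum j%:Z (trace v D u) <= B ^+ 2 -> `|bint v (trace v D u)| <= trace_const * B.
Proof.
move=> Hu [Lu _] B0 SB; have P1 : poly_space j%:Z (fun=> 1 : R).
  have := @poly_space_mono R j%:Z 0 0 isT; congr poly_space.
  by apply/funext => x; rewrite /mono !expr0 mulr1.
rewrite (_ : bint v _ = \sum_(e < n) 1 * eint v e (fun x => trace v D u x * 1)); last first.
  by apply: eq_bigr => e _; rewrite mul1r; congr (eint _ _ _); apply/funext => x; rewrite mulr1.
rewrite -[leRHS]mulr1.
by apply: (@boundary_le (fun=> 1) _ _ _ B 1 _ Lu P1 ler01 B0 _ SB) => *; rewrite normr1.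
Qed.

Lemma pd_le i x : near_center x -> `|pd i p x| <= grad_const * T / h ^+ 2.
Proof.
move=> Nx; have [Pk _ /(_ i)[g [tg pg]] _] := Pp; have [H1 H2] := Hxi.
have H2p : h2seminorm D p <= hess_const * T / h ^+ 2.
  by rewrite ler_pdivlMr ?exprn_gt0// mulrC h2seminorm_le.
have M0 : 0 <= K / h * (hess_const * T / h ^+ 2).
  exact: mulr_ge0 (divr_ge0 K0 (ltW h0)) (divr_ge0 (mulr_ge0 hess_const_ge0 T0) (exprn_ge0 2 (ltW h0))).
have Cp : C1 (pd i p) by exact: poly_C1 (poly_pd i Pk).
have dle j y : near_center y -> `|pd j (pd i p) y| <= K / h * (hess_const * T / h ^+ 2).
  move=> Ny; have Ph : poly_space k%:Z (pd j (pd i p)) := poly_space_le (deg k 2) (hess_poly j i).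
  rewrite (le_trans (inverse Ph Ny).1)// ler_wpM2l ?divr_ge0 ?(ltW h0)//.
  by rewrite (le_trans _ H2p)//; exact: hess_le.
have bi : `|bint v (pd i p)| <= trace_const * T / h ^+ 2 * h.
  (* The trace [g] named in [is_PiDelta] is exchanged for the chosen one, which the triple norm
     measures. *)
  rewrite pg (_ : bint v g = bint v (trace v D (weak_pd D i xi))); last first.
    by apply: eq_bigr => e _; exact: (trace_unique (H2 i) tg (tr_pd i)).
  rewrite (_ : _ * h = trace_const * (T / h)); last by field.
  apply: (@bint_le _ r.-1 _ (H2 i) (tr_pd i) Th0).
  by rewrite (predn_int r_gt0); exact: edge_pd_le.
rewrite (le_trans (mean_bound Cp M0 dle bi Nx))// /grad_const.
rewrite le_eqVlt; apply/orP; left; apply/eqP; field; rewrite hN0/=; exact: lt0r_neq0.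
Qed.

Definition value_const := trace_const / rho + 4 * grad_const.

Lemma grad_const_ge0 : 0 <= grad_const.
Proof. exact: addr_ge0 (divr_ge0 trace_const_ge0 (ltW rho0)) (mulr_ge0 (mulr_ge0 (ler0n _ 4) K0) hess_const_ge0). Qed.

Lemma value_le x : near_center x -> `|p x| <= value_const * T / h.
Proof.
move=> Nx; have [Pk _ _ [g [tg pg]]] := Pp; have [H1 H2] := Hxi.
have M0 : 0 <= grad_const * T / h ^+ 2 by exact: divr_ge0 (mulr_ge0 grad_const_ge0 T0) (exprn_ge0 2 (ltW h0)).
have bp : `|bint v p| <= trace_const * T / h * h.
  rewrite pg (_ : bint v g = bint v (trace v D xi)); last first.
    by apply: eq_bigr => e _; exact: (trace_unique H1 tg tr).
  by rewrite divfK//; apply: bint_le edge_le.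
rewrite (le_trans (mean_bound (poly_C1 Pk) M0 (fun i y => pd_le i (x := y)) bp Nx))// /value_const.
rewrite le_eqVlt; apply/orP; left; apply/eqP; field; rewrite hN0/=; exact: lt0r_neq0.
Qed.

(** Pointwise bounds on the square become L^2 bounds at the cost of [2 * h]; the gradient has two
    components. *)
Lemma main_bound :
  N p + h * h1seminorm D p + h ^+ 2 * h2seminorm D p <= (2 * value_const + 4 * grad_const + hess_const) * T.
Proof.
have [Pk _ _ _] := Pp; have [cp _ cdp] := poly_C1 Pk.
have value_const_ge0 : 0 <= value_const by exact: addr_ge0 (divr_ge0 trace_const_ge0 (ltW rho0)) (mulr_ge0 (ler0n _ 4) grad_const_ge0).
have M3 : 0 <= value_const * T / h by exact: divr_ge0 (mulr_ge0 value_const_ge0 T0) (ltW h0).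
have M2 : 0 <= grad_const * T / h ^+ 2 by exact: divr_ge0 (mulr_ge0 grad_const_ge0 T0) (exprn_ge0 2 (ltW h0)).
have n0 : N p <= 2 * value_const * T.
  by rewrite (le_trans (sup_l2norm cp M3 value_le))// le_eqVlt; apply/orP; left; apply/eqP; field.
have nd i : N (pd i p) <= 2 * grad_const * T / h.
  rewrite (le_trans (sup_l2norm (cdp i) M2 (pd_le i)))//.
  by rewrite le_eqVlt; apply/orP; left; apply/eqP; field.
have n1 : h * h1seminorm D p <= 4 * grad_const * T.
  rewrite mulrC -ler_pdivlMr// (_ : 4 * _ * _ / _ = 2 * grad_const * T / h + 2 * grad_const * T / h); last by field.
  rewrite (le_trans _ (lerD (nd 0) (nd 1)))// -ler_sqr ?nnegrE ?sqrtr_ge0 ?addr_ge0//.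
  rewrite /h1seminorm sqr_sqrtr; last by apply: sumr_ge0 => i _; exact: sqr_ge0.
  by rewrite sum2 sqrrD -/(N _) -/(N _) -addrA [X in _ <= _ + X]addrC addrA lerDl mulrn_wge0// mulr_ge0.
have := h2seminorm_le; lra.
Qed.

End Estimates.

Lemma le_of_sqr_le (R : realType) (a b : R) : 0 <= b -> a ^+ 2 <= b ^+ 2 -> a <= b.
Proof.
move=> b0 ab; apply: (le_trans (ler_norm a)).
by rewrite -(ger0_norm b0) -!sqrtr_sqr ler_wsqrtr.
Qed.

Section Vanishing.
Variables (R : realType) (D : set (R * R)).

Lemma l2norm_cst0 : l2norm (dint D) (cst 0) = 0.
Proof.
rewrite /l2norm (_ : (fun x => _) = cst 0); last by apply/funext => x; rewrite /= expr0n.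
by rewrite /dint /Rintegral integral0 sqrtr0.
Qed.

Lemma pd_cst0 i : pd i (cst 0 : R * R -> R) = cst 0.
Proof. by apply/funext => x; exact: pd_cst. Qed.

Lemma seminorms_cst0 : [/\ l2norm (dint D) (cst 0) = 0, h1seminorm D (cst 0) = 0 &
  h2seminorm D (cst 0) = 0].
Proof.
split; first exact: l2norm_cst0.
  by rewrite /h1seminorm big1 ?sqrtr0// => i _; rewrite pd_cst0 l2norm_cst0 expr0n.
rewrite /h2seminorm big1 ?sqrtr0// => i _; rewrite big1// => j _.
by rewrite /hess !pd_cst0 l2norm_cst0 expr0n.
Qed.

End Vanishing.

Lemma triple_norm_bounds (R : realType) k r n (v : 'I_n -> R * R) (D : set (R * R)) xi
    (T := triple_norm k r v D xi) : 0 < diam D ->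
  [/\ l2norm (dint D) (l2proj (dint D) (k%:Z - 4) xi) <= T,
      diam D * edge_sum v r%:Z (trace v D xi) <= T ^+ 2 &
      forall i, diam D * edge_sum v (r%:Z - 1) (trace v D (weak_pd D i xi)) <= (T / diam D) ^+ 2].
Proof.
move=> h0; have hge := ltW h0.
pose a := l2norm (dint D) (l2proj (dint D) (k%:Z - 4) xi).
pose S0 := edge_sum v r%:Z (trace v D xi).
pose S1 := \sum_(e < n) \sum_(i < 2)
  l2norm (eint v e) (l2proj (eint v e) (r%:Z - 1) (trace v D (weak_pd D i xi))) ^+ 2.
have S00 : 0 <= diam D * S0 by rewrite mulr_ge0// sumr_ge0// => e _; exact: sqr_ge0.
have S10 : 0 <= diam D ^+ 3 * S1.
  by rewrite mulr_ge0 ?exprn_ge0//; do 2 (apply: sumr_ge0 => ? _); exact: sqr_ge0.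
have a0 : 0 <= a ^+ 2 by exact: sqr_ge0.
have T2 : T ^+ 2 = a ^+ 2 + diam D * S0 + diam D ^+ 3 * S1.
  by rewrite sqr_sqrtr// !addr_ge0.
split.
- by apply: le_of_sqr_le; [exact: sqrtr_ge0|rewrite T2 -/a; lra].
- by rewrite T2 -/S0; lra.
(* The weight [h ^+ 3] of the triple norm is split as [h * h ^+ 2], which explains [T / h] on the
   right. *)
- move=> i; rewrite expr_div_n ler_pdivlMr ?exprn_gt0// T2.
  apply: (@le_trans _ _ (diam D ^+ 3 * S1)); last lra.
  rewrite [leLHS](_ : _ = diam D ^+ 3 * edge_sum v (r%:Z - 1) (trace v D (weak_pd D i xi))); last by ring.
  rewrite ler_wpM2l ?exprn_ge0//; apply: ler_sum => e _.
  by rewrite (bigD1 i)//= lerDl sumr_ge0// => j _; exact: sqr_ge0.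
Qed.

Unset Implicit Arguments.

Theorem lemma2p10 (R : realType) (k : nat) (rho : R)
    (k_ge2 : (2 <= k)%N) (rho_gt0 : 0 < rho) (rho_lt1 : rho < 1) :
  exists C : R,
    forall (r : nat), (maxn 3 k <= r)%N ->
    forall (n : nat) (v : 'I_n -> R * R) (D : set (R * R)),
    polygon v D -> shape_regular rho v D ->
    forall xi : R * R -> R, inH2 D xi ->
      l2norm (dint D) (PiDelta k v D xi)
      + diam D * h1seminorm D (PiDelta k v D xi)
      + diam D ^+ 2 * h2seminorm D (PiDelta k v D xi)
      <= C * triple_norm k r v D xi.
Proof.
have [K K0 inv] := inverse_estimate k rho_gt0.
(* [K] was obtained from [k] and [rho] alone, before [r], the polygon and [xi] are introduced. *)
exists (2 * value_const rho K + 4 * grad_const rho K + hess_const rho K) => r kr n v D polyD [long [c starD]] xi Hxi.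
have C1ge := hess_const_ge0 rho K0; have C2ge := grad_const_ge0 rho_gt0 K0.
have C3ge : 0 <= value_const rho K.
  exact: addr_ge0 (divr_ge0 (trace_const_ge0 rho) (ltW rho_gt0)) (mulr_ge0 (ler0n _ 4) C2ge).
have [n3 _ oD /boxedP bD _] := polyD.
have h0 := diam_gt0 oD bD (star_nonempty polyD).
have s0 : 0 < rho * diam D by rewrite mulr_gt0.
have Dc := star_center polyD s0 starD.
have near x : closure D x -> `|x.1 - c.1| <= diam D /\ `|x.2 - c.2| <= diam D.
  exact: closure_near bD Dc erefl.
have Enear e (t : R) : 0 <= t <= 1 -> near_center D c (edge_pt v e t).
  by move=> t1; apply: near; have [] := edge_pt_bd polyD e t1.
have Dnear x : D x -> near_center D c x by move=> Dx; apply: near; exact: subset_closure.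
have [nu [nu1 gr rad]] := green polyD s0 starD.
have T0 : 0 <= triple_norm k r v D xi by exact: sqrtr_ge0.
have [proj_le edge_le edge_pd_le] := triple_norm_bounds k r v xi h0.
(* If the definition has a solution, [PiDelta] is one, and [main_bound] applies to any solution. *)
have [Ex|NEx] := pselect (exists p, is_PiDelta k v D xi p).
  apply: (main_bound rho_gt0 K0 (ltnW (ltnW n3)) oD bD h0 Dnear Enear long nu1 gr rad _ T0 Hxi
    kr proj_le edge_le edge_pd_le (xgetPex (cst 0) Ex)).
  by move=> q Pq x [x1 x2]; exact: inv (disc_sub polyD starD) h0 Pq x x1 x2.
(* [PiDelta] is [0] by convention when no polynomial satisfies its definition. *)
have -> : PiDelta k v D xi = cst 0.
  by apply: xgetPN => p Pp; apply: NEx; exists p.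
have [-> -> ->] := seminorms_cst0 D.
by rewrite !mulr0 !addr0 mulr_ge0// !addr_ge0// mulr_ge0.
Qed.
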